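(* Let $\nu>0$ and let $u_0\in H^1(0,1)$ satisfy $u_0>0$, $\int_0^1u_0\,dx=1$ and $$R_0:=\|(u_0^{-1})_x\|_2<\infty .$$ Let $f_0\in L^2(0,1)$ satisfy $\int_0^1 f_0(x)\,dx=0$ and put $$P_0:=\Bigl\|\int_0^x f_0(s)\,ds\Bigr\|_2<\infty .$$ Assume in addition that $$R_0\in[0,1)\quad\text{and}\quad \nu\in\Bigl(\frac{2P_0}{1-R_0},+\infty\Bigr).$$ Then a weak solution $u(x,t)$ to the problem $$u_t=\nu(u^{-2}u_x)_x+f_0(x)\ \text{ in } Q_T,\qquad u_x(0,t)=u_x(1,t)=0\ \text{ for } t\in(0,T),\qquad u(x,0)=u_0(x)\ \text{ for } x\in(0,1),$$ considered together with the mass constraint $\int_0^1u(x,t)\,dx=1$ for all $t$, satisfies $$0<\frac{\nu}{\nu(1+R_0)+2P_0}\leqslant u(x,t)\leqslant\frac{\nu}{\nu(1-R_0)-2P_0}<\infty\quad\text{for all }(x,t)\in Q_T .$$ Moreover, $u^{-1}(\cdot,t)$ converges to $u_\infty^{-1}$, where $u_\infty$ is the steady state defined in the context, namely $$\|u^{-1}(\cdot,t)-u_\infty^{-1}\|_{H^1}\leqslant\|u_0^{-1}-u_\infty^{-1}\|_{H^1}\exp\Bigl\{-\frac{\pi^2t}{\nu}\,[\nu(1-R_0)-2P_0]^2\Bigr\}\quad\text{for all }t>0 .$$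
   Context: $Q_T:=(0,1)\times(0,T)$, with $T>0$ arbitrary. $\|\cdot\|_2$ is the norm of $L^2(0,1)$ in the variable $x$, and $\|\cdot\|_{H^1}$ is the norm of $H^1(0,1)$. The steady state $u_\infty\in H^2(0,1)$ is the positive function $$u_\infty(x)=\frac{\nu}{\int_0^x\int_0^y f_0(s)\,ds\,dy+C_\nu}>0,$$ where $C_\nu$ is the unique constant (making $u_\infty$ positive) such that $$\int_0^1\Bigl[\int_0^x\int_0^y f_0(s)\,ds\,dy+C_\nu\Bigr]^{-1}dx=\nu^{-1},$$ i.e. such that $\int_0^1u_\infty\,dx=1$. ''Weak solution'' is understood in the usual sense for this initial boundary value problem. *)

(* Defs.v *)
From HB Require Import structures.
From mathcomp Require Export all_boot all_order all_algebra.
From mathcomp Require Export all_classical all_reals all_analysis.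

Set Implicit Arguments.
Unset Strict Implicit.
Unset Printing Implicit Defensive.

Import Order.TTheory GRing.Theory Num.Theory.
Import numFieldNormedType.Exports.

Local Open Scope classical_set_scope.
Local Open Scope ring_scope.

(* The functions of one space variable are total functions R -> R of which only
   the restriction to (0,1) matters. *)

Definition I01 {R : realType} : set R := `]0, 1[.

Definition in_L2 {R : realType} (f : R -> R) : Prop :=
  f \_ I01 \in Lfun (@lebesgue_measure R) 2%:E.

Definition L2norm {R : realType} (f : R -> R) : R :=
  fine ('N[@lebesgue_measure R]_2%:E [EFin \o (f \_ I01)])%E.

Definition C1c {R : realType} (phi : R -> R) : Prop :=
  [/\ forall x, derivable phi x 1,
      continuous (derive1 phi) &
      exists a b : R, [/\ 0 < a, b < 1 &
        forall x, ~~ (a <= x <= b) -> phi x = 0]].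

Definition weak_deriv {R : realType} (f g : R -> R) : Prop :=
  [/\ locally_integrable I01 f, locally_integrable I01 g &
      forall phi, C1c phi ->
        \int[lebesgue_measure]_(x in I01) (f x * derive1 phi x) =
        - \int[lebesgue_measure]_(x in I01) (g x * phi x)].

Definition has_L2_deriv {R : realType} (f : R -> R) : Prop :=
  exists g, in_L2 g /\ weak_deriv f g.

(* A chosen square-integrable weak derivative (unique up to null sets); it is
   meaningful only under [has_L2_deriv f]. *)
Definition wderiv {R : realType} (f : R -> R) : R -> R :=
  xget (fun=> 0) [set g | in_L2 g /\ weak_deriv f g].

Definition in_H1 {R : realType} (f : R -> R) : Prop :=
  in_L2 f /\ has_L2_deriv f.

Definition H1norm {R : realType} (f : R -> R) : R :=
  Num.sqrt (L2norm f ^+ 2 + L2norm (wderiv f) ^+ 2).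

Definition primitive {R : realType} (f : R -> R) (x : R) : R :=
  \int[lebesgue_measure]_(s in `[0, x]) f s.

Definition R_0 {R : realType} (u0 : R -> R) : R :=
  L2norm (wderiv (fun x => (u0 x)^-1)).

Definition P_0 {R : realType} (f0 : R -> R) : R := L2norm (primitive f0).

Definition is_C_nu {R : realType} (nu : R) (f0 : R -> R) (C : R) : Prop :=
  (forall x, 0 <= x <= 1 -> 0 < primitive (primitive f0) x + C) /\
  \int[lebesgue_measure]_(x in I01) (primitive (primitive f0) x + C)^-1
    = nu^-1.

Definition u_inf {R : realType} (nu : R) (f0 : R -> R) (C x : R) : R :=
  nu / (primitive (primitive f0) x + C).

Definition Q {R : realType} (T : \bar R) : set (R * R) :=
  [set z | [/\ 0 < z.1 < 1, 0 < z.2 & (z.2%:E < T)%E]].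

Definition leb2 {R : realType} :=
  (@lebesgue_measure R \x @lebesgue_measure R)%E.

Definition in_L2Q {R : realType} (T : R) (w : R -> R -> R) : Prop :=
  (fun z : R * R => w z.1 z.2) \_ (Q T%:E) \in Lfun (@leb2 R) 2%:E.

Definition d_x {R : realType} (phi : R -> R -> R) (x t : R) : R :=
  derive1 (phi ^~ t) x.

Definition d_t {R : realType} (phi : R -> R -> R) (x t : R) : R :=
  derive1 (phi x) t.

(* C^1 functions vanishing for t >= T; no condition is put on x = 0 and x = 1,
   which is what makes the Neumann condition part of the weak formulation. *)
Definition test_fun {R : realType} (T : R) (phi : R -> R -> R) : Prop :=
  [/\ forall x t, derivable (phi ^~ t) x 1 /\ derivable (phi x) t 1,
      continuous (fun z : R * R => phi z.1 z.2),
      continuous (fun z : R * R => d_x phi z.1 z.2),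
      continuous (fun z : R * R => d_t phi z.1 z.2) &
      forall x t, T <= t -> phi x t = 0].

(* Weak solutions on Q_T for finite T, with spatial weak derivative ux:
   u belongs to L^2(0,T; H^1(0,1)) and the flux to L^2(Q_T).  As an element of
   that space u is determined up to null sets only, so every requirement is
   insensitive to a modification of u on a null set. *)
Definition weak_solution {R : realType} (nu : R) (f0 u0 : R -> R) (T : R)
    (u : R -> R -> R) : Prop :=
  exists ux : R -> R -> R,
  [/\ [/\ in_L2Q T u, in_L2Q T ux &
          {ae @lebesgue_measure R, forall t, 0 < t < T ->
            weak_deriv (u ^~ t) (ux ^~ t)}],
      {ae @leb2 R, forall z, Q T%:E z -> 0 < u z.1 z.2},
      in_L2Q T (fun x t => (u x t) ^- 2 * ux x t),
      (forall phi, test_fun T phi ->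
        \int[leb2]_(z in Q T%:E)
           (- (u z.1 z.2 * d_t phi z.1 z.2)
            + nu * ((u z.1 z.2) ^- 2 * ux z.1 z.2) * d_x phi z.1 z.2)
        = \int[leb2]_(z in Q T%:E) (f0 z.1 * phi z.1 z.2)
          + \int[lebesgue_measure]_(x in I01) (u0 x * phi x 0)) &
      {ae @lebesgue_measure R, forall t, 0 < t < T ->
        \int[lebesgue_measure]_(x in I01) u x t = 1}].

(* For finite T this amounts to [weak_solution nu f0 u0 T u]; T = +oo gives the
   solutions global in time. *)
Definition weak_solution_upto {R : realType} (nu : R) (f0 u0 : R -> R)
    (T : \bar R) (u : R -> R -> R) : Prop :=
  forall S : R, 0 < S -> (S%:E <= T)%E -> weak_solution nu f0 u0 S u.

Definition continuous_representative {R : realType} (T : \bar R)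
    (u v : R -> R -> R) : Prop :=
  {in Q T, continuous (fun z : R * R => v z.1 z.2)} /\
  {ae @leb2 R, forall z, Q T z -> v z.1 z.2 = u z.1 z.2}.

(* Main.v *)
(* Let p = 1/u, let pinf = 1/u_inf, write U(x,t) for the integral of u(.,t)
   over [0,x] and F for the primitive of f0.  Since nu pinf' = F, the equation
   integrates in x to U_t = G with G = F - nu p_x = - nu (p - pinf)_x.

   The map p_x -> U is monotone, because the L^2 product of two differences
   (p1 - p2)_x and U1 - U2 is the integral of (p1 - p2)^2 / (p1 p2).  Hence the
   increments U(t+h) - U(t) decrease in L^2, so |G(t)| <= |G(0)|, and
   |p_x(t)| <= R_0 + 2 P_0 / nu =: r < 1.  As p takes the value 1 somewhere,
   |p - 1| <= r, which is the pointwise bound.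

   For the decay put q = p - pinf, which obeys q_t = nu p^2 q_xx; the energy
   |q|^2 + |q_x|^2 is differentiated along difference quotients of the curve U
   in L^2 (q_x is only square integrable).  The mass constraint makes q vanish
   somewhere and gives q a Poincare inequality, and with p >= 1 - 3r/5 the
   dissipation exceeds 2 nu pi^2 (1-r)^2 times the energy. *)

(* The obstacle is regularity. A weak solution gives [u] and its flux up to null sets, with no a
   priori bound on [u] and no time derivative. What is controlled is the primitive [U]: testing the
   equation shows that [U(t) - U(s)] is the time integral of [G] for [s], [t] in a set [A] of full
   measure, to which time 0 is added. Chain rules are replaced by inequalities between nearby times
   of [A], summed along chains. Positivity at a fixed time comes from the flux: [1/u] has the
   square-integrable derivative [- u^-2 u_x], hence a continuous version. Weak limits of difference
   quotients are obtained without compactness: their primitives converge at countably many points,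
   and a limit is built from elements of nearly least norm. The constant 3/5 is a rational upper
   bound for [1/sqrt 3], the sharp factor between [|p_x|] and the uniform distance of [p] from its
   mean. The cruder bound [p >= 1 - r] would leave this argument nothing to absorb the cross term of
   the energy identity when [r] is near 1. *)
Require Import Defs.
From mathcomp Require Import measurable_realfun ring lra.
Set Implicit Arguments.
Unset Strict Implicit.
Unset Printing Implicit Defensive.
Import Order.TTheory GRing.Theory Num.Theory.
Import numFieldNormedType.Exports.
Local Open Scope classical_set_scope.
Local Open Scope ring_scope.

(* [lra] tries to unify every hypothesis with a comparison, which is slow in
   the large contexts below; the irrelevant ones are dropped first.  (It
   rejects contexts from which a section variable has been cleared.) *)
Ltac linarith :=
  repeat match goal with
  | H : ?T |- _ => lazymatch T with
    | is_true _ => fail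
    | _ = _ => fail
    | _ /\ _ => fail
    | _ => clear H
    end
  end; lra.

(** * Real-valued integrals and the space L^2(0,1) *)

Section RealIntegral.
Context d (T : measurableType d) (R : realType) (mu : {measure set T -> \bar R}).
Implicit Types (D E : set T) (f g h : T -> R).

Definition itg D f := mu.-integrable D (EFin \o f).

Lemma itg_meas D f : itg D f -> measurable_fun D f.
Proof. by move=> /integrableP[mf _]; exact/measurable_EFinP. Qed.

Lemma itg_ext D f g : measurable D -> (forall x, D x -> f x = g x) -> itg D f -> itg D g.
Proof.
move=> mD fg; apply: eq_integrable => // x /set_mem Dx.
by rewrite /= fg.
Qed.

Lemma itgS D E f : measurable D -> measurable E -> E `<=` D ->
  itg D f -> itg E f.
Proof. by move=> mD mE ED; apply: integrableS. Qed.

Lemma itgD D f g : measurable D -> itg D f -> itg D g ->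
  itg D (fun x => f x + g x).
Proof. by move=> mD fi gi; apply: (integrableD mD fi gi). Qed.

Lemma itgZ D k f : measurable D -> itg D f -> itg D (fun x => k * f x).
Proof. by move=> mD fi; apply: (integrableZl mD k fi). Qed.

Lemma itgN D f : measurable D -> itg D f -> itg D (fun x => - f x).
Proof. by move=> mD fi; apply: (integrableN fi). Qed.

Lemma itgB D f g : measurable D -> itg D f -> itg D g ->
  itg D (fun x => f x - g x).
Proof. by move=> mD fi gi; apply: itgD => //; exact: itgN. Qed.

Lemma itg_le D f g : measurable D -> measurable_fun D f -> itg D g ->
  (forall x, D x -> `|f x| <= g x) -> itg D f.
Proof.
move=> mD mf gi fg; apply: (le_integrable mD _ _ gi).
  exact/measurable_EFinP.
move=> x Dx; rewrite /= lee_fin (le_trans (fg _ Dx))//.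
by rewrite ler_norm.
Qed.

Lemma itg_norm D f : measurable D -> itg D f -> itg D (fun x => `|f x|).
Proof. by move=> mD fi; apply: integrable_norm. Qed.

Lemma itg_cst D k : measurable D -> (mu D < +oo)%E -> itg D (fun=> k).
Proof.
move=> mD Dfin; apply: measurable_bounded_integrable => //.
exists `|k|; split; first exact: num_real.
by move=> y ky x Dx /=; exact: ltW.
Qed.

Lemma itg_mulbd D f h (M : R) : measurable D -> itg D f -> measurable_fun D h ->
  (forall x, D x -> `|h x| <= M) -> itg D (fun x => h x * f x).
Proof.
move=> mD fi mh hM; apply: (@itg_le _ _ (fun x => M * `|f x|)) => //.
- by apply: measurable_funM => //; exact: itg_meas.
- by apply: itgZ => //; exact: itg_norm.
- by move=> x Dx; rewrite normrM ler_wpM2r// hM.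
Qed.

Lemma Rint_ext D f g : (forall x, D x -> f x = g x) ->
  \int[mu]_(x in D) f x = \int[mu]_(x in D) g x.
Proof. by move=> fg; apply: eq_Rintegral => x /set_mem; exact: fg. Qed.

Lemma Rint0 D : \int[mu]_(x in D) (0 : R) = 0.
Proof. by rewrite /Rintegral integral0. Qed.

Lemma RintN D f : measurable D -> itg D f ->
  \int[mu]_(x in D) (- f x) = - \int[mu]_(x in D) f x.
Proof.
move=> mD fi; under eq_Rintegral do rewrite -mulN1r.
by rewrite RintegralZl// mulN1r.
Qed.

Lemma Rint_ae_eq D f g : measurable D -> measurable_fun D f ->
  measurable_fun D g -> {ae mu, forall x, D x -> f x = g x} ->
  \int[mu]_(x in D) f x = \int[mu]_(x in D) g x.
Proof.
move=> mD mf mg fg; rewrite /Rintegral; congr fine.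
apply: ae_eq_integral => //; try exact/measurable_EFinP.
by apply: filterS fg => x fg Dx /=; rewrite fg.
Qed.

Lemma itg_ae D f g : measurable D -> itg D f -> measurable_fun D g ->
  {ae mu, forall x, D x -> f x = g x} -> itg D g.
Proof.
move=> mD fi mg fg; apply/integrableP; split; first exact/measurable_EFinP.
have /integrableP[mf flt] := fi.
rewrite (@ae_eq_integral _ _ _ mu D (abse \o (EFin \o f))) //.
- by apply: measurableT_comp => //; exact/measurable_EFinP.
- exact: measurableT_comp.
- by apply: filterS fg => x fg Dx /=; rewrite fg.
Qed.

Lemma Rint_ae_le D f g : measurable D -> itg D f -> itg D g ->
  {ae mu, forall x, D x -> f x <= g x} ->
  \int[mu]_(x in D) f x <= \int[mu]_(x in D) g x.
Proof.
move=> mD fi gi fg; rewrite -subr_ge0 -RintegralB//.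
have -> : \int[mu]_(x in D) (g x - f x) = \int[mu]_(x in D) `|g x - f x|.
  have gfi : itg D (fun x => g x - f x) by exact: itgB.
  apply: Rint_ae_eq => //.
  - exact: itg_meas gfi.
  - exact/itg_meas/itg_norm.
  - by apply: filterS fg => x h Dx; rewrite ger0_norm// subr_ge0 h.
by apply: Rintegral_ge0 => x _.
Qed.

Lemma Rint_eq0_ae D f : measurable D -> itg D f ->
  (forall x, D x -> 0 <= f x) -> \int[mu]_(x in D) f x <= 0 ->
  {ae mu, forall x, D x -> f x = 0}.
Proof.
move=> mD fi f0 If.
have mf : measurable_fun D (EFin \o f) by exact: (measurable_int mu).
have H : (\int[mu]_(x in D) `|(EFin \o f) x| = 0)%E.
  have -> : (\int[mu]_(x in D) `|(EFin \o f) x| = \int[mu]_(x in D) (f x)%:E)%E.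
    by apply: eq_integral => x /set_mem Dx /=; rewrite ger0_norm// f0.
  have := integrable_fin_num mD fi; move=> /fineK <-.
  congr EFin; apply/eqP; rewrite eq_le If/=.
  exact: Rintegral_ge0.
move/(ae_eq_integral_abs _ mD mf) : H.
by apply: filterS => x /= h Dx; have := h Dx => -[].
Qed.

Lemma le_normr_Rint D f g : measurable D -> itg D f -> itg D g ->
  {ae mu, forall x, D x -> `|f x| <= g x} ->
  `|\int[mu]_(x in D) f x| <= \int[mu]_(x in D) g x.
Proof.
move=> mD fi gi fg; apply: (le_trans (le_normr_Rintegral mD fi)).
apply: Rint_ae_le => //; exact: itg_norm.
Qed.

Lemma Rint_dct D (f_ : nat -> T -> R) f g : measurable D ->
  (forall n, measurable_fun D (f_ n)) -> measurable_fun D f -> itg D g ->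
  {ae mu, forall x, D x -> f_ n x @[n --> \oo] --> f x} ->
  (forall n, {ae mu, forall x, D x -> `|f_ n x| <= g x}) ->
  itg D f /\ \int[mu]_(x in D) f_ n x @[n --> \oo] --> \int[mu]_(x in D) f x.
Proof.
move=> mD mf_ mf gi fcvg fg.
have /= := @dominated_convergence _ T R mu D mD (fun n => EFin \o f_ n)
  (EFin \o f) (EFin \o g).
case.
- by move=> n; exact/measurable_EFinP.
- exact/measurable_EFinP.
- apply: filterS fcvg => x h Dx.
  by apply: cvg_EFin; [exact: nearW|exact: h].
- exact: gi.
- have : {ae mu, forall x, forall n, D x -> `|f_ n x| <= g x}.
    by apply/ae_foralln => n; exact: fg.
  by apply: filterS => x h n Dx; rewrite /= lee_fin h.
move=> If _ Icvg; split=> //.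
rewrite /Rintegral; apply: fine_cvg.
rewrite fineK//.
exact: integrable_fin_num.
Qed.

End RealIntegral.

(** * Pairing and norm of L^2(0,1) *)

Section L2space.
Context {R : realType}.
Notation mu := (@lebesgue_measure R).
Implicit Types (f g h : R -> R).

(** Working form of [in_L2], to which [in_L2P] translates; it looks at functions on (0,1) only, so
    that no extension by 0 has to be carried along. *)
Definition L2 f := measurable_fun I01 f /\ itg mu I01 (fun x => f x ^+ 2).
Definition ip f g := \int[mu]_(x in I01) (f x * g x).
Definition nm f := Num.sqrt (ip f f).

Lemma ae_imply (P Q : R -> Prop) : {ae mu, forall x, P x} ->
  (forall x, P x -> Q x) -> {ae mu, forall x, Q x}.
Proof. by move=> aP PQ; apply: (@filterS _ _ (ae_filter_ringOfSetsType mu)) aP. Qed.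

Lemma ae_imply2 (P P' Q : R -> Prop) : {ae mu, forall x, P x} ->
  {ae mu, forall x, P' x} -> (forall x, P x -> P' x -> Q x) ->
  {ae mu, forall x, Q x}.
Proof.
by move=> aP aP' PQ; apply: (@filterS2 _ _ (ae_filter_ringOfSetsType mu)) aP aP'.
Qed.

Lemma mI01 : (R.-ocitv.-measurable).-sigma.-measurable (I01 : set R).
Proof. exact: measurable_itv. Qed.
Lemma mI01R : measurable (I01 : set R).
Proof. exact: measurable_itv. Qed.
Hint Resolve mI01 mI01R : core.

Lemma mu_I01 : mu I01 = 1%:E.
Proof. by rewrite /I01 lebesgue_measure_itv/= lte_fin ltr01 oppr0 adde0. Qed.

Lemma mu_I01_fin : (mu I01 < +oo)%E.
Proof. by rewrite mu_I01 ltey. Qed.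

Lemma L2_itgM f g : L2 f -> L2 g -> itg mu I01 (fun x => f x * g x).
Proof.
move=> [mf f2] [mg g2].
apply: (@itg_le _ _ R mu I01 _ (fun x => f x ^+ 2 + g x ^+ 2)) => //.
- exact: measurable_funM.
- exact: itgD.
- move=> x _; have := sqr_ge0 (f x - g x); have := sqr_ge0 (f x + g x).
  by rewrite ler_norml => h1 h2; apply/andP; split; nra.
Qed.

Lemma L2_bd h (M : R) : measurable_fun I01 h ->
  (forall x, I01 x -> `|h x| <= M) -> L2 h.
Proof.
move=> mh hM; split => //.
apply: (@itg_le _ _ R mu I01 _ (fun=> M ^+ 2)) => //.
- exact: measurable_funX.
- by apply: itg_cst => //; exact: mu_I01_fin.
- move=> x Ix; rewrite normrX ler_pXn2r ?nnegrE ?hM//.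
  exact: le_trans (hM _ Ix).
Qed.

Lemma L2_cst k : L2 (fun=> k).
Proof. by apply: (@L2_bd _ `|k|) => // x. Qed.

Lemma L2_itg f : L2 f -> itg mu I01 f.
Proof.
move=> f2; apply: itg_ext (L2_itgM f2 (L2_cst 1)) => // x _.
by rewrite mulr1.
Qed.

Lemma L2_mulbd f h (M : R) : L2 f -> measurable_fun I01 h ->
  (forall x, I01 x -> `|h x| <= M) -> L2 (fun x => h x * f x).
Proof.
move=> [mf f2] mh hM; split; first exact: measurable_funM.
apply: itg_ext (itg_mulbd _ f2 (measurable_funX 2 mh) (M := M ^+ 2) _) => //.
- by move=> x _; rewrite exprMn.
- move=> x Ix; rewrite normrX ler_pXn2r ?nnegrE ?hM//.
  exact: le_trans (hM _ Ix).
Qed.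

Lemma L2Z k f : L2 f -> L2 (fun x => k * f x).
Proof. by move=> f2; apply: (@L2_mulbd _ _ `|k|). Qed.

Lemma L2N f : L2 f -> L2 (fun x => - f x).
Proof.
move=> /(L2Z (-1)); under eq_fun do rewrite mulN1r; exact: id.
Qed.

Lemma L2D f g : L2 f -> L2 g -> L2 (fun x => f x + g x).
Proof.
move=> f2 g2; split; first by apply: measurable_funD; [exact: f2.1|exact: g2.1].
apply: itg_ext (itgD _ (itgD _ f2.2 g2.2) (itgZ 2 _ (L2_itgM f2 g2))) => //.
by move=> x _ /=; ring.
Qed.

Lemma L2B f g : L2 f -> L2 g -> L2 (fun x => f x - g x).
Proof. by move=> f2 g2; apply: L2D => //; exact: L2N. Qed.

Lemma L2_ae f g : L2 f -> measurable_fun I01 g ->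
  {ae mu, forall x, I01 x -> f x = g x} -> L2 g.
Proof.
move=> [mf f2] mg fg; split=> //; apply: itg_ae f2 _ _ => //.
  exact: measurable_funX.
by apply: ae_imply fg _ => x h Dx; rewrite h.
Qed.

Lemma L2_ext f g : (forall x, I01 x -> f x = g x) -> L2 f -> L2 g.
Proof.
move=> fg [mf f2]; split.
  by apply: eq_measurable_fun mf => x /set_mem; exact: fg.
by apply: itg_ext f2 => // x Ix; rewrite fg.
Qed.

Lemma ip_ext f g f' g' : (forall x, I01 x -> f x = f' x) ->
  (forall x, I01 x -> g x = g' x) -> ip f g = ip f' g'.
Proof. by move=> ff gg; apply: Rint_ext => x Ix; rewrite ff// gg. Qed.

Lemma ip_ae f g f' : L2 f -> L2 f' -> L2 g ->
  {ae mu, forall x, I01 x -> f x = f' x} -> ip f g = ip f' g.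
Proof.
move=> f2 f'2 g2 ff; apply: Rint_ae_eq => //.
- exact/itg_meas/L2_itgM.
- exact/itg_meas/L2_itgM.
- by apply: ae_imply ff _ => x h Dx; rewrite h.
Qed.

Lemma ipC f g : ip f g = ip g f.
Proof. by apply: Rint_ext => x _; rewrite mulrC. Qed.

Lemma ipDl f g h : L2 f -> L2 g -> L2 h ->
  ip (fun x => f x + g x) h = ip f h + ip g h.
Proof.
move=> f2 g2 h2; rewrite /ip -RintegralD//; try exact: L2_itgM.
by apply: Rint_ext => x _; rewrite mulrDl.
Qed.

Lemma ipZl k f h : L2 f -> L2 h -> ip (fun x => k * f x) h = k * ip f h.
Proof.
move=> f2 h2; rewrite /ip -RintegralZl//; last exact: L2_itgM.
by apply: Rint_ext => x _; rewrite mulrA.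
Qed.

Lemma ipNl f h : L2 f -> L2 h -> ip (fun x => - f x) h = - ip f h.
Proof.
move=> f2 h2; rewrite -mulN1r -ipZl//.
by apply: ip_ext => // x _; rewrite mulN1r.
Qed.

Lemma ipBl f g h : L2 f -> L2 g -> L2 h ->
  ip (fun x => f x - g x) h = ip f h - ip g h.
Proof. by move=> f2 g2 h2; rewrite ipDl ?ipNl//; exact: L2N. Qed.

Lemma ipDr f g h : L2 f -> L2 g -> L2 h ->
  ip f (fun x => g x + h x) = ip f g + ip f h.
Proof. by move=> f2 g2 h2; rewrite ipC ipDl// !(ipC f). Qed.

Lemma ipZr k f h : L2 f -> L2 h -> ip f (fun x => k * h x) = k * ip f h.
Proof. by move=> f2 h2; rewrite ipC ipZl// (ipC f). Qed.

Lemma ipBr f g h : L2 f -> L2 g -> L2 h ->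
  ip f (fun x => g x - h x) = ip f g - ip f h.
Proof. by move=> f2 g2 h2; rewrite ipC ipBl// !(ipC f). Qed.

Lemma ip_ge0 f : 0 <= ip f f.
Proof. by apply: Rintegral_ge0 => x _; rewrite -expr2 sqr_ge0. Qed.

Lemma ipDD f g : L2 f -> L2 g ->
  ip (fun x => f x + g x) (fun x => f x + g x) = ip f f + 2 * ip f g + ip g g.
Proof.
move=> f2 g2; have fg2 := L2D f2 g2.
by rewrite ipDl// !ipDr// (ipC g f); ring.
Qed.

Lemma ipBB f g : L2 f -> L2 g ->
  ip (fun x => f x - g x) (fun x => f x - g x) = ip f f - 2 * ip f g + ip g g.
Proof.
move=> f2 g2; have fg2 := L2B f2 g2.
by rewrite ipBl// !ipBr// (ipC g f); ring.
Qed.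

Lemma ipZZ k f : L2 f ->
  ip (fun x => k * f x) (fun x => k * f x) = k ^+ 2 * ip f f.
Proof. by move=> f2; rewrite ipZl ?ipZr ?mulrA ?expr2//; exact: L2Z. Qed.

Lemma ip_CS f g : L2 f -> L2 g -> ip f g ^+ 2 <= ip f f * ip g g.
Proof.
move=> f2 g2.
have H k : 0 <= ip f f - 2 * k * ip f g + k ^+ 2 * ip g g.
  have k2 := L2Z k g2.
  have := ip_ge0 (fun x => f x - k * g x).
  by rewrite ipBB// ipZZ// ipZr// mulrA.
(* When [ip g g = 0] the quadratic in [k] is affine; unless [ip f g = 0], the [k] chosen below gives
   it the value -1. *)
have g0 := ip_ge0 g; have [gz|gnz] := eqVneq (ip g g) 0.
  have := H (ip f f + 1); have := H (- (ip f f + 1)); rewrite gz !mulr0 !addr0.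
  move=> h1 h2; have f0 := ip_ge0 f.
  have [->|fg0] := eqVneq (ip f g) 0; first by rewrite expr0n.
  have := H ((ip f f + 1) / (2 * ip f g)); rewrite gz !mulr0 !addr0.
  have -> : 2 * ((ip f f + 1) / (2 * ip f g)) * ip f g = ip f f + 1 by field.
  by linarith.
have gp : 0 < ip g g by rewrite lt_neqAle eq_sym gnz.
have := H (ip f g / ip g g).
have -> : ip f f - 2 * (ip f g / ip g g) * ip f g
   + (ip f g / ip g g) ^+ 2 * ip g g = ip f f - ip f g ^+ 2 / ip g g by field.
by rewrite subr_ge0 ler_pdivrMr.
Qed.

Lemma nm_ge0 f : 0 <= nm f. Proof. exact: sqrtr_ge0. Qed.

Lemma nm_sq f : nm f ^+ 2 = ip f f.
Proof. by rewrite sqr_sqrtr// ip_ge0. Qed.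

Lemma ip_nm f g : L2 f -> L2 g -> `|ip f g| <= nm f * nm g.
Proof.
move=> f2 g2; rewrite -(@ler_pXn2r _ 2) ?nnegrE ?mulr_ge0 ?nm_ge0//.
by rewrite exprMn !nm_sq -normrX ger0_norm ?sqr_ge0// ip_CS.
Qed.

Lemma ip_le_nm f g : L2 f -> L2 g -> ip f g <= nm f * nm g.
Proof. by move=> f2 g2; apply: le_trans (ip_nm f2 g2); exact: ler_norm. Qed.

Lemma nm_le f (k : R) : 0 <= k -> (nm f <= k) = (ip f f <= k ^+ 2).
Proof. by move=> k0; rewrite -nm_sq ler_pXn2r ?nnegrE ?nm_ge0. Qed.

Lemma nmD f g : L2 f -> L2 g -> nm (fun x => f x + g x) <= nm f + nm g.
Proof.
move=> f2 g2; rewrite nm_le ?addr_ge0 ?nm_ge0// ipDD// -!nm_sq.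
by have := ip_le_nm f2 g2; nra.
Qed.

Lemma nmN f : L2 f -> nm (fun x => - f x) = nm f.
Proof.
move=> f2; congr Num.sqrt; apply: Rint_ext => x _; ring.
Qed.

Lemma nmB f g : L2 f -> L2 g -> nm (fun x => f x - g x) <= nm f + nm g.
Proof. by move=> f2 g2; rewrite -(nmN g2) nmD//; exact: L2N. Qed.

Lemma nmZ k f : L2 f -> nm (fun x => k * f x) = `|k| * nm f.
Proof.
by move=> f2; rewrite /nm ipZZ// sqrtrM ?sqr_ge0// sqrtr_sqr.
Qed.

Lemma nm_ext f g : (forall x, I01 x -> f x = g x) -> nm f = nm g.
Proof. by move=> fg; congr Num.sqrt; exact: ip_ext. Qed.

Lemma nm_ae f g : L2 f -> L2 g ->
  {ae mu, forall x, I01 x -> f x = g x} -> nm f = nm g.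
Proof.
move=> f2 g2 fg; congr Num.sqrt.
by rewrite (ip_ae f2 g2 f2 fg) ipC (ip_ae f2 g2 g2 fg).
Qed.

Lemma Rint_cst01 (k : R) : \int[mu]_(x in I01) k = k.
Proof. by rewrite Rintegral_cst// [X in fine X]mu_I01 mulr1. Qed.

Lemma ip_bd_le f (M : R) : measurable_fun I01 f ->
  (forall x, I01 x -> `|f x| <= M) -> ip f f <= M ^+ 2.
Proof.
move=> mf fM; rewrite -[leRHS]Rint_cst01; apply: le_Rintegral => //.
- by apply: L2_itgM; exact: L2_bd fM.
- by apply: itg_cst => //; exact: mu_I01_fin.
- move=> x Ix; rewrite -expr2 -[leLHS]ger0_norm ?sqr_ge0// normrX.
  rewrite ler_pXn2r ?nnegrE ?fM//; exact: le_trans (fM _ Ix).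
Qed.

End L2space.
#[global] Hint Resolve mI01 mI01R : core.

(** * Absolutely continuous functions *)

Section AbsoluteContinuity.
Context {R : realType}.
Notation mu := (@lebesgue_measure R).
Implicit Types (F G f g N A : R -> R).

(** Steps of length [delta] taken back from [y] reach [x] after finitely many; both sides add up
    along the chain. *)
Lemma chain_le (a b delta : R) N A : 0 < delta ->
  (forall x y, a <= x -> x <= y -> y <= b -> y - x <= delta ->
     `|N y - N x| <= A y - A x) ->
  forall x y, a <= x -> x <= y -> y <= b -> `|N y - N x| <= A y - A x.
Proof.
move=> d0 H x y ax xy yb.
have [n hn] : exists n : nat, y - x <= n%:R * delta.
  exists (Num.truncn ((y - x) / delta)).+1; rewrite -ler_pdivrMr// ltW//.
  by rewrite truncnS_gt.
elim: n x y ax xy yb hn => [|n IH] x y ax xy yb hn.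
  apply: H => //; apply: (le_trans hn); rewrite mul0r; exact: ltW.
have [yx|yx] := leP (y - x) delta; first exact: H.
have h1 : `|N (y - delta) - N x| <= A (y - delta) - A x.
  apply: IH => //; [linarith|linarith|].
  by move: hn; rewrite -natr1 mulrDl mul1r; linarith.
have h2 : `|N y - N (y - delta)| <= A y - A (y - delta).
  apply: H => //; linarith.
have -> : N y - N x = (N y - N (y - delta)) + (N (y - delta) - N x) by ring.
apply: (le_trans (ler_normD _ _)); linarith.
Qed.

(** Absolute continuity with the density [f] as part of the data: calculus rules become identities
    between integrals, and no pointwise derivative of [F] is mentioned. *)
Definition AC (a b : R) F f := itg mu `[a, b] f /\
  forall x, a <= x <= b -> F x = F a + \int[mu]_(s in `[a, x]) f s.

Lemma subset_ccP (a b x y : R) : a <= x -> y <= b -> `[x, y] `<=` `[a, b].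
Proof.
move=> ax yb z; rewrite /= !in_itv/= => /andP[xz zy].
by rewrite (le_trans ax xz) (le_trans zy yb).
Qed.

Lemma itg_cc (a b x y : R) f : a <= x -> y <= b ->
  itg mu `[a, b] f -> itg mu `[x, y] f.
Proof.
by move=> ax yb; apply: itgS => //; exact: subset_ccP.
Qed.

Lemma Rint_cc_sub (a x y : R) f : a <= x -> x <= y ->
  itg mu `[a, y] f ->
  \int[mu]_(s in `[a, y]) f s - \int[mu]_(s in `[a, x]) f s =
  \int[mu]_(s in `[x, y]) f s.
Proof.
move=> ax xy fi; rewrite (@Rintegral_itvB _ _ (BLeft a) (BRight y) x)//.
  rewrite Rintegral_itv_obnd_cbnd//.
  apply: (@itgS _ _ _ mu `[a, y]) fi => //.
  by apply: subset_itvr; rewrite bnd_simp.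
Qed.

Lemma AC_sub a b F f x y : AC a b F f -> a <= x -> x <= y -> y <= b ->
  F y - F x = \int[mu]_(s in `[x, y]) f s.
Proof.
move=> [fi FE] ax xy yb.
rewrite FE ?(le_trans ax xy)// (FE x) ?ax ?(le_trans xy yb)//.
rewrite -(Rint_cc_sub ax xy); first by ring.
exact: itg_cc fi.
Qed.

Lemma AC_restrict a b F f x y : AC a b F f -> a <= x -> x <= y -> y <= b ->
  AC x y F f.
Proof.
move=> FA ax xy yb; split; first exact: itg_cc FA.1.
move=> z /andP[xz zy]; rewrite -(AC_sub FA ax xz (le_trans zy yb)); ring.
Qed.

Lemma AC_cont a b F f : a <= b -> AC a b F f -> {within `[a, b], continuous F}.
Proof.
move=> ab [fi FE].
have := parameterized_integral_continuous ab fi.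
move=> c; apply: (@subspace_eq_continuous _ _ _
  (fun x => F a + parameterized_integral mu a x f)).
  by move=> x; rewrite inE/= in_itv/= => xab; rewrite [RHS]FE.
by move=> x; apply: cvgD; [exact: cvg_cst|exact: c].
Qed.

Lemma AC_meas a b F f : a <= b -> AC a b F f -> measurable_fun `[a, b] F.
Proof.
move=> ab FA; apply: subspace_continuous_measurable_fun => //.
exact: AC_cont FA.
Qed.

Lemma itg_nonneg_int a b f : itg mu `[a, b] f -> forall x y, a <= x -> x <= y ->
  y <= b -> 0 <= \int[mu]_(s in `[x, y]) `|f s|.
Proof. by move=> fi x y ax xy yb; exact: Rintegral_ge0. Qed.

Lemma AC_bd a b F f : a <= b -> AC a b F f ->
  exists M, forall x, a <= x <= b -> `|F x| <= M.
Proof.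
move=> ab FA; exists (`|F a| + \int[mu]_(s in `[a, b]) `|f s|) => x /andP[ax xb].
have -> : F x = F a + (F x - F a) by ring.
apply: (le_trans (ler_normD _ _)); rewrite lerD2l (AC_sub FA)//.
have fx : itg mu `[a, x] f by exact: itg_cc FA.1.
apply: (le_trans (le_normr_Rintegral _ fx)) => //.
rewrite -subr_ge0 Rint_cc_sub//.
- by apply: (itg_nonneg_int FA.1).
- by apply: itg_norm => //; exact: FA.1.
Qed.

Lemma AC_uc a b F f : AC a b F f -> forall e, 0 < e ->
  exists2 delta, 0 < delta & forall x y, a <= x -> x <= y -> y <= b ->
    y - x <= delta -> `|F y - F x| <= e.
Proof.
move=> FA e e0.
have : mu.-integrable setT (EFin \o (f \_ `[a, b])).
  rewrite -restrict_EFin; apply/integrable_restrict => //=; rewrite setTI//.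
  exact: FA.1.
move=> /integral_normr_continuous /(_ _ e0)[d [d0 /=]] H.
exists (d / 2); first linarith.
move=> x y ax xy yb xyd.
have mu_lt : (mu `[x, y] < d%:E)%E.
  rewrite lebesgue_measure_itv/= lte_fin.
  case: ifPn => _; last by rewrite lte_fin.
  by rewrite -EFinD lte_fin; linarith.
have fx : itg mu `[x, y] f by exact: itg_cc FA.1.
rewrite (AC_sub FA)//; apply: (le_trans (le_normr_Rintegral _ fx)) => //.
have {}H := H [set` `[x, y]] (measurable_itv _) mu_lt.
move/ltW: H; apply: le_trans.
rewrite le_eqVlt; apply/orP; left; apply/eqP; apply: Rint_ext => z zxy.
rewrite patchE mem_set//.
exact: (subset_ccP ax yb).
Qed.

Lemma AC_uc_sym a b F f : AC a b F f -> forall e, 0 < e ->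
  exists2 delta, 0 < delta & forall x y, a <= x <= b -> a <= y <= b ->
    `|y - x| <= delta -> `|F y - F x| <= e.
Proof.
move=> FA e e0; have [d d0 H] := AC_uc FA e0; exists d => // x y xab yab xyd.
have [xy|yx] := leP x y.
  by apply: H => //; [linarith|linarith|]; rewrite ger0_norm ?subr_ge0 in xyd.
rewrite distrC; apply: H; [linarith|linarith|linarith|].
by rewrite distrC ger0_norm ?subr_ge0// in xyd; exact: ltW.
Qed.

Lemma itg_mulAC a b F f g : a <= b -> AC a b F f -> itg mu `[a, b] g ->
  itg mu `[a, b] (fun x => F x * g x).
Proof.
move=> ab FA gi; have [M FM] := AC_bd ab FA.
apply: (@itg_mulbd _ _ R mu `[a, b] _ _ M) => //; first exact: AC_meas FA.
Qed.

(** The defect [N], the product minus the candidate integral, changes over a short interval by at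
    most [e'] times the integral of [|f| + |g|] there, by uniform continuity of [F] and [G]. Summed
    over a chain this is below any [e], so [N] is constant. *)
Lemma AC_mul a b F G f g : a <= b -> AC a b F f -> AC a b G g ->
  AC a b (fun x => F x * G x) (fun x => F x * g x + G x * f x).
Proof.
move=> ab FA GA.
have i1 := itg_mulAC ab FA GA.1; have i2 := itg_mulAC ab GA FA.1.
have ii : itg mu `[a, b] (fun x => F x * g x + G x * f x) by exact: itgD.
split=> // x /andP[ax xb].
pose k s := `|f s| + `|g s|.
have ki : itg mu `[a, b] k.
  by apply: itgD => //; apply: itg_norm => //; [exact: FA.1|exact: GA.1].
pose K x := \int[mu]_(s in `[a, x]) k s.
have K0 y : 0 <= K y by apply: Rintegral_ge0 => s _; exact: addr_ge0.
have Ksub y z : a <= y -> y <= z -> z <= b ->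
    K z - K y = \int[mu]_(s in `[y, z]) k s.
  by move=> ay yz zb; rewrite /K Rint_cc_sub//; exact: itg_cc ki.
pose P x := \int[mu]_(s in `[a, x]) (F s * g s + G s * f s).
pose N x := F x * G x - P x.
suff : `|N x - N a| <= 0.
  rewrite normr_le0 subr_eq0 => /eqP; rewrite /N {2}/P.
  rewrite set_itv1 Rintegral_set1 subr0 => <-; rewrite -/(P x); ring.
apply/ler_addgt0Pr => e e0; rewrite add0r.
pose e' := e / (K b + 1).
have e'0 : 0 < e' by rewrite divr_gt0// ltr_wpDl.
have [d1 d10 H1] := AC_uc FA e'0; have [d2 d20 H2] := AC_uc GA e'0.
have step : forall y z, a <= y -> y <= z -> z <= b -> z - y <= Num.min d1 d2 ->
    `|N z - N y| <= e' * K z - e' * K y.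
  move=> y z ay yz zb; rewrite le_min => /andP[zy1 zy2].
  have iF := itg_cc ay zb FA.1; have iG := itg_cc ay zb GA.1.
  have iFz : itg mu `[y, z] (fun s => (G z) * f s) by exact: itgZ.
  have iGz : itg mu `[y, z] (fun s => F y * g s) by exact: itgZ.
  have i3 := itg_cc ay zb i1; have i4 := itg_cc ay zb i2.
  have ki' := itg_cc ay zb ki.
  (* From [F z * G z - F y * G y = F y * (G z - G y) + G z * (F z - F y)], with the constants [F y]
     and [G z] moved under the integrals. *)
  have -> : N z - N y = \int[mu]_(s in `[y, z])
     ((F y * g s + G z * f s) - (F s * g s + G s * f s)).
    rewrite RintegralB//; [|exact: itgD|exact: itgD].
    rewrite RintegralD// !RintegralZl// -(AC_sub FA)// -(AC_sub GA)//.
    rewrite -(Rint_cc_sub ay yz); last exact: itg_cc ii.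
    by rewrite /N -/(P y) -/(P z); ring.
  rewrite -mulrBr Ksub// -RintegralZl//.
  apply: le_normr_Rint => //.
  - apply: itgB => //; exact: itgD.
  - exact: itgZ.
  apply: aeW => s; rewrite /= in_itv/= => /andP[ys sz].
  have -> : F y * g s + G z * f s - (F s * g s + G s * f s) =
    (G z - G s) * f s + - (F s - F y) * g s by ring.
  apply: (le_trans (ler_normD _ _)); rewrite !normrM normrN /k mulrDr.
  apply: lerD; apply: ler_wpM2r => //.
    by apply: H2 => //; linarith.
  by apply: H1 => //; linarith.
have d0 : 0 < Num.min d1 d2 by rewrite lt_min d10.
have := chain_le d0 step (lexx a) ax xb.
move/le_trans; apply; rewrite -mulrBr.
have Ka : K a = 0 by rewrite /K set_itv1 Rintegral_set1.
have Kxb : K x <= K b.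
  by rewrite -subr_ge0 Ksub//; apply: Rintegral_ge0 => s _; exact: addr_ge0.
rewrite Ka subr0 /e' mulrAC ler_pdivrMr ?ltr_wpDl// ler_pM2l//.
by have := K0 b; linarith.
Qed.

Lemma AC_D a b F G f g : AC a b F f -> AC a b G g ->
  AC a b (fun x => F x + G x) (fun x => f x + g x).
Proof.
move=> FA GA; split.
  by apply: itgD => //; [exact: FA.1|exact: GA.1].
move=> x xab; rewrite RintegralD//.
- by rewrite (FA.2 x xab) (GA.2 x xab); ring.
- by apply: itg_cc FA.1 => //; case/andP: xab.
- by apply: itg_cc GA.1 => //; case/andP: xab.
Qed.

Lemma AC_Z a b k F f : AC a b F f ->
  AC a b (fun x => k * F x) (fun x => k * f x).
Proof.
move=> FA; split; first by apply: itgZ => //; exact: FA.1.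
move=> x xab; rewrite RintegralZl//; first by rewrite (FA.2 x xab); ring.
by apply: itg_cc FA.1 => //; case/andP: xab.
Qed.

Lemma AC_cst a b k : AC a b (fun=> k) (fun=> 0).
Proof.
split; last by move=> x _; rewrite Rint0 addr0.
exact: integrable0.
Qed.

Lemma AC_ext a b F f G g : (forall x, a <= x <= b -> F x = G x) ->
  (forall x, a <= x <= b -> f x = g x) -> a <= b -> AC a b F f -> AC a b G g.
Proof.
move=> FG fg ab [fi FE]; split.
  by apply: itg_ext fi => // x; rewrite /= in_itv/=; exact: fg.
move=> x xab; rewrite -FG// -FG ?lexx// FE//; congr (_ + _).
apply: Rint_ext => s; rewrite /= in_itv/= => /andP[xs sx].
by apply: fg; rewrite xs (le_trans sx)//; case/andP: xab.
Qed.

Lemma AC_int a b f c : itg mu `[a, b] f ->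
  AC a b (fun x => c + \int[mu]_(s in `[a, x]) f s) f.
Proof.
by move=> fi; split=> // x _; rewrite set_itv1 Rintegral_set1 addr0.
Qed.

Lemma AC_C1 (a b : R) F f : a <= b ->
  (forall x, a <= x <= b -> is_derive x 1 F (f x)) ->
  (forall x, a <= x <= b -> {for x, continuous f}) -> AC a b F f.
Proof.
move=> ab dF cf.
have wc x : x <= b -> {within `[a, x], continuous f}.
  move=> xb; apply: continuous_in_subspaceT => y; rewrite inE/= in_itv/= => /andP[ay yx].
  by apply: cf; rewrite ay (le_trans yx).
split.
  by apply: continuous_compact_integrable; [exact: segment_compact|exact: wc].
move=> x /andP[ax xb].
have [<-|axn] := eqVneq a x; first by rewrite set_itv1 Rintegral_set1 addr0.
have {}ax : a < x by rewrite lt_neqAle axn.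
have cF y : a <= y <= x -> {for y, continuous F}.
  move=> /andP[ay yx]; apply: differentiable_continuous; apply/derivable1_diffP.
  by have [] := dF y _; rewrite ?ay ?(le_trans yx).
have H := @continuous_FTC2 _ f F a x ax (wc _ xb).
rewrite /Rintegral H.
- by rewrite -EFinD /=; ring.
- split.
  + move=> y; rewrite in_itv/= => /andP[ay yx].
    by have [] := dF y _; rewrite ?(ltW ay) ?(le_trans (ltW yx)).
  + by apply: cvg_at_right_filter; apply: cF; rewrite lexx ltW.
  + by apply: cvg_at_left_filter; apply: cF; rewrite lexx ltW.
- move=> y; rewrite in_itv/= => /andP[ay yx]; rewrite derive1E.
  by apply: derive_val; apply: dF; rewrite (ltW ay) (le_trans (ltW yx)).
Qed.

End AbsoluteContinuity.

(** * Absolutely continuous functions on the unit interval *)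

Section UnitInterval.
Context {R : realType}.
Notation mu := (@lebesgue_measure R).
Implicit Types (F G f g p q w : R -> R).

Lemma itg_cc01 f : itg mu I01 f -> itg mu `[0, 1] f.
Proof.
move=> /integrableP[mf fi]; apply/integrableP; split.
  apply/measurable_EFinP.
  apply/measurable_fun_itv_obnd_cbndP.
  by apply/measurable_fun_itv_bndo_bndcP; exact/measurable_EFinP.
rewrite integral_itv_bndoo//.
by apply/measurableT_comp.
Qed.

Lemma itg_oo01 f : itg mu `[0, 1] f -> itg mu I01 f.
Proof. by apply: itgS => //; exact: subset_itv_oo_cc. Qed.

Lemma Rint01 f : itg mu I01 f ->
  \int[mu]_(x in I01) f x = \int[mu]_(x in `[0, 1]) f x.
Proof.
move=> fi; rewrite /Rintegral [in RHS]integral_itv_bndoo//.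
by case/integrableP : fi.
Qed.

Lemma primitive0 f : primitive f 0 = 0.
Proof. by rewrite /primitive set_itv1 Rintegral_set1. Qed.

Lemma primitive1 f : itg mu I01 f -> primitive f 1 = \int[mu]_(x in I01) f x.
Proof. by move=> fi; rewrite Rint01. Qed.

Lemma AC_prim f c : itg mu I01 f -> AC 0 1 (fun x => c + primitive f x) f.
Proof. by move=> /itg_cc01 fi; exact: AC_int. Qed.

Lemma AC_prim0 f : itg mu I01 f -> AC 0 1 (primitive f) f.
Proof.
move=> fi; apply: AC_ext (AC_prim 0 fi) => // x _; exact: add0r.
Qed.

Lemma AC_primE F f x : AC 0 1 F f -> 0 <= x <= 1 ->
  F x = F 0 + primitive f x.
Proof. by move=> [_ FE] x01; exact: FE. Qed.

Lemma AC01_meas F f : AC 0 1 F f -> measurable_fun I01 F.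
Proof.
move=> FA; apply: measurable_funS (AC_meas ler01 FA) => //.
exact: subset_itv_oo_cc.
Qed.

Lemma AC01_L2 F f : AC 0 1 F f -> L2 F.
Proof.
move=> FA; have [M FM] := AC_bd ler01 FA.
apply: (L2_bd (AC01_meas FA) (M := M)) => x; rewrite /I01/= in_itv/= => /andP[x0 x1].
by apply: FM; rewrite !ltW.
Qed.

Lemma I01P (x : R) : I01 x -> 0 <= x <= 1.
Proof. by rewrite /I01/= in_itv/= => /andP[x0 x1]; rewrite !ltW. Qed.

Lemma ip_parts F G f g : AC 0 1 F f -> AC 0 1 G g -> L2 f -> L2 g ->
  ip F g + ip G f = F 1 * G 1 - F 0 * G 0.
Proof.
move=> FA GA f2 g2; have FGA := AC_mul ler01 FA GA.
rewrite -RintegralD//; [|exact: L2_itgM (AC01_L2 FA) g2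
  |exact: L2_itgM (AC01_L2 GA) f2].
rewrite Rint01; last exact: itg_oo01 FGA.1.
by rewrite (AC_primE FGA) ?ler01 ?lexx// addrC addKr.
Qed.

Lemma L2_indic (x y : R) : 0 <= x -> x <= y -> y <= 1 ->
  L2 (\1_`[x, y] : R -> R).
Proof.
move=> x0 xy y1; apply: (@L2_bd _ _ 1).
  by apply: measurable_indic.
move=> z _; rewrite indicE; case: (_ \in _) => /=; by rewrite ?normr1 ?normr0.
Qed.

Lemma ip_indic f (x y : R) : L2 f -> 0 <= x -> x <= y -> y <= 1 ->
  ip f (\1_`[x, y]) = \int[mu]_(s in `[x, y]) f s.
Proof.
move=> f2 x0 xy y1; rewrite /ip Rint01; last first.
  by apply: L2_itgM => //; exact: L2_indic.
rewrite [RHS]Rintegral_mkcond [LHS]Rintegral_mkcond; apply: Rint_ext => s _.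
rewrite !patchE indicE; case: ifPn => s01.
  by case: (s \in _); rewrite ?mulr1 ?mulr0.
case: ifPn => // sxy; move: s01; rewrite notin_setE/= => -[].
by move: sxy; rewrite inE/=; apply: subset_ccP.
Qed.

(** Indicators serve as test functions: an identity known only after pairing in L^2 is read off
    pointwise on primitives. *)
Lemma ip_indic_prim f (x : R) : L2 f -> 0 <= x <= 1 ->
  ip f (\1_`[0, x]) = primitive f x.
Proof. by move=> f2 /andP[x0 x1]; rewrite ip_indic. Qed.

Lemma ip1 f : ip f (fun=> 1) = \int[mu]_(x in I01) f x.
Proof. by apply: Rint_ext => x _; rewrite mulr1. Qed.

Lemma AC_id (a b : R) : a <= b -> AC a b (fun x : R => x) (fun=> 1).
Proof.
by move=> ab; apply: AC_C1 => // x _; exact: cvg_cst.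
Qed.

Lemma Rint_cst_cc (x y k : R) : x <= y -> \int[mu]_(s in `[x, y]) k = k * (y - x).
Proof.
move=> xy; rewrite Rintegral_cst//; congr (_ * _).
rewrite [X in fine X]lebesgue_measure_itv/= lte_fin; case: ltP => // yx.
have -> : x = y by apply/eqP; rewrite eq_le xy.
by rewrite subrr.
Qed.

(** Cauchy-Schwarz for [f] against the indicator of [x, y], whose squared norm is [y - x]. *)
Lemma AC_holder F f x y : AC 0 1 F f -> L2 f -> 0 <= x -> x <= y -> y <= 1 ->
  (F y - F x) ^+ 2 <= (y - x) * ip f f.
Proof.
move=> FA f2 x0 xy y1; rewrite (AC_sub FA)// -ip_indic//.
apply: (le_trans (ip_CS f2 (L2_indic x0 xy y1))).
rewrite mulrC ler_wpM2r ?ip_ge0// ip_indic//; last exact: L2_indic.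
rewrite (_ : \int[mu]_(s in _) _ = \int[mu]_(s in `[x, y]) (1 : R)).
  by rewrite Rint_cst_cc// mul1r.
by apply: Rint_ext => s xsy; rewrite indicE mem_set.
Qed.

Lemma AC_holder_sym F f x y : AC 0 1 F f -> L2 f -> 0 <= x <= 1 -> 0 <= y <= 1 ->
  (F y - F x) ^+ 2 <= `|y - x| * ip f f.
Proof.
move=> FA f2 /andP[x0 x1] /andP[y0 y1]; have [xy|yx] := leP x y.
  by rewrite ger0_norm ?subr_ge0//; exact: AC_holder FA _ _ _ _.
rewrite -sqrrN opprB distrC ger0_norm ?subr_ge0 ?(ltW yx)//.
by apply: AC_holder FA _ _ _ _ => //; exact: ltW.
Qed.

End UnitInterval.

(** * Poincare inequalities with sharp constant *)

Section Derivatives.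
Context {R : realType}.
Implicit Types (f g : R -> R) (x a b : R).

Lemma derive_cst1 x (k : R) : is_derive x (1 : R) (fun=> k) 0.
Proof. exact: is_derive_cst. Qed.

Lemma derive_id1 x : is_derive x (1 : R) (fun y : R => y) 1.
Proof. exact: is_derive_id. Qed.

Lemma derive_add f g x a b : is_derive x 1 f a -> is_derive x 1 g b ->
  is_derive x 1 (fun y => f y + g y) (a + b).
Proof. by move=> fa gb; exact: is_deriveD. Qed.

Lemma derive_mul f g x a b : is_derive x 1 f a -> is_derive x 1 g b ->
  is_derive x 1 (fun y => f y * g y) (f x * b + g x * a).
Proof. by move=> fa gb; exact: is_deriveM. Qed.

Lemma derive_scale f x a (k : R) : is_derive x 1 f a ->
  is_derive x 1 (fun y => k * f y) (k * a).
Proof. by move=> fa; exact: (@is_deriveZ _ _ _ f). Qed.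

Lemma derive_inv f x a : f x != 0 -> is_derive x 1 f a ->
  is_derive x 1 (fun y => (f y)^-1) (- (f x) ^- 2 * a).
Proof. by move=> fx fa; exact: is_deriveV. Qed.

Lemma derive_comp f g x a b : is_derive (g x) 1 f a -> is_derive x 1 g b ->
  is_derive x 1 (fun y => f (g y)) (a * b).
Proof. by move=> fa gb; exact: is_derive1_comp. Qed.

Lemma is_derive_continuous f x a : is_derive x 1 f a -> {for x, continuous f}.
Proof.
by case=> fx _; apply: differentiable_continuous; apply/derivable1_diffP.
Qed.

End Derivatives.

Section Poincare.
Context {R : realType}.
Notation mu := (@lebesgue_measure R).
Implicit Types (F G f g p q w : R -> R).

Lemma sin_le (x : R) : 0 <= x -> sin x <= x.
Proof.
move=> x0; have SA : AC 0 x sin (@cos R).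
  by apply: AC_C1 => // y _; exact: continuous_cos.
rewrite (SA.2 x) ?x0 ?lexx// sin0 add0r -[leRHS]mul1r -[X in _ * X]subr0.
rewrite -Rint_cst_cc//; apply: le_Rintegral => //; first exact: SA.1.
  by case: (AC_id x0).
Qed.

(** The triple-angle formula at [pi / 6] reads [(s + 1)(2 s - 1)^2 = 0] for [s = sin (pi / 6)], so
    [s = 1/2], and [sin x <= x] gives the bound. It serves to replace [pi ^+ 2] by 9 in the
    coercivity estimate. *)
Lemma pi_ge3 : 3 <= pi :> R.
Proof.
pose a : R := pi / 6; pose s := sin a; pose c := cos a.
have e1 : s ^+ 2 + c ^+ 2 = 1 by rewrite addrC cos2Dsin2.
have pi0 := pi_gt0 R.
have sp : 0 <= s by apply: sin_ge0_pi; apply/andP; split; rewrite /a; linarith.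
have : sin (a + (a + a)) = 1.
  by rewrite -(sin_pihalf R); congr sin; rewrite /a; linarith.
rewrite sinD cosD sinD -/s -/c => H.
have cc : c * c = 1 - s * s by rewrite -!expr2 -e1 addrAC subrr add0r.
have {}H : (s + 1) * (2 * s - 1) ^+ 2 = 0.
  have -> : (s + 1) * (2 * s - 1) ^+ 2 =
    1 - (s * (c * c - s * s) + c * (s * c + c * s)) +
      (3 * s) * (c * c - (1 - s * s)) by ring.
  by rewrite H cc; ring.
have {}H : s = 1 / 2.
  move/eqP: H; rewrite mulf_eq0 expf_eq0/= => /orP[/eqP|/eqP]; linarith.
have := @sin_le a; rewrite -/s H /a; linarith.
Qed.

(** [H = beta cot(beta x + d)] solves the Riccati equation [H' + H^2 = - beta^2]. Adding to the
    square of [f - H F] the derivative of [F^2 H], whose integral is 0 as [F] vanishes at both ends,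
    leaves [f^2 - beta^2 F^2]. *)
Lemma wirtinger_lt (beta : R) F f : 0 < beta < pi -> AC 0 1 F f -> L2 f ->
  F 0 = 0 -> F 1 = 0 -> beta ^+ 2 * ip F F <= ip f f.
Proof.
move=> /andP[b0 bpi] FA f2 F0 F1.
(* With this shift [beta x + d] stays between [d] and [pi - d], away from the poles of the
   cotangent; this is where [beta < pi] enters. *)
pose d : R := (pi - beta) / 2.
have d0 : 0 < d by rewrite /d; linarith.
have snz x : 0 <= x <= 1 -> 0 < sin (beta * x + d).
  move=> /andP[x0 x1]; apply: sin_gt0_pi; apply/andP; split; first nra.
  by rewrite /d; nra.
pose H x : R := beta * (cos (beta * x + d) / sin (beta * x + d)).
pose H' x : R := - (beta ^+ 2 / sin (beta * x + d) ^+ 2).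
have dl x : is_derive x (1:R) (fun y : R => beta * y + d) beta.
  by apply: is_derive_eq (derive_add (derive_scale beta (derive_id1 x)) (derive_cst1 x d)) _; rewrite mulr1 addr0.
have ds x : is_derive x (1:R) (fun y : R => sin (beta * y + d))
    (cos (beta * x + d) * beta).
  by apply: derive_comp (dl x); exact: is_derive_sin.
have dc x : is_derive x (1:R) (fun y : R => cos (beta * y + d))
    (- sin (beta * x + d) * beta).
  by apply: derive_comp (dl x); exact: is_derive_cos.
have HA : AC 0 1 H H'.
  apply: AC_C1 => [||x x01]; first exact: ler01.
    move=> x x01; have sx := snz x x01.
    have sn0 : sin (beta * x + d) != 0 by rewrite gt_eqF.
    have D := derive_scale beta (derive_mul (dc x) (@derive_inv _ (fun y => sin (beta * y + d)) x _ sn0 (ds x))).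
    apply: (is_derive_eq D).
    have := cos2Dsin2 (beta * x + d); rewrite /H'.
    move: sn0; set S := sin _; set C := cos _ => sn0 e1.
    transitivity (- (beta ^+ 2 * (C ^+ 2 + S ^+ 2) / S ^+ 2)).
      by field.
    by rewrite e1 mulr1.
  have sn0 : sin (beta * x + d) != 0 by rewrite gt_eqF// snz.
  apply: continuousN; apply: continuousM; first exact: cvg_cst.
  apply: continuousV; first by rewrite expf_neq0.
  exact: is_derive_continuous (derive_mul (ds x) (ds x)).
have [M HM] := AC_bd ler01 HA.

have FF := AC_mul ler01 FA FA; have F2 := AC01_L2 FA.
have HF2 : L2 (fun x => H x * F x).
  by apply: (L2_mulbd F2 (AC01_meas HA)) => x /I01P; exact: HM.
have := ip_ge0 (fun x => f x - H x * F x).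
rewrite ipBB// => h0.
have PA := AC_mul ler01 FF HA.
have := AC_primE PA (x := 1); rewrite ler01 lexx F1 F0 !mul0r add0r => /(_ isT)/esym.
rewrite primitive1; last exact: itg_oo01 PA.1.
set I := Rintegral _ _ _ => I0.
have i1 := L2_itgM HF2 HF2; have i2 := L2_itgM f2 HF2; have i3 := L2_itgM F2 F2.
suff E : ip (fun x => H x * F x) (fun x => H x * F x) -
    2 * ip f (fun x => H x * F x) + beta ^+ 2 * ip F F = - I by move: h0; linarith.
transitivity (\int[mu]_(x in I01) ((H x * F x * (H x * F x) -
    2 * (f x * (H x * F x))) + beta ^+ 2 * (F x * F x))).
  rewrite RintegralD//; [|by apply: itgB => //; exact: itgZ|exact: itgZ].
  by rewrite RintegralB// ?RintegralZl//; exact: itgZ.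
rewrite /I -RintN//; last exact: itg_oo01 PA.1.
apply: Rint_ext => x /I01P x01.
have : H' x + H x * H x = - beta ^+ 2.
  rewrite /H' /H; have := cos2Dsin2 (beta * x + d).
  have : sin (beta * x + d) != 0 by rewrite gt_eqF// snz.
  set S := sin _; set C := cos _ => S0 e1.
  transitivity (- (beta ^+ 2 * (1 - C ^+ 2) / S ^+ 2)); first by field.
  by rewrite -e1 addrAC subrr add0r mulfK ?expf_neq0.
move=> e; have -> : H' x = - beta ^+ 2 - H x * H x by rewrite -e addrK.
by ring.
Qed.

(** A Rayleigh quotient below [pi ^+ 2] would contradict [wirtinger_lt] with [beta ^+ 2] halfway
    between the two. *)
Lemma wirtinger F f : AC 0 1 F f -> L2 f -> F 0 = 0 -> F 1 = 0 ->
  pi ^+ 2 * ip F F <= ip f f.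
Proof.
move=> FA f2 F0 F1; rewrite leNgt; apply/negP => lt.
have p0 := pi_gt0 R; have X0 := ip_ge0 F; have Y0 := ip_ge0 f.
have Xp : 0 < ip F F.
  by rewrite lt_neqAle X0 andbT; apply/eqP => E; move: lt; rewrite -E mulr0; linarith.
pose b2 : R := (ip f f / ip F F + pi ^+ 2) / 2.
have b2X : b2 * ip F F = (ip f f + pi ^+ 2 * ip F F) / 2.
  by rewrite /b2; field; rewrite gt_eqF.
have q0 : 0 <= ip f f / ip F F by rewrite divr_ge0.
have qp : ip f f / ip F F < pi ^+ 2 by rewrite ltr_pdivrMr.
have pp : 0 < pi ^+ 2 :> R by rewrite exprn_gt0.
have b0 : 0 < b2 by rewrite /b2; linarith.
have := @wirtinger_lt (Num.sqrt b2) F f _ FA f2 F0 F1.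
rewrite sqr_sqrtr ?(ltW b0)// b2X sqrtr_gt0 b0/= -(@ltr_pXn2r _ 2) ?nnegrE//.
- rewrite sqr_sqrtr ?(ltW b0)// => H.
  have {H} := H _; have -> : b2 < pi ^+ 2 by rewrite /b2; linarith.
  by move=> /(_ isT); linarith.
- exact: ltW.
Qed.

End Poincare.

(** * Poincare inequalities under mean conditions *)

Section PoincareNeumann.
Context {R : realType}.
Notation mu := (@lebesgue_measure R).
Implicit Types (F G f g p q w : R -> R).

(** Dual to the Dirichlet case: the primitive [W] of [q] vanishes at both ends, so [pi |W| <= |q|],
    while integration by parts gives [|q|^2 = - <W, g> <= |W| |g|]. *)
Lemma poincare_mean0 q g : AC 0 1 q g -> L2 g ->
  \int[mu]_(x in I01) q x = 0 -> pi ^+ 2 * ip q q <= ip g g.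
Proof.
move=> qA g2 q0; have q2 := AC01_L2 qA; have qi := L2_itg q2.
have WA := AC_prim0 qi; have W2 := AC01_L2 WA.
have W1 : primitive q 1 = 0 by rewrite primitive1.
have Wi := wirtinger WA q2 (primitive0 q) W1.
have P := ip_parts WA qA q2 g2.
rewrite W1 primitive0 !mul0r subrr in P.
have C := ip_CS W2 g2.
have X0 := ip_ge0 q; have Y0 := ip_ge0 g; have W0 := ip_ge0 (primitive q).
have pp : 0 < pi ^+ 2 :> R by rewrite exprn_gt0// pi_gt0.
have e : ip q q ^+ 2 <= ip (primitive q) (primitive q) * ip g g.
  by apply: le_trans C; rewrite -sqrrN; have -> : - ip q q = ip (primitive q) g by linarith.
have [->|Xn] := eqVneq (ip q q) 0; first by rewrite mulr0.
have Xp : 0 < ip q q by rewrite lt_neqAle eq_sym Xn.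
rewrite -(ler_pM2r Xp) -mulrA -expr2.
apply: (@le_trans _ _ (pi ^+ 2 * (ip (primitive q) (primitive q) * ip g g))).
  by rewrite ler_pM2l.
by rewrite mulrA mulrC ler_wpM2l.
Qed.

(** Let [c] be the ordinary mean of [q]. The weighted mean being 0, the integral of [w (q - c)^2] is
    that of [w q^2] plus [c^2] times the integral of [w]; the unweighted inequality then applies to
    [q - c]. *)
Lemma weighted_poincare w q g (w1 w2 : R) : AC 0 1 q g -> L2 g ->
  measurable_fun I01 w -> 0 <= w1 -> (forall x, I01 x -> w1 <= w x <= w2) ->
  \int[mu]_(x in I01) (w x * q x) = 0 ->
  pi ^+ 2 * (w1 * ip q q) <= w2 * ip g g.
Proof.
move=> qA g2 mw w10 hw wq0; have q2 := AC01_L2 qA; have qi := L2_itg q2.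
have w12 : w1 <= w2.
  have := hw (1/2); rewrite /I01/= in_itv/= => h.
  have h1 : (0 : R) < 1 / 2 by linarith.
  have h2 : (1 / 2 : R) < 1 by linarith.
  by move: h; rewrite h1 h2 => /(_ isT)/andP[]; exact: le_trans.
have w20 := le_trans w10 w12.
have wM x : I01 x -> `|w x| <= w2.
  by move=> /hw/andP[h1 h2]; rewrite ger0_norm// (le_trans w10).
have L2w f : L2 f -> L2 (fun x => w x * f x) by move=> f2; apply: L2_mulbd wM.
pose c := \int[mu]_(x in I01) q x.
have qcA : AC 0 1 (fun x => q x + - c) (fun x => g x + 0).
  by apply: AC_D => //; exact: AC_cst.
have {}qcA : AC 0 1 (fun x => q x - c) g.
  by apply: AC_ext qcA => // x _; rewrite addr0.
have qc2 := AC01_L2 qcA.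
have P := poincare_mean0 qcA g2.
have {}P : pi ^+ 2 * ip (fun x => q x - c) (fun x => q x - c) <= ip g g.
  apply: P; rewrite RintegralB//; last exact/L2_itg/L2_cst.
  by rewrite Rint_cst01 subrr.
have wc2 := L2w _ (L2_cst c).
have E : ip (fun x => w x * (q x - c)) (fun x => q x - c) =
    ip (fun x => w x * q x) q + c * ip (fun x => w x * c) (fun=> 1).
  have -> : ip (fun x => w x * (q x - c)) (fun x => q x - c) =
     ip (fun x => w x * q x - w x * c) (fun x => q x - c).
    by apply: ip_ext => // x _; rewrite mulrBr.
  have e1 : ip (fun x => w x * q x) (fun=> c) = 0.
    by rewrite /ip RintegralZr ?wq0 ?mul0r//; exact/L2_itg/L2w.
  have e2 : ip (fun x => w x * c) q = 0.
    rewrite -[RHS](mulr0 c) -[in RHS]wq0 -RintegralZl//; last exact/L2_itg/L2w.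
    by apply: Rint_ext => x _; ring.
  have e3 : ip (fun x => w x * c) (fun=> c) = c * ip (fun x => w x * c) (fun=> 1).
    rewrite -ipZr//; last exact: L2_cst.
    by apply: ip_ext => // x _; rewrite mulr1.
  rewrite ipBl//; [|exact: L2w].
  rewrite !ipBr//; [|exact: L2_cst|exact: L2w|exact: L2_cst].
  by rewrite e1 e2 e3; ring.
have cw0 : 0 <= c * ip (fun x => w x * c) (fun=> 1).
  rewrite -ipZr//; last exact: L2_cst.
  apply: Rintegral_ge0 => x Ix; rewrite mulr1 -mulrA mulr_ge0// -?expr2 ?sqr_ge0//.
  by case/andP: (hw _ Ix) => h _; exact: le_trans h.
have lo : w1 * ip q q <= ip (fun x => w x * q x) q.
  rewrite -ipZl//; apply: le_Rintegral => //.
  - exact/L2_itgM/q2/L2Z.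
  - exact/L2_itgM/q2/L2w.
  - move=> x Ix; rewrite -!mulrA -expr2 ler_wpM2r ?sqr_ge0//.
    by case/andP: (hw _ Ix).
have hi : ip (fun x => w x * (q x - c)) (fun x => q x - c) <=
    w2 * ip (fun x => q x - c) (fun x => q x - c).
  rewrite -ipZl//; apply: le_Rintegral => //.
  - exact/L2_itgM/qc2/L2w.
  - exact/L2_itgM/qc2/L2Z.
  - move=> x Ix; rewrite -!mulrA -expr2 ler_wpM2r ?sqr_ge0//.
    by case/andP: (hw _ Ix).
have pp : 0 <= pi ^+ 2 :> R by exact: sqr_ge0.
have h : w1 * ip q q <= w2 * ip (fun x => q x - c) (fun x => q x - c) by linarith.
apply: (@le_trans _ _ (pi ^+ 2 * (w2 * ip (fun x => q x - c) (fun x => q x - c)))).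
  exact: ler_wpM2l.
by rewrite mulrCA ler_wpM2l.
Qed.

(** [q] is neither positive everywhere nor negative everywhere, since [w q] would then have a strict
    sign and integral 0; the intermediate value theorem does the rest. *)
Lemma zero_of_weighted_mean w q g (w1 : R) : AC 0 1 q g ->
  measurable_fun I01 w -> 0 < w1 -> (exists w2 : R, forall x, I01 x -> w1 <= w x <= w2) ->
  \int[mu]_(x in I01) (w x * q x) = 0 ->
  exists2 z, 0 <= z <= 1 & q z = 0.
Proof.
move=> qA mw w10 [w2 hw] wq0; have q2 := AC01_L2 qA.
have wM x : I01 x -> `|w x| <= w2.
  by move=> /hw/andP[h1 h2]; rewrite ger0_norm// (le_trans (ltW w10)).
have wq2 : L2 (fun x => w x * q x) by apply: L2_mulbd wM.
have key (s : R) : s ^+ 2 = 1 -> ~ (forall x, 0 <= x <= 1 -> 0 < s * q x).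
  move=> s1 pos.
  have i : itg mu I01 (fun x => s * (w x * q x)) by apply: itgZ => //; exact: L2_itg.
  have := @Rint_eq0_ae _ _ R mu I01 _ mI01 i; case.
  - move=> x Ix; rewrite mulrCA mulr_ge0//; first by case/andP: (hw _ Ix) => h _; rewrite (le_trans (ltW w10)).
    exact/ltW/pos/I01P.
  - by rewrite RintegralZl ?wq0 ?mulr0//; exact: L2_itg.
  move=> N [mN N0 sub].
  have : mu I01 = 0%E.
    apply/eqP; rewrite eq_le measure_ge0 andbT -N0; apply: le_measure; rewrite ?inE//.
    move=> x Ix; apply: sub => /= /(_ Ix)/eqP; rewrite mulrCA mulf_eq0.
    case/andP: (hw _ Ix) => h _; have := pos x (I01P Ix) => /gt_eqF ->.
    by rewrite (gt_eqF (lt_le_trans w10 h)).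
  by rewrite mu_I01 => /eqP; rewrite eqe oner_eq0.
have cq := AC_cont ler01 qA.
have H (a b : R) : 0 <= a -> a <= b -> b <= 1 -> Num.min (q a) (q b) <= 0 <= Num.max (q a) (q b) ->
    exists2 z, 0 <= z <= 1 & q z = 0.
  move=> a0 ab b1 m.
  have cab := AC_cont ab (AC_restrict qA a0 ab b1).
  have [c + qc] := IVT ab cab m; rewrite in_itv/= => /andP[ac cb].
  by exists c => //; rewrite (le_trans a0 ac) (le_trans cb b1).
have [x x01 qx] : exists2 x, 0 <= x <= 1 & q x <= 0.
  apply: contrapT => h; apply: (key 1); first by rewrite expr1n.
  move=> x x01; rewrite mul1r ltNge; apply/negP => qx; apply: h; by exists x.
have [y y01 qy] : exists2 x, 0 <= x <= 1 & 0 <= q x.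
  apply: contrapT => h; apply: (key (-1)); first by rewrite sqrrN expr1n.
  move=> y y01; rewrite mulN1r oppr_gt0 ltNge; apply/negP => qy; apply: h; by exists y.
case/andP: x01 => x0 x1; case/andP: y01 => y0 y1.
have [xy|yx] := leP x y.
  by apply: (H x y) => //; rewrite ge_min qx le_max qy orbT.
by apply: (H y x) => //; [exact: ltW|rewrite ge_min qx orbT le_max qy].
Qed.

(** By parts, [p x0] minus the mean is the pairing of [g] with the kernel [x - 1_[x0,1]], whose
    squared norm is [1/3 - x0 (1 - x0)]. *)
Lemma mean_osc p g (x0 : R) : AC 0 1 p g -> L2 g -> 0 <= x0 <= 1 ->
  (p x0 - \int[mu]_(x in I01) p x) ^+ 2 <= 3^-1 * ip g g.
Proof.
move=> pA g2 /andP[x00 x01]; have p2 := AC01_L2 pA.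
have idA := AC_id (@ler01 R); have id2 := AC01_L2 idA.
have i2 := L2_indic x00 x01 (lexx 1).
have k2 := L2B id2 i2.
have E : ip (fun x => x - \1_`[x0, 1] x) g = p x0 - \int[mu]_(x in I01) p x.
  rewrite ipBl// [X in _ - X]ipC ip_indic// -(AC_sub pA)//.
  have := ip_parts idA pA (L2_cst 1) g2; rewrite ip1 !mul1r mul0r; linarith.
rewrite -E; apply: (le_trans (ip_CS k2 g2)); rewrite ler_wpM2r ?ip_ge0//.
rewrite ipBB// ip_indic// ip_indic//.
have -> : \int[mu]_(s in `[x0, 1]) \1_`[x0, 1] s = 1 - x0.
  rewrite (_ : \int[mu]_(s in _) _ = \int[mu]_(s in `[x0, 1]) (1 : R)).
    by rewrite Rint_cst_cc// mul1r.
  by apply: Rint_ext => s xsy; rewrite indicE mem_set.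
have sqA (a : R) : a <= 1 -> AC a 1 (fun x => 2^-1 * (x * x)) (fun x => x).
  move=> a1; apply: AC_ext (AC_Z 2^-1 (AC_mul a1 (AC_id a1) (AC_id a1))) => // x _.
  by field.
rewrite -(AC_sub (sqA _ x01) (lexx _) x01 (lexx _)).
have cuA : AC 0 1 (fun x : R => 3^-1 * (x * x * x)) (fun x => x * x).
  apply: AC_ext (AC_Z 3^-1 (AC_mul ler01 (AC_mul ler01 idA idA) idA)) => // x _.
  by field.
have -> : ip (fun x : R => x) (fun x => x) = 3^-1.
  have := AC_primE cuA (x := 1); rewrite ler01 lexx => /(_ isT).
  rewrite primitive1; last exact: itg_oo01 cuA.1.
  by rewrite /ip; linarith.
nra.
Qed.

End PoincareNeumann.

(** * Limits in L^2 *)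

Section Completeness.
Context {R : realType}.
Notation mu := (@lebesgue_measure R).
Implicit Types (f g : R -> R) (h k : nat -> R -> R).

Lemma measurable_ext d (T : measurableType d) (D : set T) (f g : T -> R) :
  (forall x, D x -> f x = g x) -> measurable_fun D f -> measurable_fun D g.
Proof. by move=> fg; apply: eq_measurable_fun => x /set_mem; exact: fg. Qed.

Lemma L2_norm f : L2 f -> L2 (fun x => `|f x|).
Proof.
move=> [mf f2]; split; first exact: measurableT_comp.
by apply: itg_ext f2 => // x _; rewrite -normrX ger0_norm// sqr_ge0.
Qed.

Lemma Rint_norm_nm f : L2 f -> \int[mu]_(x in I01) `|f x| <= nm f.
Proof.
move=> f2; rewrite -ip1; apply: (le_trans (ip_le_nm (L2_norm f2) (L2_cst 1))).
rewrite {2}/nm ip1 Rint_cst01 sqrtr1 mulr1 le_eqVlt; apply/orP; left; apply/eqP.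
congr Num.sqrt; apply: Rint_ext => x _.
by rewrite -normrM ger0_norm// -expr2 sqr_ge0.
Qed.

Lemma geometric_nm h n j : (forall n, L2 (h n)) ->
  (forall n, nm (fun x => h n.+1 x - h n x) <= 2^-1 ^+ n) ->
  nm (fun x => h (n + j)%N x - h n x) <= 2 * 2^-1 ^+ n - 2 * 2^-1 ^+ (n + j).
Proof.
move=> h2 hn; elim: j => [|j IH].
  rewrite addn0 subrr; have -> : nm (fun x => h n x - h n x) = nm (fun=> 0 : R).
    by apply: nm_ext => x _; rewrite subrr.
  rewrite /nm (_ : ip _ _ = 0) ?sqrtr0//.
  by rewrite /ip -[RHS](Rint0 mu I01); apply: Rint_ext => x _; rewrite mulr0.
rewrite addnS.
have -> : nm (fun x => h (n + j).+1 x - h n x) =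
    nm (fun x => (h (n + j).+1 x - h (n + j)%N x) + (h (n + j)%N x - h n x)).
  by apply: nm_ext => x _; ring.
apply: (le_trans (nmD (L2B (h2 _) (h2 _)) (L2B (h2 _) (h2 _)))).
apply: (le_trans (lerD (hn _) IH)); rewrite exprS; linarith.
Qed.

(** The series of [|h n.+1 - h n|] has integral at most 2, so it is finite almost everywhere, and
    there the telescoping sums converge absolutely. *)
Lemma ae_cvg_geometric h : (forall n, L2 (h n)) ->
  (forall n, nm (fun x => h n.+1 x - h n x) <= 2^-1 ^+ n) ->
  {ae mu, forall x, I01 x -> cvgn (h ^~ x)}.
Proof.
move=> h2 hn; pose D n (x : R) : R := `|h n.+1 x - h n x|.
have D2 n : L2 (D n) by apply: L2_norm; exact: L2B.
pose S x : \bar R := (\sum_(n <oo) (D n x)%:E)%E.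
have mD n : measurable_fun I01 (EFin \o D n) by apply/measurable_EFinP; exact: (D2 n).1.
have S0 x : (0 <= S x)%E by apply: nneseries_ge0 => n _ _; rewrite lee_fin normr_ge0.
have mS : measurable_fun I01 S.
  have H1 n x : I01 x -> xpredT n -> (0 <= (D n x)%:E)%E.
    by move=> _ _; rewrite lee_fin normr_ge0.
  exact: (@ge0_emeasurable_sum _ _ R I01 _ xpredT H1 (fun n _ => mD n)).
have IS : (\int[mu]_(x in I01) S x <= 2%:E)%E.
  rewrite integral_nneseries//; last by move=> n x _; rewrite lee_fin normr_ge0.
  have dn n : (\int[mu]_(x in I01) (D n x)%:E <= (2^-1 ^+ n : R)%:E)%E.
    rewrite -[leLHS]fineK; last by apply: integrable_fin_num => //; exact: L2_itg (D2 n).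
    rewrite lee_fin; apply: le_trans (hn n).
    by apply: Rint_norm_nm; exact: L2B.
  apply: lime_le.
    by apply: is_cvg_nneseries => n _ _; apply: integral_ge0 => x _; rewrite lee_fin normr_ge0.
  apply: nearW => n.
  suff : (\sum_(0 <= i < n) \int[mu]_(x in I01) (D i x)%:E <= (2 - 2 * 2^-1 ^+ n : R)%:E)%E.
    by move/le_trans; apply; rewrite lee_fin lerBlDr lerDl mulr_ge0// exprn_ge0.
  elim: n => [|n IH].
    by rewrite big_geq// expr0 mulr1 subrr.
  rewrite big_nat_recr//=; apply: (le_trans (leeD IH (dn n))).
  by rewrite -EFinD lee_fin exprS; linarith.
have : {ae mu, forall x, I01 x -> S x \is a fin_num}.
  apply: integrable_ae => //; apply/integrableP; split => //.
  apply: le_lt_trans (ltry 2); apply: le_trans IS.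
  by under eq_integral do rewrite gee0_abs ?S0//.
move=> H; apply: ae_imply H _ => x H Ix; have {}H := H Ix.
have c : cvgn [normed series (fun n => h n.+1 x - h n x)].
  apply: nondecreasing_is_cvgn.
    by apply: nondecreasing_series => n _ _; exact: normr_ge0.
  exists (fine (S x)) => _ [n _ <-]; rewrite -lee_fin fineK//.
  rewrite /= -sumEFin; apply: (@nneseries_lim_ge _ _ xpredT 0 n) => m _ _.
  by rewrite lee_fin normr_ge0.
move/normed_cvg : c; rewrite -/(telescope (h ^~ x)) telescopeK => /cvg_ex[l cl].
apply/cvg_ex; exists (l + h 0%N x).
have -> : (h ^~ x) = (fun n => (h n x - h 0%N x) + h 0%N x).
  by apply/funext => n; rewrite subrK.
by apply: cvgD => //; exact: cvg_cst.
Qed.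

(** Completeness of L^2 with an explicit rate: Fatou's lemma carries the bounds on [h (n + m) - h n]
    to the almost everywhere limit in [m]. *)
Lemma riesz_fischer h : (forall n, L2 (h n)) ->
  (forall n, nm (fun x => h n.+1 x - h n x) <= 2^-1 ^+ n) ->
  exists g, L2 g /\ forall n, nm (fun x => g x - h n x) <= 2 * 2^-1 ^+ n.
Proof.
move=> h2 hn; have hc := ae_cvg_geometric h2 hn.
(* The upper limit is measurable whether or not the sequence converges; where it is infinite, which
   happens on a null set only, [fine] returns 0. *)
pose g x := fine (limn_esup (fun n => (h n x)%:E)).
have mg : measurable_fun I01 g.
  apply: (measurableT_comp (@fine_measurable _ _ _)) => //.
  by apply: measurable_fun_limn_esup => n; apply/measurable_EFinP; exact: (h2 n).1.
have hg : {ae mu, forall x, I01 x -> h n x @[n --> \oo] --> g x}.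
  apply: ae_imply hc _ => x c Ix; have {}c := c Ix.
  have cl : (h n x)%:E @[n --> \oo] --> (lim (h n x @[n --> \oo]))%:E.
    by apply: cvg_EFin => //; exact: nearW.
  by rewrite /g (cvg_limn_einf_sup cl).2.
have key n : (\int[mu]_(x in I01) ((g x - h n x) ^+ 2)%:E <=
    ((2 * 2^-1 ^+ n) ^+ 2)%:E)%E.
  have mgh : measurable_fun I01 (fun x => ((g x - h n x) ^+ 2)%:E).
    apply/measurable_EFinP; apply: measurable_funX; apply: measurable_funB => //.
    exact: (h2 n).1.
  pose F m x := ((h (n + m)%N x - h n x) ^+ 2)%:E.
  have mF m : measurable_fun I01 (F m).
    apply/measurable_EFinP; apply: measurable_funX; apply: measurable_funB => //.
      exact: (h2 _).1.
    exact: (h2 n).1.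
  have F0 m x : I01 x -> (0 <= F m x)%E by move=> _; rewrite lee_fin sqr_ge0.
  have -> : (\int[mu]_(x in I01) ((g x - h n x) ^+ 2)%:E =
      \int[mu]_(x in I01) limn_einf (F ^~ x))%E.
    apply: ae_eq_integral => //.
      rewrite (_ : (fun x => _) = (fun x => - limn_esup (fun m => - F m x))%E); last first.
        by apply/funext => x; rewrite /limn_einf.
      apply: measurableT_comp => //; apply: measurable_fun_limn_esup => m.
      exact: (measurableT_comp (@oppe_measurable _ _) (mF m)).
    apply: ae_imply hg _ => x c Ix; have {}c := c Ix.
    have cl : F m x @[m --> \oo] --> ((g x - h n x) ^+ 2)%:E.
      apply: cvg_EFin; first exact: nearW.
      apply: (@cvg_comp _ _ _ _ (fun y : R => y ^+ 2) _ (nbhs (g x - h n x))).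
        apply: cvgB; last exact: cvg_cst.
        apply: (@cvg_comp _ _ _ (addn n) (h ^~ x)); [exact: cvg_addnl|exact: c].
      exact: exprn_continuous.
    by rewrite (cvg_limn_einf_sup cl).1.
  apply: (le_trans (@fatou _ _ _ mu I01 mI01 F mF F0)).
  have bnd m : (\int[mu]_(x in I01) F m x <= ((2 * 2^-1 ^+ n) ^+ 2)%:E)%E.
    have hh2 := L2B (h2 (n + m)%N) (h2 n).
    rewrite -[leLHS]fineK; last by apply: integrable_fin_num => //; exact: hh2.2.
    rewrite lee_fin.
    have -> : fine (\int[mu]_(x in I01) F m x) = nm (fun x => h (n + m)%N x - h n x) ^+ 2.
      by rewrite nm_sq; apply: Rint_ext => x _; rewrite expr2.
    rewrite ler_pXn2r ?nnegrE ?nm_ge0 ?mulr_ge0 ?exprn_ge0//.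
    apply: (le_trans (geometric_nm n m h2 hn)).
    by rewrite lerBlDr lerDl mulr_ge0// exprn_ge0.
  rewrite limn_einf_lim; apply: lime_le; first exact: is_cvg_einfs.
  apply: nearW => m; apply: le_trans (bnd m).
  by apply: ereal_inf_lbound; exists m => //=.
have g2 : L2 g.
  have gh : L2 (fun x => g x - h 0%N x).
    split; first by apply: measurable_funB => //; exact: (h2 0%N).1.
    apply/integrableP; split.
      apply/measurable_EFinP/measurable_funX/measurable_funB => //; exact: (h2 0%N).1.
    under eq_integral do rewrite /= ger0_norm ?sqr_ge0//.
    exact: le_lt_trans (key 0%N) (ltry _).
  by apply: L2_ext (L2D gh (h2 0%N)) => x _; rewrite subrK.
exists g; split=> // n; have gh := L2B g2 (h2 n).
rewrite nm_le ?mulr_ge0 ?exprn_ge0//.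
have -> : ip (fun x => g x - h n x) (fun x => g x - h n x) =
    fine (\int[mu]_(x in I01) ((g x - h n x) ^+ 2)%:E).
  by apply: Rint_ext => x _; rewrite expr2.
rewrite -lee_fin fineK//.
by apply: integrable_fin_num => //; exact: gh.2.
Qed.

End Completeness.

(** * Weak limits without compactness *)

Section WeakLimits.
Context {R : realType}.
Notation mu := (@lebesgue_measure R).
Implicit Types (f g : R -> R) (h k : nat -> R -> R).

Lemma small_pow (e : R) : 0 < e -> exists j, 2^-1 ^+ j < e.
Proof.
move=> e0; pose n := (Num.truncn e^-1).+1; exists n.
have n0 : (0 : R) < n%:R by rewrite ltr0n.
have h1 : e^-1 < n%:R by exact: truncnS_gt.
have h2 : (n%:R : R) < 2 ^+ n by rewrite -natrX ltr_nat ltn_expl.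
rewrite exprVn -[ltRHS]invrK ltf_pV2 ?posrE ?invr_gt0 ?exprn_gt0//.
exact: lt_trans h2.
Qed.

Lemma le_of_pow (a b c : R) : (forall j, a <= b + c * 2^-1 ^+ j) -> a <= b.
Proof.
move=> H; rewrite leNgt; apply/negP => ba.
have c0 : 0 < c by have := H 0%N; rewrite expr0; linarith.
have [j Hj] := @small_pow ((a - b) / c) (ltac:(rewrite divr_gt0 ?subr_gt0//)).
have := H j; rewrite ltr_pdivlMr// in Hj; nra.
Qed.

(* A minimizing sequence for the norm along a decreasing sequence of convex
   sets is Cauchy by the parallelogram identity. *)
Lemma min_norm_limit (A : nat -> (R -> R) -> Prop) (K : R) :
  (forall n f, A n f -> L2 f) ->
  (forall n m f, (n <= m)%N -> A m f -> A n f) ->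
  (forall n f g, A n f -> A n g -> A n (fun x => 2^-1 * (f x + g x))) ->
  (forall n, exists2 f, A n f & ip f f <= K) ->
  exists g, [/\ L2 g, ip g g <= K & forall n, exists2 f, A n f &
    nm (fun x => g x - f x) <= 2 * 2^-1 ^+ n].
Proof.
move=> A2 And Amid Ane.
pose V n : set R := [set r | exists2 f, A n f & r = ip f f].
have Vinf n : has_inf (V n).
  split; first by have [f Af _] := Ane n; exists (ip f f); exists f.
  by exists 0 => _ [f _ ->]; exact: ip_ge0.
pose d n := inf (V n).
have dP n f : A n f -> d n <= ip f f.
  by move=> Af; apply: ge_inf; [exact: (Vinf n).2|exists f].
have dK n : d n <= K.
  by have [f Af fK] := Ane n; exact: le_trans (dP _ _ Af) fK.
have dnd n m : (n <= m)%N -> d n <= d m.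
  move=> nm; apply: lb_le_inf; first exact: (Vinf m).1.
  by move=> _ [f Af ->]; apply: dP; exact: And Af.
pose S := sup (range d).
have Ssup : has_sup (range d).
  by split; [exists (d 0%N); exists 0%N|exists K => _ [n _ <-]].
have dS n : d n <= S by apply: sup_upper_bound => //; exists n.
have SK : S <= K by apply: ge_sup; [exact: Ssup.1|move=> _ [n _ <-]].
(* The parallelogram identity bounds the squared step by [2 (S + e j / 4) + 2 (S + e j) - 4 (S - e
   j) = 13/2 e j], and [8 * e j] is the square of [2^-1 ^+ j]. *)
pose e j : R := (2^-1 ^+ j) ^+ 2 / 8.
have e0 j : 0 < e j by rewrite divr_gt0// !exprn_gt0.
have /choice[N HN] j : exists N, (j <= N)%N /\ S - e j <= d N.
  have [_ [N _ <-] h] := sup_adherent (e0 j) Ssup.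
  exists (maxn j N); split; first exact: leq_maxl.
  by apply: (le_trans (ltW h)); apply: dnd; exact: leq_maxr.
have /choice[k Hk] j : exists f, A (N j) f /\ ip f f <= S + e j.
  have [_ [f Af ->] h] := inf_adherent (e0 j) (Vinf (N j)).
  exists f; split => //; apply: (le_trans (ltW h)); rewrite lerD2r; exact: dS.
have k2 j : L2 (k j) by exact: A2 (Hk j).1.
have step j : nm (fun x => k j.+1 x - k j x) <= 2^-1 ^+ j.
  rewrite nm_le ?exprn_ge0// ipBB//.
  have : S - e j <= ip (fun x => 2^-1 * (k j.+1 x + k j x)) (fun x => 2^-1 * (k j.+1 x + k j x)).
    have ee : e j.+1 <= e j.
      rewrite /e ler_pM2r// ler_pXn2r ?nnegrE ?exprn_ge0// exprS.
      have : 0 <= 2^-1 ^+ j :> R by rewrite exprn_ge0.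
      by linarith.
    have [le1|le2] := leqP (N j) (N j.+1).
      apply: le_trans (HN j).2 _; apply: dP; apply: Amid; last exact: (Hk j).1.
      exact: And (Hk j.+1).1.
    apply: (@le_trans _ _ (d (N j.+1))).
      apply: le_trans (HN j.+1).2; linarith.
    apply: dP; apply: Amid; first exact: (Hk j.+1).1.
    exact: And (ltnW le2) (Hk j).1.
  rewrite ipZZ; last exact: L2D.
  rewrite ipDD//.
  have h1 := (Hk j.+1).2; have h2 := (Hk j).2.
  have ee : e j.+1 = e j / 4 by rewrite /e (exprS _ j); move: (2^-1 ^+ j) => p; field.
  rewrite ee in h1.
  have -> : (2^-1 ^+ j) ^+ 2 = 8 * e j by rewrite /e; move: (2^-1 ^+ j) => p; field.
  set a := ip _ _ in h1 *; set b := ip _ _; set c := ip (k j) _ in h2 *.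
  have -> : 2^-1 ^+ 2 = 4^-1 :> R by field.
  by have := e0 j; move: (e j) h1 h2 => E; linarith.
have [g [g2 gk]] := riesz_fischer k2 step.
exists g; split=> //; last first.
  move=> n; exists (k n); last exact: gk.
  exact: And (HN n).1 (Hk n).1.
apply: le_trans SK.
have S0 : 0 <= S.
  apply: le_trans (dS 0%N); apply: lb_le_inf; first exact: (Vinf 0%N).1.
  by move=> _ [f _ ->]; exact: ip_ge0.
rewrite -[leRHS]sqr_sqrtr// -nm_le ?sqrtr_ge0//.
apply: (@le_of_pow _ _ 3) => j.
have -> : nm g = nm (fun x => (g x - k j x) + k j x).
  by apply: nm_ext => x _; rewrite subrK.
apply: (le_trans (nmD (L2B g2 (k2 j)) (k2 j))).
have p0 : 0 <= 2^-1 ^+ j :> R by rewrite exprn_ge0.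
have h : nm (k j) <= Num.sqrt S + 2^-1 ^+ j.
  rewrite nm_le ?addr_ge0 ?sqrtr_ge0//; apply: (le_trans (Hk j).2).
  rewrite sqrrD sqr_sqrtr// /e.
  have := @mulr_ge0 R _ _ (sqrtr_ge0 S) p0; have := sqr_ge0 (2^-1 ^+ j : R).
  by rewrite mulr2n; linarith.
by have := gk j; linarith.
Qed.

Lemma cvg_distP (u : nat -> R) (l : R) : u n @[n --> \oo] --> l ->
  forall e, 0 < e -> exists N, forall n, (N <= n)%N -> `|u n - l| <= e.
Proof.
move=> /cvgrPdist_le H e e0; have [N _ HN] := H e e0.
by exists N => n Nn; rewrite distrC; apply: HN.
Qed.

Lemma prim_nm g g' x : L2 g -> L2 g' -> 0 <= x <= 1 ->
  `|primitive g x - primitive g' x| <= nm (fun y => g y - g' y).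
Proof.
move=> g2 g'2 x01; have gg := L2B g2 g'2.
rewrite -!ip_indic_prim// -ipBl//; last by apply: L2_indic; linarith.
have i2 : L2 (\1_`[0, x] : R -> R) by apply: L2_indic; linarith.
apply: (le_trans (ip_nm gg i2)); rewrite -[leRHS]mulr1 ler_wpM2l ?nm_ge0//.
rewrite nm_le// expr1n -(expr1n _ 2); apply: ip_bd_le; first exact: i2.1.
by move=> y _; rewrite indicE; case: (_ \in _) => /=; rewrite ?normr1 ?normr0.
Qed.

Lemma primitiveZ c g x : L2 g -> 0 <= x <= 1 ->
  primitive (fun y => c * g y) x = c * primitive g x.
Proof.
move=> g2 /andP[x0 x1]; rewrite /primitive RintegralZl//.
by apply: itg_cc (itg_cc01 (L2_itg g2)).
Qed.

Lemma primitiveD f g x : L2 f -> L2 g -> 0 <= x <= 1 ->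
  primitive (fun y => f y + g y) x = primitive f x + primitive g x.
Proof.
move=> f2 g2 /andP[x0 x1]; rewrite /primitive RintegralD//.
  by apply: itg_cc (itg_cc01 (L2_itg f2)).
by apply: itg_cc (itg_cc01 (L2_itg g2)).
Qed.

Lemma primitiveB f g x : L2 f -> L2 g -> 0 <= x <= 1 ->
  primitive (fun y => f y - g y) x = primitive f x - primitive g x.
Proof.
move=> f2 g2 x01; have := primitiveD f2 (L2Z (-1) g2) x01.
rewrite primitiveZ// mulN1r => <-; apply: Rint_ext => y _; ring.
Qed.

(** Stands in for weak compactness together with weak lower semicontinuity of the norm. The
    functions whose primitives are within [2^-1 ^+ n] of the target at [e 0, ..., e n] form
    decreasing convex sets, and each contains a member of the sequence, of squared norm at most [K];
    elements of nearly least norm then converge strongly. *)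
Lemma weak_lsc (e : nat -> R) (k : nat -> R -> R) f (K : R) :
  (forall i, 0 <= e i <= 1) -> (forall n, L2 (k n)) ->
  (forall n, ip (k n) (k n) <= K) ->
  (forall i, primitive (k n) (e i) @[n --> \oo] --> f (e i)) ->
  exists g, [/\ L2 g, ip g g <= K & forall i, primitive g (e i) = f (e i)].
Proof.
move=> e01 k2 kK kf.
pose A n g := L2 g /\ forall i, (i <= n)%N ->
  `|primitive g (e i) - f (e i)| <= 2^-1 ^+ n.
have [g [g2 gK gA]] : exists g, [/\ L2 g, ip g g <= K & forall n, exists2 f, A n f &
    nm (fun x => g x - f x) <= 2 * 2^-1 ^+ n].
  apply: min_norm_limit.
  - by move=> n g [].
  - move=> n m g nm [g2 gA]; split=> // i ni.
    apply: le_trans (gA i (leq_trans ni nm)) _.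
    by apply: ler_wiXn2l => //; linarith.
  - move=> n g g' [g2 gA] [g'2 g'A]; split; first exact/L2Z/L2D.
    move=> i ni; rewrite primitiveZ//; last exact: L2D.
    rewrite primitiveD//; have := gA i ni; have := g'A i ni.
    rewrite !ler_norml => /andP[h1 h2] /andP[h3 h4]; apply/andP; split; linarith.
  - move=> n.
    have /choice[N HN] i : exists N, forall m, (N <= m)%N ->
        `|primitive (k m) (e i) - f (e i)| <= 2^-1 ^+ n.
      by apply: (cvg_distP (kf i)); rewrite exprn_gt0.
    pose M := (\max_(i < n.+1) N i)%N.
    exists (k M); last exact: kK.
    split=> // i ni; apply: HN.
    by apply: (@leq_bigmax _ (fun i : 'I_n.+1 => N i) (Ordinal (ni : i < n.+1)%N)).
exists g; split=> // i; apply/eqP; rewrite -subr_eq0 -normr_le0.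
apply: (@le_of_pow _ _ 3) => j; rewrite add0r.
pose m := maxn i j.
have [h [h2 hA] gh] := gA m.
have -> : primitive g (e i) - f (e i) = (primitive g (e i) - primitive h (e i)) +
  (primitive h (e i) - f (e i)) by ring.
apply: (le_trans (ler_normD _ _)).
have h1 := prim_nm g2 h2 (e01 i); have h3 := hA i (leq_maxl _ _).
have : 2^-1 ^+ m <= 2^-1 ^+ j :> R.
  by apply: ler_wiXn2l; [linarith|linarith|exact: leq_maxr].
linarith.
Qed.

Lemma ae_rderiv (a b : R) f : itg mu `[a, b] f ->
  {ae mu, forall t, a < t < b -> forall eps : R, 0 < eps ->
    exists2 d : R, 0 < d & forall r : R, 0 < r <= d ->
      `|\int[mu]_(s in `[t, t + r]) f s - r * f t| <= eps * r}.
Proof.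
move=> fi; have mab : measurable (`[a, b] : set R) by [].
have locf := integrable_locally mab fi.
move: (lebesgue_differentiation locf) => L.
apply: ae_imply L _ => t lt /andP[ta tb] eps eps0.
pose g := f \_ `[a, b].
have gi : itg mu `[a, b] g.
  by apply: itg_ext fi => // x xab; rewrite /g patchE mem_set.
have [dF F'] := @FTC1_lebesgue_pt R g (BLeft a) t b tb gi (ltac:(by rewrite lte_fin)) lt.
have gt : g t = f t by rewrite /g patchE mem_set//= in_itv/= !ltW.
have cv : r^-1 *: ((fun y => \int[mu]_(s in [set` Interval (BLeft a) (BRight y)]) g s) (r *: (1 : R) + t)
    - \int[mu]_(s in [set` Interval (BLeft a) (BRight t)]) g s) @[r --> 0^'] --> f t.
  by rewrite -gt -F' derive1E; exact: dF.
move/cvgrPdist_le : cv => /(_ eps eps0) [d /= d0 Hd].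
exists (Num.min (d / 2) (b - t)); first by rewrite lt_min subr_gt0 tb andbT; linarith.
move=> r /andP[r0]; rewrite le_min => /andP[rd rb].
have := Hd r; rewrite /ball_/= sub0r normrN gtr0_norm// => /(_ (ltac:(linarith))).
move=> /(_ (ltac:(by rewrite gt_eqF))); rewrite /GRing.scale/= mulr1 (addrC r).
have [at' tr trb] : [/\ a <= t, t <= t + r & t + r <= b] by split; linarith.
rewrite (Rint_cc_sub at' tr); last exact: itg_cc gi.
have -> : \int[mu]_(s in `[t, (t + r)]) g s = \int[mu]_(s in `[t, (t + r)]) f s.
  apply: Rint_ext => s; rewrite /= in_itv/= => /andP[ts st].
  by rewrite /g patchE mem_set//= in_itv/=; apply/andP; split; linarith.
set J := Rintegral _ _ _ => H.
have -> : J - r * f t = - (r * (f t - r^-1 * J)) by field; rewrite gt_eqF.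
by rewrite normrN normrM gtr0_norm// mulrC ler_pM2r.
Qed.

(** At a Lebesgue point [f t] is a limit of averages, and the averages are increments of a vanishing
    primitive. *)
Lemma ae0_of_primitive f : itg mu I01 f ->
  (forall x, 0 <= x <= 1 -> primitive f x = 0) ->
  {ae mu, forall x, I01 x -> f x = 0}.
Proof.
move=> fi f0; apply: ae_imply (ae_rderiv (itg_cc01 fi)) _ => t H.
rewrite /I01/= in_itv/= => /[dup] t01 /H {}H; case/andP: t01 => t0 t1.
apply/eqP; rewrite -normr_le0; apply/ler_addgt0Pr => e e0; rewrite add0r.
have [d d0 Hd] := H e e0.
pose r := Num.min d (1 - t).
have r0 : 0 < r by rewrite lt_min d0 subr_gt0.
have rd : r <= d by rewrite ge_min lexx.
have rt : r <= 1 - t by rewrite ge_min lexx orbT.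
have := Hd r; rewrite r0 rd => /(_ isT).
rewrite -(@Rint_cc_sub _ 0)//; last 3 first.
- exact: ltW.
- linarith.
- apply: itg_cc (itg_cc01 fi) => //; linarith.
rewrite -/(primitive _ _) -/(primitive _ _) !f0; [|apply/andP; split; linarith..].
by rewrite subrr sub0r normrN normrM gtr0_norm// mulrC ler_pM2r.
Qed.

Lemma rat01_dense : exists e : nat -> R, (forall i, 0 <= e i <= 1) /\
  forall x, 0 <= x <= 1 -> forall eps, 0 < eps -> exists i, `|e i - x| < eps.
Proof.
(* Rationals are clipped to [0, 1]; codes that decode to no rational give 0. *)
pose e i : R := if unpickle i is Some q then
  Num.max 0 (Num.min 1 (ratr (q : rat))) else 0.
exists e; split=> [i|x /andP[x0 x1] eps e0].
  rewrite /e; case: unpickle => [q|]; last by rewrite lexx ler01.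
  by rewrite le_max lexx/= ge_max ler01/= ge_min lexx.
have [q] := @rat_in_itvoo R (x - eps) (x + eps) (ltac:(linarith)).
rewrite in_itv/= => /andP[h1 h2].
exists (pickle q); rewrite /e pickleK.
have [h3|h3] := lerP (ratr q : R) 1.
  by rewrite ltr_norml; case: (lerP 0 (ratr q : R)) => h4; apply/andP; split; linarith.
by rewrite (max_idPr ler01) ltr_norml; apply/andP; split; linarith.
Qed.

Lemma primitive_dense (e : nat -> R) f g :
  (forall x, 0 <= x <= 1 -> forall eps, 0 < eps -> exists i, `|e i - x| < eps) ->
  (forall i, 0 <= e i <= 1) -> L2 f -> L2 g ->
  (forall i, primitive f (e i) = primitive g (e i)) ->
  forall x, 0 <= x <= 1 -> primitive f x = primitive g x.
Proof.
move=> ed e01 f2 g2 fg x x01; apply/eqP; rewrite -subr_eq0 -normr_le0.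
apply/ler_addgt0Pr => eps e0; rewrite add0r -primitiveB//.
have fg2 := L2B f2 g2; have FA := AC_prim0 (L2_itg fg2).
have [d d0 Hd] := AC_uc_sym FA e0.
have [i Hi] := ed x x01 d d0.
have := Hd (e i) x (e01 i) x01; rewrite distrC (ltW Hi) => /(_ isT).
by rewrite (primitiveB f2 g2 (e01 i)) fg subrr subr0.
Qed.

Lemma ae_of_primitive f g : L2 f -> L2 g ->
  (forall x, 0 <= x <= 1 -> primitive f x = primitive g x) ->
  {ae mu, forall x, I01 x -> f x = g x}.
Proof.
move=> f2 g2 fg; have fg2 := L2B f2 g2.
have := ae0_of_primitive (L2_itg fg2) (ltac:(by move=> x x01; rewrite primitiveB// fg// subrr)).
by move=> H; apply: ae_imply H _ => x H Ix; apply/eqP; rewrite -subr_eq0 H.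
Qed.

End WeakLimits.

(** * Curves in L^2 with a weak velocity *)

Section Translation.
Context {R : realType}.
Notation mu := (@lebesgue_measure R).
Implicit Types (f : R -> R).

(** Both measures agree on half-open intervals, which determine Lebesgue measure. *)
Lemma lebesgue_measure_shift (h : R) (A : set (measurableTypeR R)) : measurable A ->
  pushforward mu ((fun x => x + h) : _ -> measurableTypeR R) A = mu A.
Proof.
move=> mA; have mphi : measurable_fun setT ((fun x : R => x + h) : R -> measurableTypeR R).
  by apply: measurable_funD.
apply/esym/(@lebesgue_measure_unique _ (pushforward mu
  ((fun x => x + h) : measurableTypeR R -> measurableTypeR R))) => //= _ [[a b]] _ <-.
rewrite /pushforward.
have -> : (fun x : R => x + h) @^-1` `]a, b]%classic = `](a - h), (b - h)]%classic.
  by apply/seteqP; split => x /=; rewrite !in_itv/= ltrBlDr lerBrDr.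
rewrite !lebesgue_measure_itv/= !lte_fin ltrD2r.
by case: ifPn => // _; rewrite -!EFinD; congr EFin; ring.
Qed.

Lemma shift_preimage (a b h : R) :
  (fun x : R => x + h) @^-1` `[(a + h), (b + h)]%classic = `[a, b]%classic.
Proof. by apply/seteqP; split => x /=; rewrite !in_itv/= !lerD2r. Qed.

Lemma ae_shift (P : R -> Prop) (h : R) : {ae mu, forall t, P t} ->
  {ae mu, forall t, P (t + h)}.
Proof.
move=> [N [mN N0 sub]]; exists ((fun x => x + h) @^-1` N); split.
- rewrite -[X in measurable X]setTI.
  have : measurable_fun setT ((fun x : R => x + h) : measurableTypeR R -> measurableTypeR R).
    by apply: measurable_funD.
  exact.
- by rewrite -[LHS](lebesgue_measure_shift h mN) in N0 *.
- by move=> t /= nP; apply: sub.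
Qed.

Lemma shift_integral (a b h : R) f : itg mu `[a + h, b + h] f ->
  itg mu `[a, b] (fun t => f (t + h)) /\
  \int[mu]_(t in `[a, b]) f (t + h) = \int[mu]_(t in `[(a + h), (b + h)]) f t.
Proof.
move=> fi; pose D := `[a + h, b + h]%classic; pose g := f \_ D.
have mD : measurable (D : set (measurableTypeR R)) by exact: measurable_itv.
pose phi : measurableTypeR R -> measurableTypeR R := fun x => x + h.
have mphi : measurable_fun setT phi by apply: measurable_funD.
have mg : measurable_fun setT (EFin \o g).
  apply/measurable_EFinP; apply/(measurable_restrictT _ _).1 => //.
  exact: itg_meas fi.
have gi : itg mu D g.
  by apply: itg_ext fi => // x xab; rewrite /g patchE mem_set.
have eqm A : measurable A -> A `<=` D -> mu A = pushforward mu phi A.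
  by move=> mA _; rewrite [RHS]lebesgue_measure_shift.
have gphi : mu.-integrable (phi @^-1` D) ((EFin \o g) \o phi).
  apply/integrableP; split.
    by apply: (measurable_funS (E := setT)) => //; exact: measurableT_comp.
  have -> : (\int[mu]_(x in phi @^-1` D) `|((EFin \o g) \o phi) x| =
      \int[pushforward mu phi]_(x in D) `|(EFin \o g) x|)%E.
    rewrite ge0_integral_pushforward//.
    apply: (measurable_funS (E := setT)) => //.
    exact: measurableT_comp.
  rewrite -(@eq_measure_integral _ _ _ _ (pushforward mu phi) mu)//.
  by case/integrableP : gi.
have E := @integral_pushforward _ _ _ _ R phi mphi mu D (EFin \o g) mg gphi mD.
have ext x : `[a, b]%classic x -> g (phi x) = f (x + h).
  move=> xab; rewrite /g patchE mem_set// /D/=; move: xab.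
  by rewrite /= !in_itv/= /phi !lerD2r.
rewrite shift_preimage in gphi E; split.
  by apply: (@itg_ext _ _ _ mu _ (g \o phi)).
have -> : \int[mu]_(t in `[a, b]) f (t + h) = \int[mu]_(t in `[a, b]) g (phi t).
  by apply: Rint_ext => x xab; rewrite ext.
rewrite /Rintegral -[LHS]/(fine (\int[mu]_(t in `[a, b]) ((EFin \o g) \o phi) t)%E) -E.
congr fine; rewrite -(@eq_measure_integral _ _ _ _ (pushforward mu phi) mu)//.
by apply: eq_integral => x /set_mem xD; rewrite /= /g patchE mem_set.
Qed.

Lemma ae_exists (x y : R) (P : R -> Prop) : x < y -> {ae mu, forall t, P t} ->
  exists2 t, P t & x < t < y.
Proof.
move=> xy [N [mN N0 sub]]; apply: contrapT => h.
have : (mu `]x, y[ <= mu N)%E.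
  apply: le_measure; rewrite ?inE// => t; rewrite /= in_itv/= => xty.
  by apply: sub => /= Pt; apply: h; exists t.
rewrite [X in (_ <= X)%E]N0 lebesgue_measure_itv/= lte_fin xy -EFinD lee_fin.
by rewrite subr_le0 leNgt xy.
Qed.

End Translation.

(** * Energy inequalities along curves *)

Section Energy.
Context {R : realType}.
Notation mu := (@lebesgue_measure R).
Implicit Types (U G : R -> R -> R) (A : set R).

(** Intermediate times must lie in [A], so a step cannot be given the exact length [delta]; density
    provides one between [delta / 2] and [delta], which bounds the number of steps. *)
Lemma chain_dense A (N : R -> R) (delta s t : R) : 0 < delta ->
  (forall x y, s <= x -> x < y -> y <= t -> exists2 z, A z & x < z < y) ->
  (forall x y, A x -> A y -> s <= x -> x < y -> y <= t -> y - x <= delta -> N y <= N x) ->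
  A s -> A t -> s <= t -> N t <= N s.
Proof.
move=> d0 Ad H As At st.
have key n : forall y, A y -> s <= y -> y <= t -> y - s <= n%:R * (delta / 2) -> N y <= N s.
  elim: n => [|n IH] y Ay sy yt.
    by rewrite mul0r => ys; have -> : y = s by linarith.
  rewrite -natr1 mulrDl mul1r => hy.
  have [->|sny] := eqVneq y s; first by [].
  have {}sny : s < y by rewrite lt_neqAle eq_sym sny.
  have [yd|yd] := leP (y - s) delta; first by apply: H => //; linarith.
  have [z Az /andP[z1 z2]] := Ad (y - delta) (y - delta / 2) (ltac:(linarith)) (ltac:(linarith)) (ltac:(linarith)).
  apply: (@le_trans _ _ (N z)); first by apply: H => //; linarith.
  by apply: IH => //; linarith.
pose n := (Num.truncn ((t - s) / (delta / 2))).+1.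
apply: (key n) => //; rewrite -ler_pdivrMr ?divr_gt0//; apply: ltW.
exact: truncnS_gt.
Qed.

Lemma itg_cst_cc (a b k : R) : a <= b -> itg mu `[a, b] (fun=> k).
Proof.
move=> ab; have [ai _] := AC_id ab.
by apply: itg_ext (itgZ k _ ai) => // x _; rewrite mulr1.
Qed.

(* [G] is the velocity of the curve [U] in L^2, in the weak sense.  Lebesgue
   measure on Borel sets is not complete, hence the function [gamma], which
   agrees almost everywhere with [ip (G t) psi]. *)
Definition curve (T : R) A U G := [/\ forall t, A t -> L2 (U t),
  {ae mu, forall t, 0 < t < T -> A t /\ L2 (G t)},
  exists n : R -> R, itg mu `[0, T] n /\
    {ae mu, forall t, 0 < t < T -> nm (G t) <= n t} &
  forall psi, L2 psi -> exists gamma : R -> R, [/\ itg mu `[0, T] gamma,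
    {ae mu, forall t, 0 < t < T -> gamma t = ip (G t) psi} &
    forall s t, A s -> A t -> 0 <= s -> s <= t -> t <= T ->
    ip (fun x => U t x - U s x) psi = \int[mu]_(tau in `[s, t]) gamma tau]].

Lemma curve_dense T A U G : curve T A U G -> forall x y, 0 <= x -> x < y -> y <= T ->
  exists2 z, A z & x < z < y.
Proof.
move=> [_ Aae _ _] x y x0 xy yT; have [t H xty] := ae_exists xy Aae.
by exists t => //; case: H => //; case/andP: xty => h1 h2; apply/andP; split; linarith.
Qed.

Lemma ae_itv (a b : R) (P : R -> Prop) : {ae mu, forall t, a < t < b -> P t} ->
  {ae mu, forall t, `[a, b]%classic t -> P t}.
Proof.
move=> H; have n1 (c : R) : {ae mu, forall t, t != c}.
  exists [set c]; split; first by [].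
    exact: lebesgue_measure_set1.
  by move=> t /= /negP; rewrite negbK => /eqP.
have n2 : {ae mu, forall t : R, t != a /\ t != b} by apply: ae_imply2 (n1 a) (n1 b) _.
apply: ae_imply2 H n2 _ => t H [ta tb]; rewrite /= in_itv/= => /andP[at' tb'].
by apply: H; rewrite !lt_neqAle eq_sym ta at' tb' tb.
Qed.

(** The increment itself is taken as test function: its squared norm is the time integral of its
    pairings with [G], hence at most its norm times the integral of [n]. *)
Lemma curve_increment T A U G (n : R -> R) (s t : R) : curve T A U G ->
  itg mu `[0, T] n -> (forall t, 0 <= n t) ->
  {ae mu, forall t, 0 < t < T -> nm (G t) <= n t} ->
  A s -> A t -> 0 <= s -> s <= t -> t <= T ->
  nm (fun x => U t x - U s x) <= \int[mu]_(tau in `[s, t]) n tau.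
Proof.
move=> [U2 Aae _ W] ni n0 Gn As At s0 st tT.
set psi := fun x => _; have psi2 : L2 psi by apply: L2B; exact: U2.
set I := Rintegral _ _ _.
have I0 : 0 <= I by exact: Rintegral_ge0.
have niST : itg mu `[s, t] n by exact: itg_cc s0 tT ni.
have : ip psi psi <= I * nm psi.
  have [gamma [gi ge E]] := W psi psi2.
  rewrite [X in X <= _](E s t)// mulrC -RintegralZl//.
  apply: Rint_ae_le => //.
  - exact: itg_cc s0 tT gi.
  - exact: itgZ.
  apply: ae_itv; apply: ae_imply2 (ae_imply2 Aae Gn (fun _ a b => conj a b)) ge _ => tau [HA Hn] Hg /andP[h1 h2].
  have t0T : 0 < tau < T by apply/andP; split; linarith.
  have [_ G2] := HA t0T; have {}Hn := Hn t0T; rewrite Hg//.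
  by apply: (le_trans (ip_le_nm G2 psi2)); rewrite mulrC ler_wpM2l ?nm_ge0.
rewrite -nm_sq expr2 => h.
have [->|nz] := eqVneq (nm psi) 0; first by [].
by rewrite -(@ler_pM2r _ (nm psi))// lt_neqAle eq_sym nz nm_ge0.
Qed.

Lemma curve_modulus T A U G : curve T A U G ->
  exists n : R -> R, [/\ itg mu `[0, T] n, forall t, 0 <= n t,
   {ae mu, forall t, 0 < t < T -> nm (G t) <= n t} &
   forall s t, A s -> A t -> 0 <= s -> s <= t -> t <= T ->
     nm (fun x => U t x - U s x) <= \int[mu]_(tau in `[s, t]) n tau].
Proof.
move=> C; have [_ _ [n [ni Gn]] _] := C; exists (fun t => `|n t|).
have ani : itg mu `[0, T] (fun t => `|n t|) by exact: itg_norm.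
have aGn : {ae mu, forall t, 0 < t < T -> nm (G t) <= `|n t|}.
  by apply: ae_imply Gn _ => t H /H /le_trans; apply; exact: ler_norm.
by split=> // s t As At s0 st tT; exact: curve_increment C ani _ aGn As At s0 st tT.
Qed.

(** [|U y|^2 - |U x|^2] is the pairing of [U y - U x] with [U y + U x], hence a time integral of
    pairings of [G tau] with [U y + U x]. Over a short step this sum differs from [2 U tau] by at
    most [2 e'] in norm; weighted by the integrable [n], these errors add up to at most [e]. *)
Lemma curve_energy T A U G (s t k : R) : curve T A U G -> A s -> A t ->
  0 <= s -> s <= t -> t <= T ->
  {ae mu, forall tau, s < tau < t -> ip (G tau) (U tau) <= k} ->
  ip (U t) (U t) - ip (U s) (U s) <= 2 * k * (t - s).
Proof.
move=> C As At s0 st tT Hk; have [n [ni n0 Gn mod]] := curve_modulus C.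
have [U2 Aae _ W] := C.
have KA := AC_int 0 ni; set K := (fun x => 0 + _) in KA.
have Ksub x y : 0 <= x -> x <= y -> y <= T -> K y - K x = \int[mu]_(tau in `[x, y]) n tau.
  by move=> x0 xy yT; rewrite (AC_sub KA).
have Kst : 0 <= K t - K s by rewrite Ksub//; exact: Rintegral_ge0.
apply/ler_addgt0Pr => e e0; pose e' := e / (2 * (K t - K s + 1)).
have e'0 : 0 < e' by rewrite divr_gt0// mulr_gt0//; linarith.
have [d d0 Hd] := AC_uc KA e'0.
pose N x := ip (U x) (U x) - 2 * k * x - 2 * e' * K x.
have : N t <= N s.
  apply: (chain_dense d0 _ _ As At st).
    by move=> x y sx xy yt; apply: (curve_dense C); linarith.
  move=> x y Ax Ay sx xy yt yxd.
  have x0 : 0 <= x by linarith.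
  have yT : y <= T by linarith.
  have xy' := ltW xy.
  have S2 : L2 (fun z => U y z + U x z) by apply: L2D; exact: U2.
  have -> : N y = ip (U y) (U y) - ip (U x) (U x) + ip (U x) (U x) - 2 * k * y - 2 * e' * K y.
    by rewrite /N; ring.
  have -> : ip (U y) (U y) - ip (U x) (U x) =
      ip (fun z => U y z - U x z) (fun z => U y z + U x z).
    have := U2 _ Ax; have := U2 _ Ay => y2 x2.
    by rewrite ipBl ?ipDr// (ipC (U x)); ring.
  have [gamma [gi ge E]] := W _ S2; rewrite (E x y)//.
  suff : \int[mu]_(tau in `[x, y]) gamma tau <=
     2 * k * (y - x) + 2 * e' * (K y - K x) by rewrite /N; linarith.
  have niXY := itg_cc x0 yT ni.
  rewrite Ksub// -Rint_cst_cc// -RintegralZl// -RintegralD//; last 2 first.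
  - exact: itg_cst_cc.
  - exact: itgZ.
  apply: Rint_ae_le => //.
  - exact: itg_cc x0 yT gi.
  - apply: itgD => //; last exact: itgZ.
    exact: itg_cst_cc.
  apply: ae_itv; apply: ae_imply2 (ae_imply2 Aae Gn (fun _ a b => conj a b))
    (ae_imply2 Hk ge (fun _ a b => conj a b)) _ => tau [HA Hn] [{}Hk Hg] /andP[h1 h2].
  have tau0 : 0 < tau by exact: le_lt_trans h1.
  have t0T : 0 < tau < T by rewrite tau0 (lt_le_trans h2).
  have [Atau G2] := HA t0T; have {}Hn := Hn t0T; rewrite Hg//.
  have {}Hk : ip (G tau) (U tau) <= k.
    by apply: Hk; rewrite (le_lt_trans sx)//= (lt_le_trans h2).
  have Ut := U2 _ Atau; have Ux := U2 _ Ax; have Uy := U2 _ Ay.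
  have D1 := L2B Uy Ut; have D2 := L2B Ut Ux.
  have -> : ip (G tau) (fun z => U y z + U x z) = ip (G tau) (fun z => U y z - U tau z) -
     ip (G tau) (fun z => U tau z - U x z) + 2 * ip (G tau) (U tau).
    by rewrite ipDr// !ipBr//; ring.
  have m1 : nm (fun z => U y z - U tau z) <= e'.
    apply: (le_trans (mod tau y Atau Ay (ltW tau0) (ltW h2) yT)).
    rewrite -(Ksub _ _ (ltW tau0) (ltW h2) yT); apply: (le_trans (ler_norm _)).
    by apply: (Hd _ _ (ltW tau0) (ltW h2) yT); clear -h1 yxd; lra.
  have m2 : nm (fun z => U tau z - U x z) <= e'.
    have tauT : tau <= T by exact: le_trans (ltW h2) yT.
    apply: (le_trans (mod x tau Ax Atau x0 (ltW h1) tauT)).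
    rewrite -(Ksub _ _ x0 (ltW h1) tauT); apply: (le_trans (ler_norm _)).
    by apply: (Hd _ _ x0 (ltW h1) tauT); clear -h2 yxd; lra.
  have p1 := ip_nm G2 D1; have p2 := ip_nm G2 D2.
  have q1 : nm (G tau) * nm (fun z => U y z - U tau z) <= n tau * e'.
    by apply: ler_pM => //; exact: nm_ge0.
  have q2 : nm (G tau) * nm (fun z => U tau z - U x z) <= n tau * e'.
    by apply: ler_pM => //; exact: nm_ge0.
  move: p1 p2; rewrite !ler_norml => /andP[_ p1] /andP[p2 _].
  by clear -p1 p2 q1 q2 Hk; lra.
rewrite /N => h.
have : 2 * e' * (K t - K s) <= e.
  rewrite /e' -mulrA mulrC -mulrA -mulrA; rewrite mulrCA [leLHS](_ : _ = e * ((K t - K s) / (K t - K s + 1))); last first.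
    by field; clear -Kst; lra.
  by rewrite -[leRHS]mulr1 ler_wpM2l ?(ltW e0)// ler_pdivrMr ?mul1r; clear -Kst; lra.
by clear -h; lra.
Qed.

End Energy.

(** * Lipschitz bounds and velocities of curves *)

Section Curves.
Context {R : realType}.
Notation mu := (@lebesgue_measure R).
Implicit Types (U G : R -> R -> R) (A : set R).

Lemma ae_all (P : nat -> R -> Prop) : (forall n, {ae mu, forall x, P n x}) ->
  {ae mu, forall x, forall n, P n x}.
Proof. by move=> H; apply/ae_foralln => n; exact: H. Qed.

Lemma curve_sub T A U G V : curve T A U G -> L2 V ->
  curve T A (fun t x => U t x - V x) G.
Proof.
move=> [U2 Aae N W] V2; split=> //; first by move=> t At; apply: L2B => //; exact: U2.
move=> psi psi2; have [g [gi ge E]] := W psi psi2; exists g; split=> // s t As At s0 st tT.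
rewrite -(E s t)//; apply: ip_ext => // x _; ring.
Qed.

(* Square roots are regularized by [eta] in order to divide by the norm. *)
Lemma curve_lipschitz T A U G (s t : R) g : curve T A U G -> A s -> A t ->
  0 <= s -> s <= t -> t <= T -> L2 g ->
  {ae mu, forall tau, s < tau < t ->
    ip (fun x => G tau x - g x) (fun x => U tau x - U s x) <= 0} ->
  nm (fun x => U t x - U s x) <= (t - s) * nm g.
Proof.
move=> C As At s0 st tT g2 H; have U2 : forall t, A t -> L2 (U t) by case: C.
have Aae : {ae mu, forall t, 0 < t < T -> A t /\ L2 (G t)} by case: C.
have [n [ni n0 Gn mod]] := curve_modulus C.
have Cw := curve_sub C (U2 s As); set w := (fun t x => U t x - U s x) in Cw.
have w2 tau : A tau -> L2 (w tau) by case: Cw => h _ _ _; exact: h.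
have KA := AC_int 0 ni; set K := (fun x => 0 + _) in KA.
have Ksub x y : 0 <= x -> x <= y -> y <= T -> K y - K x = \int[mu]_(tau in `[x, y]) n tau.
  by move=> x0 xy yT; rewrite (AC_sub KA).
set c := nm g; have c0 : 0 <= c by exact: nm_ge0.
suff key eta : 0 < eta -> nm (w t) <= eta + c * (1 + eta) * (t - s).
  rewrite mulrC; apply/ler_addgt0Pr => e e0.
  have ct : 0 <= c * (t - s) by rewrite mulr_ge0// subr_ge0.
  have := key (e / (1 + c * (t - s))) (ltac:(rewrite divr_gt0//; linarith)).
  move/le_trans; apply; rewrite le_eqVlt; apply/orP; left; apply/eqP.
  by field; linarith.
move=> eta0; pose Y x := Num.sqrt (ip (w x) (w x) + eta ^+ 2).
have Ysq x : Y x ^+ 2 = nm (w x) ^+ 2 + eta ^+ 2.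
  by rewrite sqr_sqrtr ?nm_sq// addr_ge0 ?ip_ge0// sqr_ge0.
have Y0 x : 0 <= Y x by exact: sqrtr_ge0.
have YE x : eta <= Y x.
  by rewrite -(@ler_pXn2r _ 2) ?nnegrE ?(ltW eta0)// Ysq lerDr sqr_ge0.
have Yw x : nm (w x) <= Y x.
  by rewrite -(@ler_pXn2r _ 2) ?nnegrE ?nm_ge0// Ysq lerDl sqr_ge0.
have e0 : 0 < eta ^+ 2 by rewrite exprn_gt0.
have [d d0 Hd] := AC_uc KA e0.
pose N x := Y x - c * (1 + eta) * x.
have : N t <= N s.
  apply: (chain_dense d0 _ _ As At st).
    by move=> x y sx xy yt; apply: (curve_dense C); linarith.
  move=> x y Ax Ay sx xy yt yxd.
  have x0 : 0 <= x by linarith.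
  have yT : y <= T by linarith.
  (* Integrated form of [d|w|^2 <= 2 c |w| dt]: the hypothesis gives
     [ip (G tau) (w tau) <= c * nm (w tau)], and on a short step [nm (w tau)] exceeds [nm (w x)] by
     at most [eta ^+ 2]. *)
  have := @curve_energy R T A w G x y (c * (nm (w x) + eta ^+ 2)) Cw Ax Ay x0 (ltW xy) yT.
  move=> h; have {}h := h _.
  have E : ip (w y) (w y) - ip (w x) (w x) <= 2 * (c * (nm (w x) + eta ^+ 2)) * (y - x).
    apply: h; apply: ae_imply2 Aae H _ => tau HA Hm /andP[h1 h2].
    have [Atau G2] : A tau /\ L2 (G tau) by apply: HA; apply/andP; split; linarith.
    have {}Hm := Hm (ltac:(apply/andP; split; linarith)).
    have wt2 := w2 _ Atau; have wx2 := w2 _ Ax.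
    rewrite ipBl// in Hm.
    have g1 := ip_le_nm g2 wt2; rewrite -/c in g1.
    have m1 : nm (w tau) <= nm (w x) + eta ^+ 2.
      have -> : nm (w tau) = nm (fun z => w x z + (w tau z - w x z)).
        by apply: nm_ext => z _; ring.
      apply: (le_trans (nmD wx2 (L2B wt2 wx2))); rewrite lerD2l.
      have -> : nm (fun z => w tau z - w x z) = nm (fun z => U tau z - U x z).
        by apply: nm_ext => z _; rewrite /w; ring.
      apply: (le_trans (mod x tau Ax Atau _ _ _)); [linarith|linarith|linarith|].
      rewrite -Ksub; [|linarith..].
      by apply: (le_trans (ler_norm _)); apply: Hd; linarith.
    have := ler_wpM2l c0 m1; rewrite -/(w tau) in Hm; linarith.
  have nw0 := nm_ge0 (w x).
  suff : Y y <= Y x + c * (1 + eta) * (y - x) by rewrite /N; linarith.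
  have r0 : 0 <= Y x + c * (1 + eta) * (y - x).
    by rewrite addr_ge0// !mulr_ge0//; linarith.
  rewrite -(@ler_pXn2r _ 2) ?nnegrE// sqrrD !Ysq.
  rewrite -!nm_sq in E.
  (* [Y x] dominates both [nm (w x)] and [eta]; the second bound turns [eta ^+ 2] into at most
     [eta * Y x]. *)
  have a1 : nm (w x) + eta ^+ 2 <= Y x * (1 + eta).
    by have := YE x; have := Yw x; rewrite mulrDr mulr1 expr2; nra.
  have a2 : c * (y - x) * (nm (w x) + eta ^+ 2) <= c * (y - x) * (Y x * (1 + eta)).
    by apply: ler_wpM2l => //; rewrite mulr_ge0// subr_ge0 ltW.
  have a3 := sqr_ge0 (c * (1 + eta) * (y - x)).
  rewrite mulr2n; linarith.
rewrite /N => h.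
have Ys : Y s = eta.
  rewrite /Y (_ : ip _ _ = 0) ?add0r ?sqrtr_sqr ?gtr0_norm//.
  by rewrite /ip -[RHS](Rint0 mu I01); apply: Rint_ext => x _; rewrite /w subrr mulr0.
by have := Yw t; linarith.
Qed.

(** Null sets are translation invariant, so [t] and [t + h] are both good times for almost every
    [t]. Applied to this curve, the energy inequality controls increments over a fixed time. *)
Lemma curve_shift T A U G h : 0 < h -> curve T A U G ->
  curve (T - h) [set t | A t /\ A (t + h)]
    (fun t x => U (t + h) x - U t x) (fun t x => G (t + h) x - G t x).
Proof.
move=> h0 [U2 Aae [n [ni Gn]] W].
have sh P : {ae mu, forall t, 0 < t < T -> P t} ->
    {ae mu, forall t, 0 < t < T - h -> P t /\ P (t + h)}.
  move=> H; have H' := ae_shift h H; apply: ae_imply2 H H' _ => t H1 H2 /andP[t0 t1].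
  by split; [apply: H1|apply: H2]; apply/andP; split; linarith.
have shi f : itg mu `[0, T] f -> itg mu `[0, T - h] f /\ itg mu `[0, T - h] (fun t => f (t + h)).
  move=> fi; split.
    by apply: itg_cc fi; linarith.
  apply: (shift_integral _).1; apply: itg_cc fi; linarith.
split.
- by move=> t [At Ath]; apply: L2B; exact: U2.
- apply: ae_imply (sh _ Aae) _ => t H /H[[? ?] [? ?]]; split=> //; exact: L2B.
- exists (fun t => n (t + h) + n t); split.
    by have [n1 n2] := shi _ ni; exact: itgD.
  apply: ae_imply2 (sh _ Aae) (sh _ Gn) _ => t H1 H2 t0T.
  have [[_ G1] [_ G2]] := H1 t0T; have [n1 n2] := H2 t0T.
  by apply: (le_trans (nmB G2 G1)); exact: lerD.
move=> psi psi2; have [g [gi ge E]] := W psi psi2.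
have [g1 g2] := shi _ gi.
exists (fun t => g (t + h) - g t); split; first exact: itgB.
  apply: ae_imply2 (sh _ Aae) (sh _ ge) _ => t H1 H2 t0T.
  have [[_ G1] [_ G2]] := H1 t0T; have [e1 e2] := H2 t0T.
  by rewrite e1 e2 ipBl.
move=> s t [As Ash] [At Ath] s0 st tT.
rewrite RintegralB//; last 2 first.
- by apply: itg_cc g2.
- by apply: itg_cc g1.
rewrite -(E s t)//; last by linarith.
rewrite (shift_integral (itg_cc _ _ gi)).2; [|linarith|linarith].
rewrite -(E (s + h) (t + h))//; [|linarith..].
rewrite -ipBl//; [|by apply: L2B; exact: U2..].
by apply: ip_ext => // x _; ring.
Qed.

(** Fix [t] outside a null set, a Lebesgue point of the pairings of [G] with the indicators of all
    [[0, e i]]. Difference quotients along suitable [h m] tending to 0 have norm at most [c], and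
    their primitives converge at each [e i] to that of [G t]; by [weak_lsc] the norm bound survives
    the limit. *)
Lemma velocity_bound T A U G (c : R) : curve T A U G -> 0 <= c ->
  {ae mu, forall h, 0 < h < T -> forall t, A t -> A (t + h) -> 0 <= t -> t + h <= T ->
     nm (fun x => U (t + h) x - U t x) <= c * h} ->
  {ae mu, forall t, 0 < t < T -> nm (G t) <= c}.
Proof.
move=> C c0 H; have [U2 Aae N W] := C.
have [e [e01 ed]] := @rat01_dense R.
pose X i : R -> R := \1_`[0, e i].
have X2 i : L2 (X i) by apply: L2_indic => //; have /andP[] := e01 i.
have /choice[g Hg] i := W (X i) (X2 i).
have D : {ae mu, forall t, forall i, 0 < t < T -> forall eps : R, 0 < eps ->
    exists2 d : R, 0 < d & forall r : R, 0 < r <= d ->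
      `|\int[mu]_(s in `[t, t + r]) g i s - r * g i t| <= eps * r}.
  apply: ae_all => i; apply: ae_rderiv.
  by have [] := Hg i.
have Ge : {ae mu, forall t, forall i, 0 < t < T -> g i t = ip (G t) (X i)}.
  by apply: ae_all => i; have [] := Hg i.
have P : {ae mu, forall t, (0 < t < T -> A t /\ L2 (G t)) /\
   (forall i, 0 < t < T -> forall eps : R, 0 < eps ->
    exists2 d : R, 0 < d & forall r : R, 0 < r <= d ->
      `|\int[mu]_(s in `[t, t + r]) g i s - r * g i t| <= eps * r)}.
  by apply: ae_imply2 Aae D _.
apply: ae_imply2 P Ge _ => t [HA HD] HG t0T.
have [At G2] := HA t0T; have {}HD := fun i => HD i t0T; have {}HG := fun i => HG i t0T.
have /andP[t0 tT] := t0T.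
(* [A (t + h)] holds for almost every [h], so admissible increments exist arbitrarily close to 0. *)
have Hh : {ae mu, forall h, 0 < h < T - t -> A (t + h) /\
    nm (fun x => U (t + h) x - U t x) <= c * h}.
  have Ash := ae_shift t Aae; apply: ae_imply2 Ash H _ => h HA' H' /andP[h0 h1].
  have [Ath _] : A (h + t) /\ L2 (G (h + t)) by apply: HA'; apply/andP; split; linarith.
  rewrite addrC in Ath; split=> //; apply: H' => //; [apply/andP; split; linarith|linarith|linarith].
have /choice[h hP] m : exists h : R, (0 < h < T - t -> A (t + h) /\
    nm (fun x => U (t + h) x - U t x) <= c * h) /\ 0 < h < Num.min (T - t) (m.+1%:R^-1).
  have mp : 0 < Num.min (T - t) (m.+1%:R^-1).
    by rewrite lt_min subr_gt0 tT/= invr_gt0 ltr0n.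
  have [h h1 h2] := ae_exists mp Hh.
  by exists h.
have {hP} hP m : [/\ 0 < h m, h m <= m.+1%:R^-1, t + h m <= T, A (t + h m) &
    nm (fun x => U (t + h m) x - U t x) <= c * h m].
  have [h1 /andP[h2]] := hP m; rewrite lt_min => /andP[h3 h4].
  by have [a b] := h1 (ltac:(by rewrite h2 h3)); split=> //; [exact: ltW|linarith].
pose k m x := (h m)^-1 * (U (t + h m) x - U t x).
have k2 m : L2 (k m) by have [_ _ _ a _] := hP m; apply/L2Z/L2B; exact: U2.
have kK m : ip (k m) (k m) <= c ^+ 2.
  have [h0 _ _ a b] := hP m.
  rewrite -nm_le// nmZ; last by apply: L2B; exact: U2.
  by rewrite gtr0_norm ?invr_gt0// ler_pdivrMl// mulrC.
have kf i : primitive (k m) (e i) @[m --> \oo] --> primitive (G t) (e i).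
  apply/cvgrPdist_le => eps e0; have [d d0 Hd] := HD i eps e0.
  have [M HM] : exists M : nat, M.+1%:R^-1 <= d.
    exists (Num.truncn d^-1); rewrite -[leRHS]invrK lef_pV2 ?posrE ?invr_gt0// ltW//.
    by rewrite truncnS_gt.
  near=> m; have [h0 hm thT a _] := hP m.
  have hd : h m <= d.
    apply: (le_trans hm); apply: le_trans HM.
    rewrite lef_pV2 ?posrE ?ltr0n// ler_nat ltnS.
    by near: m; exact: nbhs_infty_ge.
  have UU := L2B (U2 _ a) (U2 _ At).
  rewrite primitiveZ// -!ip_indic_prim// -/(X i) -HG.
  have [gi _ E] := Hg i; rewrite (E t (t + h m))//; [|linarith..].
  have := Hd (h m); rewrite h0 hd => /(_ isT); set J := Rintegral _ _ _ => HJ.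
  have -> : g i t - (h m)^-1 * J = - ((h m)^-1 * (J - h m * g i t)).
    by field; rewrite gt_eqF.
  by rewrite normrN normrM gtr0_norm ?invr_gt0// ler_pdivrMl// (mulrC _ eps).
have [l [l2 lK lE]] := weak_lsc e01 k2 kK kf.
have lG := ae_of_primitive l2 G2 (primitive_dense ed e01 l2 G2 lE).
by rewrite -(nm_ae l2 G2 lG) nm_le.
Unshelve. all: by end_near. Qed.

End Curves.

(** * Reciprocals of unit-mass densities *)

Section States.
Context {R : realType}.
Notation mu := (@lebesgue_measure R).
Implicit Types (p g : R -> R).

(* [p] stands for 1/u and [g] for its derivative; [vol p] is then the primitive
   of u. *)
Definition state p g := [/\ AC 0 1 p g, L2 g, forall x, 0 <= x <= 1 -> 0 < p x &
  \int[mu]_(x in I01) (p x)^-1 = 1].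

Definition vol p : R -> R := primitive (fun y => (p y)^-1).

Lemma AC_lb p g : AC 0 1 p g -> (forall x, 0 <= x <= 1 -> 0 < p x) ->
  exists2 m, 0 < m & forall x, 0 <= x <= 1 -> m <= p x.
Proof.
move=> pA p0; have [z] := EVT_min ler01 (AC_cont ler01 pA).
rewrite in_itv/= => z01 H; exists (p z); first exact: p0.
by move=> x x01; apply: H; rewrite in_itv.
Qed.

Lemma inv_meas d (T : measurableType d) (D : set T) (p : T -> R) : measurable_fun D p ->
  (forall x, D x -> 0 < p x) -> measurable_fun D (fun x => (p x)^-1).
Proof.
move=> mp p0; apply: (@measurable_ext _ _ _ _ (fun x => (p x) `^ (-1))).
  by move=> x Dx; rewrite powR_inv1// ltW// p0.
by apply: (measurableT_comp (measurable_powR _)).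
Qed.

Lemma AC_inv_L2 p g : AC 0 1 p g -> (forall x, 0 <= x <= 1 -> 0 < p x) ->
  L2 (fun x => (p x)^-1).
Proof.
move=> pA p0; have [m m0 mp] := AC_lb pA p0; apply: (@L2_bd _ _ m^-1).
  by apply: inv_meas (AC01_meas pA) _ => x /I01P; exact: p0.
move=> x /I01P x01; rewrite ger0_norm; last by rewrite invr_ge0 ltW// p0.
by rewrite lef_pV2 ?posrE ?p0// mp.
Qed.

Lemma state_inv_L2 p g : state p g -> L2 (fun x => (p x)^-1).
Proof. by case=> pA _ p0 _; exact: AC_inv_L2 pA p0. Qed.

Lemma vol_AC p g : state p g -> AC 0 1 (vol p) (fun x => (p x)^-1).
Proof. by move=> S; exact/AC_prim0/L2_itg/state_inv_L2/S. Qed.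

Lemma vol_L2 p g : state p g -> L2 (vol p).
Proof. by move=> /vol_AC/AC01_L2. Qed.

Lemma vol0 p : vol p 0 = 0. Proof. exact: primitive0. Qed.

Lemma vol1 p g : state p g -> vol p 1 = 1.
Proof.
move=> S; rewrite /vol primitive1; first by case: S.
exact/L2_itg/state_inv_L2/S.
Qed.

Lemma AC_B (a b : R) F f G g : AC a b F f -> AC a b G g ->
  AC a b (fun x => F x - G x) (fun x => f x - g x).
Proof.
move=> FA GA; split.
  by apply: itgB => //; [exact: FA.1|exact: GA.1].
move=> x xab; rewrite RintegralB//.
- by rewrite (FA.2 x xab) (GA.2 x xab); ring.
- by apply: itg_cc FA.1 => //; case/andP: xab.
- by apply: itg_cc GA.1 => //; case/andP: xab.
Qed.

(** The two volumes agree at 0 and, by the unit mass, at 1, so integration by parts has no boundary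
    terms. *)
Lemma state_parts p1 g1 p2 g2 : state p1 g1 -> state p2 g2 ->
  ip (fun x => g1 x - g2 x) (fun x => vol p1 x - vol p2 x) =
  - ip (fun x => p1 x - p2 x) (fun x => (p1 x)^-1 - (p2 x)^-1).
Proof.
move=> S1 S2; have [A1 g12 _ _] := S1; have [A2 g22 _ _] := S2.
have dA := AC_B A1 A2; have WA := AC_B (vol_AC S1) (vol_AC S2).
have := ip_parts WA dA (L2B (state_inv_L2 S1) (state_inv_L2 S2)) (L2B g12 g22).
rewrite !vol0 (vol1 S1) (vol1 S2) !subrr !mul0r subrr ipC => /eqP.
by rewrite addr_eq0 => /eqP.
Qed.

Lemma ip_le_ip f1 f2 f3 f4 : L2 f1 -> L2 f2 -> L2 f3 -> L2 f4 ->
  (forall x : R, 0 <= x <= 1 -> f1 x * f2 x <= f3 x * f4 x) -> ip f1 f2 <= ip f3 f4.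
Proof.
move=> L1 L2' L3 L4 H; apply: le_Rintegral => //; try exact: L2_itgM.
by move=> x /I01P; exact: H.
Qed.

Lemma inv_diff_le (a b m : R) : 0 < m -> m <= a -> m <= b ->
  m ^+ 2 * ((a^-1 - b^-1) * (a^-1 - b^-1)) <= - ((a - b) * (a^-1 - b^-1)).
Proof.
move=> m0 ma mb; have a0 := lt_le_trans m0 ma; have b0 := lt_le_trans m0 mb.
have -> : - ((a - b) * (a^-1 - b^-1)) = a * b * ((a^-1 - b^-1) * (a^-1 - b^-1)).
  by field; rewrite !gt_eqF.
rewrite ler_wpM2r// -?expr2 ?sqr_ge0// expr2; apply: ler_pM => //; exact: ltW.
Qed.

(** The right side is the integral of [p1 p2 (1/p1 - 1/p2)^2], at least [m^2] times the squared norm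
    of the derivative of the difference of volumes. That difference vanishes at both ends, so
    Wirtinger's inequality applies to it. *)
Lemma monotone p1 g1 p2 g2 (m : R) : state p1 g1 -> state p2 g2 -> 0 < m ->
  (forall x, 0 <= x <= 1 -> m <= p1 x) -> (forall x, 0 <= x <= 1 -> m <= p2 x) ->
  (m ^+ 2 * pi ^+ 2) * ip (fun x => vol p1 x - vol p2 x) (fun x => vol p1 x - vol p2 x) <=
  ip (fun x => g1 x - g2 x) (fun x => vol p1 x - vol p2 x).
Proof.
move=> S1 S2 m0 m1 m2; rewrite (state_parts S1 S2).
have i1 := state_inv_L2 S1; have i2 := state_inv_L2 S2; have d2 := L2B i1 i2.
have WA := AC_B (vol_AC S1) (vol_AC S2).
have := wirtinger WA d2; rewrite !vol0 (vol1 S1) (vol1 S2) !subrr => /(_ erefl erefl) Wi.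
have mm : 0 <= m ^+ 2 := sqr_ge0 _.
have := ler_wpM2l mm Wi; rewrite mulrA => /le_trans; apply.
have [A1 _ _ _] := S1; have [A2 _ _ _] := S2.
have P2 := L2B (AC01_L2 A1) (AC01_L2 A2).
rewrite -ipNl// -ipZl//; apply: ip_le_ip => //; [exact: L2Z|exact: L2N|].
move=> x x01; rewrite mulNr -mulrA; apply: inv_diff_le m0 _ _; [exact: m1|exact: m2].
Qed.

Lemma monotone0 p1 g1 p2 g2 : state p1 g1 -> state p2 g2 ->
  0 <= ip (fun x => g1 x - g2 x) (fun x => vol p1 x - vol p2 x).
Proof.
move=> S1 S2; have [A1 _ P1 _] := S1; have [A2 _ P2 _] := S2.
have [m1 m10 H1] := AC_lb A1 P1; have [m2 m20 H2] := AC_lb A2 P2.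
apply: le_trans (@monotone _ _ _ _ (Num.min m1 m2) S1 S2 _ _ _).
- by rewrite mulr_ge0 ?ip_ge0// mulr_ge0// sqr_ge0.
- by rewrite lt_min m10.
- by move=> x x01; rewrite ge_min H1.
- by move=> x x01; rewrite ge_min H2 ?orbT.
Qed.

Lemma state_w p g : state p g -> exists2 w1 : R, 0 < w1 & exists w2 : R,
  forall x, I01 x -> w1 <= (p x)^-1 <= w2.
Proof.
move=> [pA _ p0 _]; have [m m0 mp] := AC_lb pA p0.
have [M MP] := AC_bd ler01 pA.
have M0 : 0 < M.
  apply: (lt_le_trans m0); apply: (le_trans (mp 0 _)); first by rewrite lexx ler01.
  by apply: le_trans (MP 0 _); [exact: ler_norm|rewrite lexx ler01].
exists M^-1; first by rewrite invr_gt0.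
exists m^-1 => x /I01P x01.
have px := p0 x x01; rewrite !lef_pV2 ?posrE// mp// andbT.
by apply: le_trans (MP x x01); exact: ler_norm.
Qed.

(** [p - 1] has mean 0 for the weight [1/p], since both 1 and [1/p] have integral 1. *)
Lemma state_one p g : state p g -> exists2 z, 0 <= z <= 1 & p z = 1.
Proof.
move=> S; have [pA g2 p0 p1] := S.
have qA : AC 0 1 (fun x => p x - 1) g.
  by apply: AC_ext (AC_B pA (AC_cst 0 1 1)) => // x _; rewrite subr0.
have [w1 w10 [w2 W]] := state_w S; have i2 := state_inv_L2 S.
have E : \int[mu]_(x in I01) ((p x)^-1 * (p x - 1)) = 0.
  transitivity (\int[mu]_(x in I01) (1 - (p x)^-1)).
    by apply: Rint_ext => x /I01P /p0 px; field; rewrite gt_eqF.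
  rewrite RintegralB ?Rint_cst01 ?p1 ?subrr//; first exact/L2_itg/L2_cst.
  exact: L2_itg.
have [z z01 qz] := zero_of_weighted_mean qA i2.1 w10 (ex_intro _ w2 W) E.
by exists z => //; linarith.
Qed.

Lemma AC_osc p g x y : AC 0 1 p g -> L2 g -> 0 <= x <= 1 -> 0 <= y <= 1 ->
  `|p x - p y| <= nm g.
Proof.
move=> pA g2 x01 y01.
rewrite -(@ler_pXn2r _ 2) ?nnegrE ?nm_ge0// -normrX ger0_norm ?sqr_ge0// nm_sq.
apply: (le_trans (AC_holder_sym pA g2 y01 x01)).
rewrite -[leRHS]mul1r ler_wpM2r ?ip_ge0//.
by rewrite ler_norml; case/andP: x01; case/andP: y01; linarith.
Qed.

Lemma state_bound p g x : state p g -> 0 <= x <= 1 -> `|p x - 1| <= nm g.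
Proof.
move=> S x01; have [z z01 <-] := state_one S; case: S => pA g2 _ _.
exact: AC_osc pA g2 x01 z01.
Qed.

(** [p + 1/p >= 2] makes the mean of [p] at least 1, and [mean_osc] keeps [p] within [nm g / sqrt 3]
    of its mean; 9/25 exceeds 1/3. This improves on the lower bound [1 - nm g] contained in
    [state_bound]. *)
Lemma state_lower p g x : state p g -> 0 <= x <= 1 -> 1 - 3 / 5 * nm g <= p x.
Proof.
move=> S x01; have [pA g2 p0 p1] := S; have i2 := state_inv_L2 S.
have m1 : 1 <= \int[mu]_(x in I01) p x.
  have : 2 <= \int[mu]_(x in I01) (p x + (p x)^-1).
    rewrite -[leLHS]Rint_cst01; apply: le_Rintegral => //.
    - exact/L2_itg/L2_cst.
    - by apply: L2_itg; apply: L2D => //; exact: AC01_L2 pA.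
    - move=> y /I01P /p0 py; rewrite -subr_ge0.
      have -> : p y + (p y)^-1 - 2 = (p y - 1) ^+ 2 / p y by field; rewrite gt_eqF.
      by rewrite divr_ge0 ?sqr_ge0// ltW.
  rewrite RintegralD ?p1//; first linarith.
    exact/L2_itg/(AC01_L2 pA).
  exact: L2_itg.
have := mean_osc pA g2 x01; rewrite -nm_sq; set I := Rintegral _ _ _ in m1 *.
move=> h; have n0 := nm_ge0 g.
have [lt|] := ltP (p x) (1 - 3 / 5 * nm g); last by [].
have : (3 / 5 * nm g) ^+ 2 < (p x - I) ^+ 2.
  rewrite -[ltRHS]sqrrN ltr_pXn2r ?nnegrE//; first linarith.
  - by rewrite mulr_ge0//; linarith.
  - linarith.
have := sqr_ge0 (nm g).
have -> : (3 / 5 * nm g) ^+ 2 = 9 / 25 * nm g ^+ 2 by field.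
linarith.
Qed.

End States.

(** * Coercivity of the dissipation for two states *)

Section StaticEnergy.
Context {R : realType}.
Notation mu := (@lebesgue_measure R).
Implicit Types (p g : R -> R).

Lemma state_min p g : state p g -> exists2 m : R, 0 < m &
  1 - 3 / 5 * nm g <= m /\ forall x, 0 <= x <= 1 -> m <= p x <= m + nm g.
Proof.
move=> S; have [pA g2 p0 _] := S.
have [z] := EVT_min ler01 (AC_cont ler01 pA); rewrite in_itv/= => z01 H.
exists (p z); first exact: p0.
split; first exact: state_lower S z01.
move=> x x01; apply/andP; split; first by apply: H; rewrite in_itv.
rewrite -lerBlDl; apply: le_trans (AC_osc pA g2 x01 z01).
exact: ler_norm.
Qed.

(** The scalar inequality behind [static_energy]: [1 - 3/5 r] is the lower bound of a state and 9
    stands for [pi ^+ 2]. The difference of the two sides is [r] times a quartic; bounding [r^3] and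
    [r^4] by [r^2] leaves a positive quadratic, whose minimum lies close to the point [24 / 25] at
    which the square is centred. *)
Lemma energy_polynomial (r : R) : 0 <= r <= 1 ->
  (1 - r) ^+ 2 * (1 - 3 / 5 * r + r) ^+ 2 <=
  (1 - 3 / 5 * r) ^+ 2 * (9 * ((1 - 3 / 5 * r) ^+ 2 - (1 - r) ^+ 2) +
    (1 - r) * (1 - 3 / 5 * r) ^+ 2 - r).
Proof.
move=> /andP[r0 r1]; rewrite -subr_ge0.
set D := (X in 0 <= X).
have -> : D = r * (4 - 41 / 5 * r + 141 / 25 * r ^+ 2 - 31 / 25 * r ^+ 3 -
    81 / 625 * r ^+ 4) by rewrite /D; field.
apply: mulr_ge0; first exact: r0.
have r2 : 0 <= r ^+ 2 by exact: sqr_ge0.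
have h3 : r ^+ 3 <= r ^+ 2 by rewrite exprSr ler_piMr.
have h4 : r ^+ 4 <= r ^+ 2.
  by apply: le_trans h3; rewrite (exprSr r 3) ler_piMr// exprn_ge0.
have : 0 <= (r - 24 / 25) ^+ 2 by exact: sqr_ge0.
rewrite sqrrB => h.
have -> : 41 / 5 * r = 427 / 100 * (r * (24 / 25) *+ 2) + 16 / 10000 * r.
  by rewrite mulr2n; field.
have e : (24 / 25) ^+ 2 = 576 / 625 :> R by field.
rewrite e in h; linarith.
Qed.

Section TwoStates.
Variables (p g pi_ gi : R -> R) (r : R).
Hypotheses (Sp : state p g) (Si : state pi_ gi) (r01 : 0 <= r < 1).
Hypotheses (gr : nm g <= r) (gir : nm gi <= r).

Let q x := p x - pi_ x.
Let q' x := g x - gi x.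

Let qA : AC 0 1 q q'.
Proof. by case: Sp => pA _ _ _; case: Si => iA _ _ _; exact: AC_B. Qed.

Let q'2 : L2 q'.
Proof. by case: Sp => _ p2 _ _; case: Si => _ i2 _ _; exact: L2B. Qed.

(** Chosen so that [w q = 1/pi_ - 1/p], which integrates to 0 because both masses are 1. *)
Let w x := (p x)^-1 * (pi_ x)^-1.

Let w2 : L2 w.
Proof.
have i1 := state_inv_L2 Sp; have i2 := state_inv_L2 Si.
have [w1 w10 [w3 W]] := state_w Sp.
apply: (L2_mulbd i2 i1.1 (M := w3)) => x Ix; have /andP[a b] := W x Ix.
by rewrite ger0_norm// (le_trans (ltW w10)).
Qed.

Let wq0 : \int[mu]_(x in I01) (w x * q x) = 0.
Proof.
have [_ _ p0 p1] := Sp; have [_ _ i0 i1] := Si.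
transitivity (\int[mu]_(x in I01) ((pi_ x)^-1 - (p x)^-1)).
  apply: Rint_ext => x /I01P x01; rewrite /w /q.
  by have := p0 x x01; have := i0 x x01 => a b; field; rewrite !gt_eqF.
by rewrite RintegralB ?p1 ?i1 ?subrr//;
  [exact: L2_itg (state_inv_L2 Si)|exact: L2_itg (state_inv_L2 Sp)].
Qed.

Lemma diff_zero : exists2 z, 0 <= z <= 1 & q z = 0.
Proof.
have [m1 m10 [_ H1]] := state_min Sp; have [m2 m20 [_ H2]] := state_min Si.
have M10 : 0 < m1 + nm g by rewrite ltr_wpDr// nm_ge0.
have M20 : 0 < m2 + nm gi by rewrite ltr_wpDr// nm_ge0.
have W : forall x, I01 x -> ((m1 + nm g) * (m2 + nm gi))^-1 <= w x <= (m1 * m2)^-1.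
  move=> y /I01P y01; have /andP[a b] := H1 y y01; have /andP[c d] := H2 y y01.
  have py := lt_le_trans m10 a; have iy := lt_le_trans m20 c.
  rewrite /w -invfM !lef_pV2 ?posrE ?mulr_gt0//.
  by apply/andP; split; apply: ler_pM => //; exact: ltW.
apply: (zero_of_weighted_mean qA w2.1 _ (ex_intro _ _ W) wq0).
by rewrite invr_gt0 mulr_gt0.
Qed.

Lemma diff_sup x : 0 <= x <= 1 -> `|q x| <= nm q'.
Proof.
move=> x01; have [z z01 qz] := diff_zero.
by rewrite -[q x]subr0 -qz; exact: AC_osc qA q'2 x01 z01.
Qed.

(** The weight lies between [1/((m1 + r)(m2 + r))] and [1/(m1 m2)], with [m1] and [m2] the minima of
    the two states. The quotients [(m1 + r)/m1] and [(m2 + r)/m2] that result are decreasing in the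
    minima, and each minimum is at least [1 - 3/5 r]. *)
Lemma diff_poincare : pi ^+ 2 * (1 - 3 / 5 * r) ^+ 2 * ip q q <=
  (1 - 3 / 5 * r + r) ^+ 2 * ip q' q'.
Proof.
set m := 1 - 3 / 5 * r; have [r0 r1] := andP r01; have gr' := gr; have gir' := gir.
have m0 : 0 < m by rewrite /m; lra.
have [m1 m10 [l1 H1]] := state_min Sp; have [m2 m20 [l2 H2]] := state_min Si.
have mm1 : m <= m1 by rewrite /m; lra.
have mm2 : m <= m2 by rewrite /m; lra.
have W : forall x, I01 x -> ((m1 + r) * (m2 + r))^-1 <= w x <= (m1 * m2)^-1.
  move=> y /I01P y01; have /andP[a b] := H1 y y01; have /andP[c d] := H2 y y01.
  have py := lt_le_trans m10 a; have iy := lt_le_trans m20 c.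
  rewrite /w -invfM !lef_pV2 ?posrE ?mulr_gt0//; [|lra|lra].
  by apply/andP; split; apply: ler_pM; lra.
have i0 : 0 <= ((m1 + r) * (m2 + r))^-1 by rewrite invr_ge0 mulr_ge0//; lra.
have := weighted_poincare qA q'2 w2.1 i0 W wq0.
have P0 := ip_ge0 q; have X0 := ip_ge0 q'.
have pp : 0 <= pi ^+ 2 :> R by exact: sqr_ge0.
move=> H.
have {}H : m1 * m2 * (pi ^+ 2 * ip q q) <= (m1 + r) * (m2 + r) * ip q' q'.
  rewrite mulrCA in H; rewrite ler_pdivrMl in H; last by rewrite mulr_gt0//; lra.
  by rewrite mulrCA ler_pdivlMl ?mulr_gt0// in H.
have k1 : m * (m1 + r) <= m1 * (m + r) by nra.
have k2 : m * (m2 + r) <= m2 * (m + r) by nra.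
have k : (m * (m1 + r)) * (m * (m2 + r)) <= (m1 * (m + r)) * (m2 * (m + r)).
  by apply: ler_pM => //; apply: mulr_ge0; lra.
have m12 : 0 < m1 * m2 by exact: mulr_gt0.
rewrite -(ler_pM2l m12).
apply: (@le_trans _ _ (m ^+ 2 * ((m1 + r) * (m2 + r) * ip q' q'))).
  have -> : m1 * m2 * (pi ^+ 2 * m ^+ 2 * ip q q) =
    m ^+ 2 * (m1 * m2 * (pi ^+ 2 * ip q q)) by ring.
  by rewrite ler_wpM2l ?sqr_ge0.
rewrite mulrA [leRHS]mulrA ler_wpM2r//.
have -> : m ^+ 2 * ((m1 + r) * (m2 + r)) = m * (m1 + r) * (m * (m2 + r)) by ring.
have -> // : m1 * m2 * (m + r) ^+ 2 = m1 * (m + r) * (m2 * (m + r)) by ring.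
Qed.

(** The derivative of [q p^2]. As [p_t = - p^2 u_t], half the time derivative of [|q|^2] is minus
    the integral of [q p^2 u_t], which by parts is the pairing of [B] with the velocity of the
    primitive of [u]. *)
Let B x := q x * (p x * g x + p x * g x) + p x * p x * q' x.

Lemma qpp_AC : AC 0 1 (fun x => q x * (p x * p x)) B.
Proof. by case: Sp => pA _ _ _; have := AC_mul ler01 qA (AC_mul ler01 pA pA). Qed.

Let mulp_L2 (f F k : R -> R) : AC 0 1 F k -> L2 f -> L2 (fun x => F x * f x).
Proof.
move=> FA f2; have [M MF] := AC_bd ler01 FA.
by apply: (L2_mulbd f2 (AC01_meas FA)) => x /I01P; exact: MF.
Qed.

Lemma qpp_L2 : L2 B.
Proof.
have [pA g2 _ _] := Sp; have pp := AC_mul ler01 pA pA.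
apply: L2D; last exact: (mulp_L2 pp q'2).
by apply: (mulp_L2 qA); apply: L2D; exact: (mulp_L2 pA).
Qed.

(* Young's inequality with parameter [r] turns the cross term into part of
   the two diagonal ones, uniformly up to [r = 1]. *)
Lemma static_energy : pi ^+ 2 * (1 - r) ^+ 2 * (ip q' q' + ip q q) <=
  (1 - 3 / 5 * r) ^+ 2 * pi ^+ 2 * ip q' q' + ip B q'.
Proof.
have [r0 r1] := andP r01; have [pA g2 p0 _] := Sp; have gr' := gr.
set m := 1 - 3 / 5 * r.
have pq2 : L2 (fun x => p x * q' x) by exact: (mulp_L2 pA).
have qg2 : L2 (fun x => q x * g x) by exact: (mulp_L2 qA).
set X := ip q' q'; set Y := ip (fun x => p x * q' x) (fun x => p x * q' x).
have X0 : 0 <= X := ip_ge0 _; have Y0 : 0 <= Y := ip_ge0 _.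
have BE : ip B q' = Y + 2 * ip (fun x => q x * g x) (fun x => p x * q' x).
  rewrite -ipZl// /Y /ip -RintegralD//; last 2 first.
  - exact: L2_itgM.
  - by apply: L2_itgM => //; exact: L2Z.
  by apply: Rint_ext => x _; rewrite /B; ring.
have YX : m ^+ 2 * X <= Y.
  rewrite -ipZZ//; apply: ip_le_ip => //; try exact: L2Z.
  move=> x x01; have := state_lower Sp x01 => h.
  have mp : m <= p x by rewrite /m; lra.
  have m0 : 0 < m by rewrite /m; lra.
  have -> : m * q' x * (m * q' x) = (m * m) * (q' x * q' x) by ring.
  have -> : p x * q' x * (p x * q' x) = (p x * p x) * (q' x * q' x) by ring.
  by apply: ler_wpM2r; [rewrite -expr2 sqr_ge0|apply: ler_pM => //; exact: ltW].
(* [|q|] is at most [nm q'] everywhere and [nm g <= r], so the cross term is at most [2 r sqrt(X Y)]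
   in absolute value, hence at most [r X + r Y]. *)
have cross : - (r * X + r * Y) <= 2 * ip (fun x => q x * g x) (fun x => p x * q' x).
  have := ip_nm qg2 pq2; rewrite ler_norml => /andP[h _].
  have ng : nm (fun x => q x * g x) <= r * nm q'.
    rewrite nm_le ?mulr_ge0 ?nm_ge0// exprMn nm_sq.
    apply: (@le_trans _ _ (nm q' ^+ 2 * ip g g)).
      rewrite -ipZZ//; apply: ip_le_ip => //; try exact: L2Z.
      move=> x x01; have := diff_sup x01; rewrite -(@ler_pXn2r _ 2) ?nnegrE ?nm_ge0//.
      rewrite -normrX ger0_norm ?sqr_ge0// => hq.
      have -> : q x * g x * (q x * g x) = q x ^+ 2 * (g x * g x) by ring.
      have -> : nm q' * g x * (nm q' * g x) = nm q' ^+ 2 * (g x * g x) by ring.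
      by apply: ler_wpM2r => //; rewrite -expr2 sqr_ge0.
    rewrite mulrC nm_sq; apply: ler_wpM2r => //.
    by rewrite -nm_sq ler_pXn2r ?nnegrE ?nm_ge0.
  have nY := nm_ge0 (fun x => p x * q' x); have nX := nm_ge0 q'.
  have eY := nm_sq (fun x => p x * q' x); have eX := nm_sq q'.
  have h1 : nm (fun x => q x * g x) * nm (fun x => p x * q' x) <=
    r * nm q' * nm (fun x => p x * q' x) by exact: ler_wpM2r.
  have h2 := sqr_ge0 (nm q' - nm (fun x => p x * q' x)).
  rewrite sqrrB eX eY -/X -/Y mulr2n in h2.
  have h3 : 0 <= r * (X - (nm q' * nm (fun x => p x * q' x) +
     nm q' * nm (fun x => p x * q' x)) + Y) by apply: mulr_ge0.
  lra.
have P := diff_poincare; rewrite -/m -/X in P; set Ph := ip q q in P *.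
have Ph0 : 0 <= Ph := ip_ge0 _.
have pol := @energy_polynomial r (ltac:(apply/andP; split; lra)); rewrite -/m in pol.
have L9 : 9 <= pi ^+ 2 :> R.
  have h := @pi_ge3 R; have -> : 9 = 3 ^+ 2 :> R by field.
  by rewrite ler_pXn2r ?nnegrE//; lra.
rewrite BE; move: P L9; set La := pi ^+ 2 => P L9.
have m0 : 0 < m by rewrite /m; lra.
have mm0 : 0 < m ^+ 2 by exact: exprn_gt0.
have d0 : 0 <= m ^+ 2 - (1 - r) ^+ 2.
  have -> : m ^+ 2 - (1 - r) ^+ 2 = (m - (1 - r)) * (m + (1 - r)) by ring.
  by apply: mulr_ge0; rewrite /m; lra.
(* After the cross term a share [(1 - r) Y] is left, which is at least [(1 - r) m^2 X]. What remains
   bounds [|q|^2] by a multiple of [|q'|^2]; multiplied by [m^2] it follows from [diff_poincare] and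
   the polynomial inequality. *)
suff : La * (1 - r) ^+ 2 * Ph <=
   (La * (m ^+ 2 - (1 - r) ^+ 2) + (1 - r) * m ^+ 2 - r) * X.
  have YX' : (1 - r) * (m ^+ 2 * X) <= (1 - r) * Y by apply: ler_wpM2l => //; lra.
  lra.
rewrite -(ler_pM2l mm0).
apply: (@le_trans _ _ ((1 - r) ^+ 2 * ((m + r) ^+ 2 * X))).
  have -> : m ^+ 2 * (La * (1 - r) ^+ 2 * Ph) = (1 - r) ^+ 2 * (La * m ^+ 2 * Ph) by ring.
  by apply: ler_wpM2l => //; exact: sqr_ge0.
rewrite mulrA [leRHS]mulrA; apply: ler_wpM2r => //.
apply: (le_trans pol); apply: ler_wpM2l; first exact: ltW.
have : 9 * (m ^+ 2 - (1 - r) ^+ 2) <= La * (m ^+ 2 - (1 - r) ^+ 2) by exact: ler_wpM2r.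
lra.
Qed.

End TwoStates.

End StaticEnergy.

(** * The slope bound along the flow *)

Section CurveExtension.
Context {R : realType}.
Notation mu := (@lebesgue_measure R).
Implicit Types (U G : R -> R -> R) (A B : set R).

Lemma curve_restrict T A B U G : curve T A U G -> B `<=` A ->
  {ae mu, forall t, 0 < t < T -> B t} -> curve T B U G.
Proof.
move=> [U2 Aae N W] BA Bae; split=> //.
- by move=> t /BA; exact: U2.
- by apply: ae_imply2 Aae Bae _ => t H1 H2 /[dup] /H1[_ ?] /H2.
move=> psi psi2; have [g [gi ge E]] := W psi psi2; exists g; split=> // s t Bs Bt.
by apply: E; exact: BA.
Qed.

Lemma nm_sup f (M : R) : L2 f -> (forall x, 0 <= x <= 1 -> `|f x| <= M) -> nm f <= M.
Proof.
move=> f2 fM; have M0 : 0 <= M by apply: le_trans (fM 0 _) => //; rewrite lexx ler01.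
by rewrite nm_le//; apply: ip_bd_le f2.1 _ => x /I01P; exact: fM.
Qed.

(** The identity is known between times of [A] close to [s] and [t]. Passing to [s] and [t] changes
    the left side little by the approximation hypothesis, and the right side little because it is an
    integral in time. *)
Lemma curve_extend (T : R) A U U' G : curve T A U G ->
  (forall t : R, 0 <= t <= T -> L2 (U' t)) ->
  (forall t : R, 0 <= t <= T -> forall e : R, 0 < e -> exists2 d : R, 0 < d &
    forall s, A s -> 0 <= s <= T -> `|s - t| <= d -> nm (fun x => U' t x - U s x) <= e) ->
  curve T [set t | 0 <= t <= T] U' G.
Proof.
move=> C U'2 near; have [U2 Aae N W] := C; split=> //.
  by apply: ae_imply Aae _ => t H /[dup] /H[_ ?] /andP[t0 tT]; split=> //=; rewrite !ltW.
move=> psi psi2; have [g [gi ge E]] := W psi psi2; exists g; split=> // s t s01 t01 s0 st tT.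
have [<-|snt] := eqVneq s t.
  rewrite set_itv1 Rintegral_set1 /ip -[RHS](Rint0 mu I01).
  by apply: Rint_ext => x _; rewrite subrr mul0r.
have {}st : s < t by rewrite lt_neqAle snt.
have KA := AC_int 0 gi; set K := (fun x => 0 + _) in KA.
have s0T : 0 <= s <= T by [].
have t0T : 0 <= t <= T by [].
apply/eqP; rewrite -subr_eq0 -normr_le0; apply/ler_addgt0Pr => e e0; rewrite add0r.
pose e1 := e / (4 * (nm psi + 1)).
have n0 := nm_ge0 psi.
have e10 : 0 < e1 by rewrite divr_gt0// mulr_gt0//; linarith.
have e40 : 0 < e / 4 by linarith.
have [d1 d10 H1] := near s s0T e1 e10.
have [d2 d20 H2] := near t t0T e1 e10.
have [d3 d30 H3] := AC_uc_sym KA e40.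
pose d := Num.min (Num.min d1 d2) (Num.min d3 ((t - s) / 2)).
have d0 : 0 < d by rewrite !lt_min d10 d20 d30/= divr_gt0// subr_gt0.
have [dd1 dd2 dd3 dd4] : [/\ d <= d1, d <= d2, d <= d3 & d <= (t - s) / 2].
  by rewrite /d !ge_min !lexx/= !orbT.
have ssd : s < s + d by linarith.
have sdT : s + d <= T by linarith.
have [s' As' /andP[s1 s2]] := curve_dense C s0 ssd sdT.
have td0 : 0 <= t - d by linarith.
have tdt : t - d < t by linarith.
have [t' At' /andP[t1 t2]] := curve_dense C td0 tdt tT.
have [s'0 t'T s't'] : [/\ 0 <= s', t' <= T & s' <= t'].
  by clear -s0 tT s1 s2 t1 t2 dd4; split; lra.
have E' := E s' t' As' At' s'0 s't' t'T.
have s'0T : 0 <= s' <= T by rewrite s'0 (le_trans s't').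
have t'0T : 0 <= t' <= T by rewrite (le_trans s'0 s't').
have ss' : `|s' - s| <= d by rewrite ler_norml; clear -s1 s2; apply/andP; split; lra.
have tt' : `|t' - t| <= d by rewrite ler_norml; clear -t1 t2; apply/andP; split; lra.
have b1 := H1 s' As' s'0T (le_trans ss' dd1).
have b2 := H2 t' At' t'0T (le_trans tt' dd2).
have c1 := H3 s s' s0T s'0T (le_trans ss' dd3).
have tt'' : `|t - t'| <= d by rewrite distrC.
have c2 := H3 t' t t'0T t0T (le_trans tt'' dd3).
have L1 := U2 _ As'; have L2' := U2 _ At'; have L3 := U'2 _ s01; have L4 := U'2 _ t01.
have -> : ip (fun x => U' t x - U' s x) psi = ip (fun x => U' t x - U t' x) psi +
    ip (fun x => U t' x - U s' x) psi - ip (fun x => U' s x - U s' x) psi.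
  by rewrite !ipBl//; ring.
rewrite E' -(AC_sub KA s'0 s't' t'T) -(AC_sub KA s0 (ltW st) tT).
have p1 := ip_nm (L2B L4 L2') psi2; have p2 := ip_nm (L2B L3 L1) psi2.
have f1 : e1 * nm psi <= e / 4.
  have -> : e / 4 = e1 * (nm psi + 1) by rewrite /e1; field; clear -n0; lra.
  by apply: ler_wpM2l; [exact: ltW|rewrite lerDl].
have q1 : nm (fun x => U' t x - U t' x) * nm psi <= e / 4.
  by apply: le_trans f1; exact: ler_wpM2r.
have q2 : nm (fun x => U' s x - U s' x) * nm psi <= e / 4.
  by apply: le_trans f1; exact: ler_wpM2r.
move: p1 p2 c1 c2; rewrite !ler_norml => /andP[p1 p1'] /andP[p2 p2'] /andP[c1 c1'] /andP[c2 c2'].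
by clear -q1 q2 p1 p1' p2 p2' c1 c1' c2 c2'; apply/andP; split; lra.
Qed.

(** Each time is approached by a sequence of [A] chosen once and for all; uniform continuity on [A]
    makes the values along it Cauchy. *)
Lemma uniform_extension (T : R) A (p : R -> R -> R) :
  (forall t : R, 0 <= t <= T -> forall d : R, 0 < d ->
    exists2 s, A s /\ 0 <= s <= T & `|s - t| <= d) ->
  (forall e : R, 0 < e -> exists2 d : R, 0 < d & forall s t : R, A s -> A t ->
    0 <= s <= T -> 0 <= t <= T -> `|s - t| <= d ->
    forall x : R, 0 <= x <= 1 -> `|p t x - p s x| <= e) ->
  exists P : R -> R -> R, forall e : R, 0 < e -> exists2 d : R, 0 < d &
    forall s t : R, A s -> 0 <= s <= T -> 0 <= t <= T -> `|s - t| <= d ->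
    forall x : R, 0 <= x <= 1 -> `|P t x - p s x| <= e.
Proof.
move=> dense unif.
have /choice[tau Htau] (t : R) : exists tau : nat -> R, 0 <= t <= T ->
    forall n, [/\ A (tau n), 0 <= tau n <= T & `|tau n - t| <= n.+1%:R^-1].
  have [t0T|nt] := boolP (0 <= t <= T); last by exists (fun=> 0).
  have /choice[u Hu] (n : nat) : exists s, [/\ A s, 0 <= s <= T & `|s - t| <= n.+1%:R^-1].
    have [s [As s0T] st] := dense t t0T n.+1%:R^-1 (ltac:(rewrite invr_gt0 ltr0n//)).
    by exists s.
  by exists u.
exists (fun t x => lim (p (tau t n) x @[n --> \oo])) => e e0.
have [d d0 Hd] := unif e e0.
exists (d / 2); first linarith.
move=> s t As s0T t0T st x x01.
have small (r : R) : 0 < r -> \forall n \near \oo, n.+1%:R^-1 <= r :> R.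
  move=> r0; near=> n.
  have h : r^-1 <= n.+1%:R.
    apply: ltW; apply: (lt_le_trans (truncnS_gt _)).
    by rewrite ler_nat ltnS; near: n; exact: nbhs_infty_ge.
  by rewrite -[leRHS]invrK lef_pV2 ?posrE ?invr_gt0.
have Ht := Htau t t0T.
have cv : cvgn (fun n => p (tau t n) x).
  apply/cauchy_cvgP/cauchy_exP => r r0.
  have [d' d'0 Hd'] := unif (r / 2) (ltac:(linarith)).
  have [N _ HN] := small (d' / 2) (ltac:(linarith)).
  exists (p (tau t N) x); exists N => // k /= Nk; rewrite /ball/=.
  have [Am m0T mt] := Ht N; have [Ak k0T kt] := Ht k.
  apply: (@le_lt_trans _ _ (r / 2)); last linarith.
  apply: Hd' => //.
  have := HN N (leqnn N); have := HN k Nk => h1 h2.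
  have -> : tau t k - tau t N = (tau t k - t) - (tau t N - t) by ring.
  rewrite [leRHS]splitr; apply: (le_trans (ler_normB _ _)).
  by apply: lerD; [apply: le_trans kt h1|apply: le_trans mt h2].
apply/ler_addgt0Pr => r r0.
have /cvgrPdist_le/(_ r r0) cvr := cv.
have sd := small (d / 2) (ltac:(linarith)).
near \oo => n.
have [An n0T nt] := Ht n.
have h1 : `|lim (p (tau t n) x @[n --> \oo]) - p (tau t n) x| <= r by near: n.
have h2 : n.+1%:R^-1 <= d / 2 by near: n.
have h3 : `|p (tau t n) x - p s x| <= e.
  apply: Hd => //; have -> : s - tau t n = (s - t) - (tau t n - t) by ring.
  rewrite [leRHS]splitr; apply: (le_trans (ler_normB _ _)).
  by apply: lerD => //; apply: le_trans nt h2.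
have -> : lim (p (tau t n) x @[n --> \oo]) - p s x =
  (p (tau t n) x - p s x) + (lim (p (tau t n) x @[n --> \oo]) - p (tau t n) x) by ring.
by apply: (le_trans (ler_normD _ _)); exact: lerD.
Unshelve. all: by end_near. Qed.

End CurveExtension.

(** * Uniform distance of states from the distance of their volumes *)

Section StateClose.
Context {R : realType}.
Notation mu := (@lebesgue_measure R).
Implicit Types (p g F f : R -> R).

(** [F^2] has density [2 F f], so its increment from the zero [z] is controlled by
    Cauchy-Schwarz. *)
Lemma sq_le_of_zero F f (z x : R) : AC 0 1 F f -> L2 f -> 0 <= z <= 1 -> F z = 0 ->
  0 <= x <= 1 -> F x ^+ 2 <= 2 * nm F * nm f.
Proof.
move=> FA f2 z01 Fz x01; have F2 := AC01_L2 FA.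
have FFA := AC_mul ler01 FA FA; set k := (fun x => F x * f x + F x * f x) in FFA.
have kA := FFA.1.
have K : \int[mu]_(s in `[0, 1]) `|k s| <= 2 * nm F * nm f.
  have -> : \int[mu]_(s in `[0, 1]) `|k s| = \int[mu]_(s in I01) (2 * (`|F s| * `|f s|)).
    rewrite Rint01; last by apply: itgZ => //; exact: L2_itgM (L2_norm F2) (L2_norm f2).
    by apply: Rint_ext => s _; rewrite -normrM -[2]ger0_norm// -normrM; congr `|_|; rewrite /k; ring.
  rewrite RintegralZl//; last by apply: L2_itgM; exact: L2_norm.
  rewrite -mulrA ler_wpM2l//; apply: (le_trans (ip_le_nm (L2_norm F2) (L2_norm f2))).
  have E h : nm (fun x => `|h x|) = nm h :> R.
    by congr Num.sqrt; apply: Rint_ext => s _; rewrite -normrM ger0_norm// -expr2 sqr_ge0.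
  by rewrite !E.
have sub (a b : R) : 0 <= a -> a <= b -> b <= 1 ->
    `|F b * F b - F a * F a| <= 2 * nm F * nm f.
  move=> a0 ab b1; apply: le_trans K; rewrite (AC_sub FFA)//.
  apply: (le_trans (le_normr_Rintegral _ (itg_cc a0 b1 kA))) => //.
  have kN : itg mu `[0, 1] (fun s => `|k s|) by apply: itg_norm.
  have KA := AC_int 0 kN; set K := (fun x => 0 + _) in KA.
  rewrite -(AC_sub KA a0 ab b1).
  have -> : \int[mu]_(s in `[0, 1]) `|k s| = K 1 - K 0.
    by rewrite (AC_sub KA)//; exact: ler01.
  have k1 : 0 <= K 1 - K b.
    rewrite (AC_sub KA)//; last exact: le_trans ab.
    by apply: Rintegral_ge0.
  have k2 : 0 <= K a - K 0.
    rewrite (AC_sub KA)//; last exact: le_trans b1.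
    by apply: Rintegral_ge0.
  linarith.
have [z0 z1] := andP z01; have [x0 x1] := andP x01.
have Fzz : F z * F z = 0 by rewrite Fz mul0r.
have [zx|xz] := leP z x.
  by have := sub z x z0 zx x1; rewrite Fzz subr0 -expr2 ; apply: le_trans; exact: ler_norm.
have := sub x z x0 (ltW xz) z1; rewrite Fzz sub0r normrN -expr2.
by apply: le_trans; exact: ler_norm.
Qed.

(** [- (p1 - p2)(1/p1 - 1/p2)] equals [(p1 - p2)^2 / (p1 p2)], and slopes of norm at most 1 keep
    both states below 2, whence the factor 4. *)
Lemma sq_diff_le p1 g1 p2 g2 : state p1 g1 -> state p2 g2 -> nm g1 <= 1 -> nm g2 <= 1 ->
  ip (fun x => p1 x - p2 x) (fun x => p1 x - p2 x) <=
    4 * ip (fun x => g1 x - g2 x) (fun x => vol p1 x - vol p2 x).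
Proof.
move=> S1 S2 n1 n2; have [A1 G1 P1 _] := S1; have [A2 G2 P2 _] := S2.
have dA := AC_B A1 A2; have d2 := AC01_L2 dA.
have i2 := L2B (state_inv_L2 S1) (state_inv_L2 S2).
rewrite (state_parts S1 S2) mulrN -mulNr -ipZl//.
apply: (ip_le_ip d2 d2 (L2Z _ d2) i2) => y y01.
have b1 := state_bound S1 y01; have b2 := state_bound S2 y01.
have q1 := P1 y y01; have q2 := P2 y y01.
move: b1 b2; rewrite !ler_norml => /andP[_ b1] /andP[_ b2].
have -> : -4 * (p1 y - p2 y) * ((p1 y)^-1 - (p2 y)^-1) =
   (p1 y - p2 y) ^+ 2 * (4 / (p1 y * p2 y)) by field; rewrite !gt_eqF.
rewrite -expr2 -[leLHS]mulr1 ler_wpM2l ?sqr_ge0//.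
rewrite ler_pdivlMr ?mulr_gt0// mul1r; nra.
Qed.

(** Interpolation: with slopes at distance at most 2, closeness of the volumes controls [p1 - p2] in
    L^2 by [sq_diff_le], then uniformly by [sq_le_of_zero], the difference having a zero. Each
    passage costs a square root, whence [e ^+ 4]; the 128 makes the L^2 distance at most
    [e ^+ 2 / 4]. *)
Lemma state_close (e : R) : 0 < e -> exists2 d : R, 0 < d &
  forall p1 g1 p2 g2, state p1 g1 -> state p2 g2 -> nm g1 <= 1 -> nm g2 <= 1 ->
  nm (fun x => vol p1 x - vol p2 x) <= d ->
  forall x, 0 <= x <= 1 -> `|p1 x - p2 x| <= e.
Proof.
move=> e0; exists (e ^+ 4 / 128); first by rewrite divr_gt0// exprn_gt0.
move=> p1 g1 p2 g2 S1 S2 n1 n2 Wd x x01.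
have [A1 G1 P1 _] := S1; have [A2 G2 P2 _] := S2.
have dA := AC_B A1 A2; have d2 := AC01_L2 dA; have gg := L2B G1 G2.
have [z z01 dz] := diff_zero S1 S2.
have H := sq_le_of_zero dA gg z01 dz x01.
have WA := AC_B (vol_AC S1) (vol_AC S2); have W2 := AC01_L2 WA.
have ng : nm (fun x => g1 x - g2 x) <= 2 by have := nmB G1 G2; linarith.
have le1 := sq_diff_le S1 S2 n1 n2.
have nW0 := nm_ge0 (fun x => vol p1 x - vol p2 x).
have ng0 := nm_ge0 (fun x => g1 x - g2 x).
have nd0 := nm_ge0 (fun x => p1 x - p2 x).
have le2 := ip_le_nm gg W2.
have le3 : nm (fun x => g1 x - g2 x) * nm (fun x => vol p1 x - vol p2 x) <=
   2 * (e ^+ 4 / 128) by apply: ler_pM.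
have le4 : nm (fun x => p1 x - p2 x) <= e ^+ 2 / 4.
  rewrite nm_le; last by rewrite divr_ge0// sqr_ge0.
  have -> : (e ^+ 2 / 4) ^+ 2 = 4 * (2 * (e ^+ 4 / 128)) by field.
  linarith.
have le5 : 2 * nm (fun x => p1 x - p2 x) * nm (fun x => g1 x - g2 x) <= e ^+ 2.
  have : nm (fun x => p1 x - p2 x) * nm (fun x => g1 x - g2 x) <= e ^+ 2 / 4 * 2.
    by apply: ler_pM.
  linarith.
by rewrite -(@ler_pXn2r _ 2) ?nnegrE ?(ltW e0)// -normrX ger0_norm ?sqr_ge0//; linarith.
Qed.

End StateClose.

(** * Extension of the flow to all times *)

Section StageOne.
Context {R : realType}.
Notation mu := (@lebesgue_measure R).

Lemma curve_ext T A (U G G' : R -> R -> R) : curve T A U G ->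
  {ae mu, forall t, 0 < t < T -> G t = G' t} -> curve T A U G'.
Proof.
move=> [U2 Aae [n [ni Gn]] W] GG; split=> //.
- by apply: ae_imply2 Aae GG _ => t H1 H2 t0; rewrite -H2//; exact: H1.
- by exists n; split=> //; apply: ae_imply2 Gn GG _ => t H1 H2 t0; rewrite -H2//; exact: H1.
move=> psi psi2; have [gm [gi ge E]] := W psi psi2; exists gm; split=> //.
by apply: ae_imply2 ge GG _ => t H1 H2 t0; rewrite -H2//; exact: H1.
Qed.

(** The slope of the limit comes from [weak_lsc] applied to [nu * (gi - g n)] and not to [g n], so
    that the velocity bound [c] is kept without loss. The common lower bound 2/5, from [r <= 1],
    lets positivity and mass pass to the limit. *)
Lemma state_limit (q : R -> R) (p g : nat -> R -> R) (gi : R -> R) (nu c r : R) :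
  0 < nu -> r <= 1 -> L2 gi ->
  (forall n, state (p n) (g n)) -> (forall n, nm (g n) <= r) ->
  (forall n, nm (fun x => nu * (gi x - g n x)) <= c) ->
  (forall n (x : R), 0 <= x <= 1 -> `|q x - p n x| <= n.+1%:R^-1) ->
  exists2 k, state q k & nm (fun x => nu * (gi x - k x)) <= c.
Proof.
move=> nu0 r1 gi2 S gr Gc qp.
have small (e : R) : 0 < e -> exists n : nat, n.+1%:R^-1 <= e.
  move=> e0; exists (Num.truncn e^-1); rewrite -[leRHS]invrK lef_pV2 ?posrE ?invr_gt0// ltW//.
  exact: truncnS_gt.
have qn x : 0 <= x <= 1 -> p n x @[n --> \oo] --> q x.
  move=> x01; apply/cvgrPdist_le => e e0; have [N HN] := small e e0.
  near=> n; apply: (le_trans (qp n x x01)); apply: le_trans HN.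
  rewrite lef_pV2 ?posrE ?ltr0n// ler_nat ltnS; near: n; exact: nbhs_infty_ge.
have c0 : 0 <= c by apply: le_trans (Gc 0%N); exact: nm_ge0.
have [e [e01 ed]] := @rat01_dense R.
pose k n x := nu * (gi x - g n x).
have g2 n : L2 (g n) by case: (S n).
have k2 n : L2 (k n) by apply: L2Z; exact: L2B.
have kK n : ip (k n) (k n) <= c ^+ 2 by rewrite -nm_le//; exact: Gc.
pose f x := nu * (primitive gi x - (q x - q 0)).
have z01 : 0 <= (0 : R) <= 1 by rewrite lexx ler01.
have kf i : primitive (k n) (e i) @[n --> \oo] --> f (e i).
  have -> : (fun n => primitive (k n) (e i)) =
      (fun n => nu * (primitive gi (e i) - (p n (e i) - p n 0))).
    apply/funext => n; rewrite primitiveZ ?primitiveB//; last exact: L2B.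
    by case: (S n) => pA _ _ _; rewrite (AC_primE pA (e01 i)); congr (_ * (_ - _)); ring.
  apply: cvgMr; apply: cvgB; first exact: cvg_cst.
  by apply: cvgB; exact: qn.
have [h [h2 hK hE]] := weak_lsc e01 k2 kK kf.
pose ga x := gi x - nu^-1 * h x.
have ga2 : L2 ga by apply: L2B => //; exact: L2Z.
have gaE i : q (e i) = q 0 + primitive ga (e i).
  rewrite primitiveB//; last exact: L2Z.
  rewrite primitiveZ// hE /f; field; by rewrite gt_eqF.
have gaA := AC_prim0 (L2_itg ga2).
have qA x : 0 <= x <= 1 -> q x = q 0 + primitive ga x.
  move=> x01; apply/eqP; rewrite -subr_eq0 -normr_le0; apply/ler_addgt0Pr => d d0.
  rewrite add0r; have d40 : 0 < d / 4 by linarith.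
  have [N HN] := small _ d40.
  have [pA _ _ _] := S N.
  have [d1 d10 H1] := AC_uc_sym pA d40; have [d2 d20 H2] := AC_uc_sym gaA d40.
  have d12 : 0 < Num.min d1 d2 by rewrite lt_min d10.
  have [i] := ed x x01 _ d12; rewrite lt_min => /andP[i1 i2].
  have b1 := H1 x (e i) x01 (e01 i) (ltW i1); have b2 := H2 x (e i) x01 (e01 i) (ltW i2).
  have b3 := le_trans (qp N x x01) HN; have b4 := le_trans (qp N (e i) (e01 i)) HN.
  have -> : q x - (q 0 + primitive ga x) = (q x - p N x) - (p N (e i) - p N x) -
      (q (e i) - p N (e i)) + (primitive ga (e i) - primitive ga x) by rewrite (gaE i); ring.
  move: b1 b2 b3 b4; rewrite !ler_norml => /andP[? ?] /andP[? ?] /andP[? ?] /andP[? ?].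
  apply/andP; split; linarith.
have AQ : AC 0 1 q ga by split=> //; exact: gaA.1.
have pl n x : 0 <= x <= 1 -> 2 / 5 <= p n x.
  by move=> x01; apply: le_trans (state_lower (S n) x01); have := gr n; linarith.
have ql x : 0 <= x <= 1 -> 2 / 5 <= q x.
  move=> x01; apply/ler_addgt0Pr => d d0; have [N HN] := small d d0.
  have := le_trans (qp N x x01) HN; rewrite ler_norml => /andP[h1 _].
  by have := pl N x x01; linarith.
have q0 x : 0 <= x <= 1 -> 0 < q x by move=> /ql; apply: lt_le_trans; linarith.
exists ga; last first.
  rewrite (_ : nm _ = nm h) ?nm_le//; apply: nm_ext => x _; rewrite /ga; field.
  by rewrite gt_eqF.
split=> //; have iq2 := AC_inv_L2 AQ q0.
apply/eqP; rewrite -subr_eq0 -normr_le0; apply/ler_addgt0Pr => d d0.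
(* Both functions are at least 2/5, so the reciprocals differ by at most 25/4 times the distance,
   and 1/7 is below 4/25. *)
rewrite add0r; have [N HN] := small (d / 7) (ltac:(linarith)).
have [pA _ p0 <-] := S N; have ip2 := state_inv_L2 (S N).
rewrite -RintegralB//; [|exact: L2_itg..].
rewrite -[leRHS]Rint_cst01; apply: le_normr_Rint => //.
- by apply/L2_itg/L2B.
- by apply: itg_cst => //; exact: mu_I01_fin.
apply: aeW => x /I01P x01.
have a1 := ql x x01; have a2 := pl N x x01; have qx := q0 x x01; have px := p0 x x01.
have -> : (q x)^-1 - (p N x)^-1 = (p N x - q x) / (q x * p N x) by field; rewrite !gt_eqF.
rewrite normrM normfV distrC (ger0_norm (mulr_ge0 (ltW qx) (ltW px))).
rewrite ler_pdivrMr ?mulr_gt0//; apply: (le_trans (qp N x x01)); apply: (le_trans HN).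
have : d * (4 / 25) <= d * (q x * p N x) by rewrite ler_pM2l//; nra.
linarith.
Unshelve. all: by end_near. Qed.

(** Above 2/5 the reciprocal is Lipschitz with constant 25/4, and 7 exceeds it. *)
Lemma vol_close (e : R) p1 g1 p2 g2 : state p1 g1 -> state p2 g2 -> nm g1 <= 1 -> nm g2 <= 1 ->
  (forall x, 0 <= x <= 1 -> `|p1 x - p2 x| <= e) ->
  nm (fun x => vol p1 x - vol p2 x) <= 7 * e.
Proof.
move=> S1 S2 n1 n2 pe; have i1 := state_inv_L2 S1; have i2 := state_inv_L2 S2.
apply: nm_sup (L2B (vol_L2 S1) (vol_L2 S2)) _ => x x01.
apply: (le_trans (prim_nm i1 i2 x01)); apply: nm_sup (L2B i1 i2) _ => y y01.
have a1 := state_lower S1 y01; have a2 := state_lower S2 y01.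
have b1 : 2 / 5 <= p1 y by linarith.
have b2 : 2 / 5 <= p2 y by linarith.
have q1 : 0 < p1 y by linarith.
have q2 : 0 < p2 y by linarith.
have -> : (p1 y)^-1 - (p2 y)^-1 = (p2 y - p1 y) / (p1 y * p2 y) by field; rewrite !gt_eqF.
rewrite normrM normfV distrC (ger0_norm (mulr_ge0 (ltW q1) (ltW q2))).
rewrite ler_pdivrMr ?mulr_gt0//; apply: (le_trans (pe y y01)).
have e0 : 0 <= e by apply: le_trans (pe y y01).
have : e * (4 / 25) <= e * (p1 y * p2 y) by apply: ler_wpM2l => //; nra.
linarith.
Qed.

Lemma slope_bound (nu : R) gi g (c : R) : 0 < nu -> L2 gi -> L2 g ->
  nm (fun x => nu * (gi x - g x)) <= c -> nm g <= c / nu + nm gi.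
Proof.
move=> nu0 gi2 g2 Gc; have G2 : L2 (fun x => nu * (gi x - g x)) by apply: L2Z; exact: L2B.
have -> : nm g = nm (fun x => gi x - nu^-1 * (nu * (gi x - g x))).
  by apply: nm_ext => x _; field; rewrite gt_eqF.
apply: (le_trans (nmB gi2 (L2Z _ G2))); rewrite addrC lerD2r nmZ//.
by rewrite gtr0_norm ?invr_gt0// mulrC ler_wpM2r// invr_ge0 ltW.
Qed.

Section Flow.
Variables (T nu : R) (A : set R) (p g : R -> R -> R) (gi : R -> R).
Hypotheses (nu0 : 0 < nu) (T0 : 0 < T) (gi2 : L2 gi) (A0 : A 0).
Hypothesis S : forall t, A t -> state (p t) (g t).
Let U t := vol (p t).
Let G t x := nu * (gi x - g t x).
Hypothesis C : curve T A U G.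

(** A difference of velocities is [- nu] times the difference of slopes, and slopes depend
    monotonically on volumes. *)
Lemma flow_monotone s t : A s -> A t ->
  ip (fun x => G t x - G s x) (fun x => U t x - U s x) <= 0.
Proof.
move=> As At; have := monotone0 (S At) (S As).
have [_ gt2 _ _] := S At; have [_ gs2 _ _] := S As.
have W2 := L2B (vol_L2 (S At)) (vol_L2 (S As)).
have -> : ip (fun x => G t x - G s x) (fun x => U t x - U s x) =
    - nu * ip (fun x => g t x - g s x) (fun x => U t x - U s x).
  rewrite -ipZl; [|exact: L2B|exact: W2].
  by apply: ip_ext => // x _; rewrite /G; ring.
by rewrite mulNr oppr_le0 => h; rewrite mulr_ge0// ltW.
Qed.

Lemma flow_G_L2 t : A t -> L2 (G t).
Proof. by move=> /S[_ g2 _ _]; exact/L2Z/L2B. Qed.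

(** By monotonicity [U] recedes from [U s] no faster than a motion with the constant velocity [G s]
    would. *)
Lemma flow_lipschitz s t : A s -> A t -> 0 <= s -> s <= t -> t <= T ->
  nm (fun x => U t x - U s x) <= (t - s) * nm (G s).
Proof.
move=> As At s0 st tT.
apply: (curve_lipschitz C As At s0 st tT (flow_G_L2 As)).
have [_ Aae _ _] := C; apply: ae_imply Aae _ => tau H /andP[h1 h2].
have [Atau _] := H (ltac:(apply/andP; split; lra)).
exact: flow_monotone.
Qed.

(** The curve and its shift by [h] follow the same monotone flow, so the squared distance between
    them has nonpositive derivative. *)
Lemma flow_contraction h s t : 0 < h -> A s -> A t -> A (s + h) -> A (t + h) ->
  0 <= s -> s <= t -> t + h <= T ->
  nm (fun x => U (t + h) x - U t x) <= nm (fun x => U (s + h) x - U s x).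
Proof.
move=> h0 As At Ash Ath s0 st thT; have Ch := curve_shift h0 C.
have tT : t <= T - h by lra.
have := @curve_energy R _ _ _ _ s t 0 Ch (conj As Ash) (conj At Ath) s0 st tT.
rewrite mulr0 mul0r subr_le0 => H.
rewrite nm_le ?nm_ge0// nm_sq; apply: H.
have [_ Aae _ _] := Ch; apply: ae_imply Aae _ => tau H /andP[h1 h2].
have [[Atau Atauh] _] := H (ltac:(apply/andP; split; lra)).
have [_ g1 _ _] := S Atau; have [_ g2 _ _] := S Atauh.
exact: flow_monotone.
Qed.

(** The increment over a time [h] is no longer than the one that starts at time 0, and that one is
    at most [h * nm (G 0)]; [velocity_bound] turns this into a bound on the velocity. *)
Lemma flow_velocity : {ae mu, forall t, 0 < t < T -> nm (G t) <= nm (G 0)}.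
Proof.
apply: (velocity_bound C (nm_ge0 _)).
have [_ Aae _ _] := C; apply: ae_imply Aae _ => h H hT t At Ath t0 thT.
have [Ah _] := H hT; have [h0 h1] := andP hT.
have A0h : A (0 + h) by rewrite add0r.
apply: (le_trans (flow_contraction h0 A0 At A0h Ath (lexx 0) t0 thT)).
have := flow_lipschitz A0 Ah (lexx 0) (ltW h0) (ltW h1).
by rewrite subr0 mulrC add0r.
Qed.

(** At times with [nm (G t) <= nm (G 0)], [U] is Lipschitz in time and slopes are at most [r], so
    [state_close] gives uniform continuity of [p] in time. The exceptional times are filled in by
    limits, which [state_limit] shows to be states with the same velocity bound. *)
Lemma flow_extension (r : R) : nm (G 0) / nu + nm gi <= r -> r <= 1 ->
  exists P Gam : R -> R -> R, [/\
   forall t : R, 0 <= t <= T -> state (P t) (Gam t) /\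
     nm (fun x => nu * (gi x - Gam t x)) <= nm (G 0),
   curve T [set t | 0 <= t <= T] (fun t => vol (P t)) (fun t x => nu * (gi x - Gam t x)),
   (forall e : R, 0 < e -> exists2 d : R, 0 < d & forall s t : R,
     0 <= s <= T -> 0 <= t <= T -> `|s - t| <= d ->
     forall x : R, 0 <= x <= 1 -> `|P t x - P s x| <= e),
   (forall x : R, 0 <= x <= 1 -> P 0 x = p 0 x) &
   {ae mu, forall t, 0 < t < T -> A t /\ forall x, 0 <= x <= 1 -> P t x = p t x}].
Proof.
move=> cr r1; set c := nm (G 0) in cr *.
have c0 : 0 <= c := nm_ge0 _.
pose B t := A t /\ nm (G t) <= c.
have B0 : B 0 by split=> //; exact: lexx.
have Bae : {ae mu, forall t, 0 < t < T -> B t}.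
  have [_ Aae _ _] := C; apply: ae_imply2 Aae flow_velocity _ => t H1 H2 t0.
  by split; [have [] := H1 t0|exact: H2].
have CB : curve T B U G by apply: curve_restrict C _ Bae => t [].
have gr t : B t -> nm (g t) <= r.
  move=> [At Gt]; apply: le_trans cr; have [_ g2 _ _] := S At.
  exact: slope_bound.
have gr1 t : B t -> nm (g t) <= 1 by move=> /gr; lra.
have Ulip s t : B s -> B t -> 0 <= s -> s <= t -> t <= T ->
    nm (fun x => U t x - U s x) <= c * (t - s).
  move=> Bs Bt s0 st tT; rewrite -Rint_cst_cc//.
  apply: (curve_increment CB _ _ _ Bs Bt) => //.
    by apply: itg_cst_cc; exact: ltW.
  by apply: ae_imply Bae _ => tau H /H[].
have unif : forall e : R, 0 < e -> exists2 d : R, 0 < d & forall s t : R, B s -> B t ->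
    0 <= s <= T -> 0 <= t <= T -> `|s - t| <= d ->
    forall x : R, 0 <= x <= 1 -> `|p t x - p s x| <= e.
  move=> e e0; have [d d0 H] := @state_close R e e0.
  exists (d / (c + 1)); first by rewrite divr_gt0// ltr_wpDl.
  have key (s t : R) : B s -> B t -> 0 <= s -> s <= t -> t <= T -> t - s <= d / (c + 1) ->
      forall x : R, 0 <= x <= 1 -> `|p t x - p s x| <= e.
    move=> Bs Bt s0 st tT std x x01.
    apply: (H _ _ _ _ (S Bt.1) (S Bs.1) (gr1 _ Bt) (gr1 _ Bs)) => //.
    apply: (le_trans (Ulip s t Bs Bt s0 st tT)).
    apply: (@le_trans _ _ ((c + 1) * (d / (c + 1)))).
      by apply: ler_pM => //; lra.
    by rewrite mulrC divfK// gt_eqF// ltr_wpDl.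
  move=> s t Bs Bt /andP[s0 sT] /andP[t0 tT] std x x01.
  move: std; rewrite ler_norml => /andP[h1 h2].
  have [st|ts] := leP s t; first by apply: key => //; lra.
  by rewrite distrC; apply: key => //; lra.
have dense : forall t : R, 0 <= t <= T -> forall d : R, 0 < d ->
    exists2 s : R, B s /\ 0 <= s <= T & `|s - t| <= d.
  move=> t /andP[t0 tT] d d0.
  have a0 : 0 <= Num.max 0 (t - d) by rewrite le_max lexx.
  have bT : Num.min T (t + d) <= T by rewrite ge_min lexx.
  have ab : Num.max 0 (t - d) < Num.min T (t + d).
    rewrite gt_max !lt_min T0; apply/andP; split; apply/andP; split; lra.
  have [s Bs] := curve_dense CB a0 ab bT.
  rewrite gt_max lt_min => /andP[/andP[h1 h2] /andP[h3 h4]].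
  by exists s; [split=> //; apply/andP; split; lra|rewrite ler_norml; apply/andP; split; lra].
have [P HP] := uniform_extension dense unif.
have Pp s x : B s -> 0 <= s <= T -> 0 <= x <= 1 -> P s x = p s x.
  move=> Bs s0T x01; apply/eqP; rewrite -subr_eq0 -normr_le0; apply/ler_addgt0Pr => d d0.
  rewrite add0r; have [d' d'0 H] := HP d d0; apply: (H s s) => //.
  by rewrite subrr normr0 ltW.
have PC (e : R) : 0 < e -> exists2 d : R, 0 < d & forall s t : R,
     0 <= s <= T -> 0 <= t <= T -> `|s - t| <= d ->
     forall x : R, 0 <= x <= 1 -> `|P t x - P s x| <= e.
  move=> e0; have [d d0 H] := HP (e / 2) (ltac:(lra)).
  exists (d / 2); first lra.
  move=> s t s0T t0T st x x01.
  have [s' [Bs' s'0] s's] := dense s s0T (d / 2) (ltac:(lra)).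
  have d2d : d / 2 <= d by lra.
  have h1 := H s' s Bs' s'0 s0T (le_trans s's d2d) x x01.
  have h2 : `|P t x - p s' x| <= e / 2.
    apply: (H s' t) => //; have -> : s' - t = (s' - s) + (s - t) by ring.
    by rewrite [leRHS]splitr; apply: (le_trans (ler_normD _ _)); exact: lerD.
  have -> : P t x - P s x = (P t x - p s' x) - (P s x - p s' x) by ring.
  by rewrite [leRHS]splitr; apply: (le_trans (ler_normB _ _)); exact: lerD.
(* At a good time the slope is kept equal to [g t], so that the extended curve has the same velocity
   almost everywhere; at the other times a limit slope is chosen. *)
have PS (t : R) : exists k : R -> R, 0 <= t <= T ->
    [/\ state (P t) k, nm (fun x => nu * (gi x - k x)) <= c & B t -> k = g t].
  have [t0T|nt] := boolP (0 <= t <= T); last by exists (fun=> 0).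
  have [Bt|nBt] := pselect (B t).
    exists (g t) => _; split=> //; last by case: Bt.
    have [pA g2 p0 p1] := S Bt.1; have E x : 0 <= x <= 1 -> p t x = P t x.
      by move=> x01; rewrite Pp.
    split=> //.
    - by apply: AC_ext E _ ler01 pA.
    - by move=> x x01; rewrite -E//; exact: p0.
    - by rewrite -p1; apply: Rint_ext => x /I01P x01; rewrite E.
  have /choice[s Hs] (n : nat) : exists s : R, B s /\
      forall x : R, 0 <= x <= 1 -> `|P t x - p s x| <= n.+1%:R^-1.
    have n0 : 0 < (n.+1%:R^-1 : R) by rewrite invr_gt0 ltr0n.
    have [d d0 H] := HP _ n0; have [s [Bs s0T] sd] := dense t t0T d d0.
    by exists s; split=> // x x01; exact: H.
  have [k kS kc] := @state_limit (P t) (fun n => p (s n)) (fun n => g (s n)) gi nu c r nu0 r1 gi2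
    (fun n => S (Hs n).1.1) (fun n => gr _ (Hs n).1) (fun n => (Hs n).1.2) (fun n => (Hs n).2).
  by exists k.
have {PS} [Gam HG] := choice PS.
exists P, Gam; split=> //.
- by move=> t /HG[].
- apply: (@curve_ext _ _ _ G); last first.
    apply: ae_imply Bae _ => t H t0T; have t0T' : 0 <= t <= T by case/andP: t0T => ? ?; rewrite !ltW.
    by have [_ _ E] := HG t t0T'; rewrite (E (H t0T)).
  apply: (curve_extend CB); first by move=> t /HG[/vol_L2].
  move=> t t0T e e0; have [St Gt _] := HG t t0T.
  have [d d0 H] := HP (e / 7) (ltac:(lra)).
  have Gt1 : nm (Gam t) <= 1.
    by have [_ k2 _ _] := St; have := slope_bound nu0 gi2 k2 Gt; lra.
  exists d => // s Bs s0T st.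
  have -> : e = 7 * (e / 7) by field.
  exact: vol_close St (S Bs.1) Gt1 (gr1 _ Bs) (H s t Bs s0T t0T st).
- by move=> x x01; rewrite Pp// lexx ltW.
- apply: ae_imply Bae _ => t H /[dup] /H [At Gt] /andP[t0 tT]; split=> // x x01.
  by rewrite Pp// !ltW.
Qed.


End Flow.
End StageOne.

(** * Energy decay *)

Section Gronwall.
Context {R : realType}.

(** [E] is compared with [b s = E 0 * expR (- (lam * s)) + e * (1 + s)]. The supremum of the times
    up to which [E <= b] is itself such a time, because [E] does not jump up from the left; were it
    less than [t], the right difference estimate would carry the comparison further. *)
Lemma dini_gronwall (E : R -> R) (T lam : R) : 0 <= lam -> 0 <= E 0 ->
  (forall t : R, 0 <= t < T -> forall e : R, 0 < e -> exists2 d : R, 0 < d &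
     forall h : R, 0 < h <= d -> t + h < T -> E (t + h) - E t <= h * (e - lam * E t)) ->
  (forall t : R, 0 <= t < T -> forall e : R, 0 < e -> exists2 d : R, 0 < d &
     forall s : R, 0 <= s <= t -> t - s <= d -> E t <= E s + e) ->
  forall t : R, 0 <= t < T -> E t <= E 0 * expR (- (lam * t)).
Proof.
move=> lam0 E0 HR HL t /andP[t0 tT]; apply/ler_addgt0Pr => e' e'0.
pose e := e' / (1 + t); have e0 : 0 < e by rewrite divr_gt0//; linarith.
pose b s := E 0 * expR (- (lam * s)) + e * (1 + s).
suff : E t <= b t by rewrite /b (_ : e * (1 + t) = e')// /e divfK// gt_eqF//; linarith.
pose A := [set s : R | 0 <= s <= t /\ forall x, 0 <= x <= s -> E x <= b x].
have A0 : A 0.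
  split; first by rewrite lexx.
  move=> x x0; have -> : x = 0 by linarith.
  by rewrite /b mulr0 oppr0 expR0 mulr1; linarith.
have hA : has_sup A by split; [exists 0|exists t => x [/andP[]]].
have s0 : 0 <= sup A by apply: sup_upper_bound.
have st : sup A <= t by apply: ge_sup; [exists 0|move=> x [/andP[]]].
have below x : 0 <= x -> x < sup A -> E x <= b x.
  move=> x0 xs; have [y [_ Ay] xy] := sup_adherent (ltac:(by rewrite subr_gt0) : 0 < sup A - x) hA.
  by apply: Ay; linarith.
set s := sup A in s0 st below.
have Es : E s <= b s.
  apply/ler_addgt0Pr => z z0.
  have [->|sn0] := eqVneq s 0; first by rewrite /b mulr0 oppr0 expR0 mulr1; linarith.
  have sp : 0 < s by rewrite lt_neqAle eq_sym sn0.
  have [d d0 H] := HL s (ltac:(linarith)) (z / 2) (ltac:(linarith)).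
  (* At an earlier time [b] exceeds [b s] by at most [k] times the distance; the step back from [s]
     is short enough to make this at most [z / 2]. *)
  pose k := E 0 * lam + 1; have k0 : 0 < k by rewrite /k; have := mulr_ge0 E0 lam0; linarith.
  pose x := s - Num.min (Num.min d s) (z / (2 * k)).
  have w0 : 0 < Num.min (Num.min d s) (z / (2 * k)).
    by rewrite !lt_min d0 sp/= divr_gt0// mulr_gt0.
  have w1 : Num.min (Num.min d s) (z / (2 * k)) <= d by rewrite !ge_min lexx.
  have w2 : Num.min (Num.min d s) (z / (2 * k)) <= s by rewrite !ge_min lexx orbT.
  have w3 : Num.min (Num.min d s) (z / (2 * k)) <= z / (2 * k) by rewrite !ge_min lexx orbT.
  have x0 : 0 <= x by rewrite /x; linarith.
  have xs : x < s by rewrite /x; linarith.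
  have h1 := H x (ltac:(linarith)) (ltac:(rewrite /x; linarith)).
  have h2 := below x x0 xs.
  have h3 : b x <= b s + k * (s - x).
    rewrite /b; have e1 : expR (- (lam * x)) <= expR (- (lam * s)) + lam * (s - x).
      have -> : - (lam * s) = - (lam * x) + - (lam * (s - x)) by ring.
      rewrite expRD; have e2 := expR_ge1Dx (- (lam * (s - x))).
      have e3 : expR (- (lam * x)) <= 1 by rewrite -expR0 ler_expR oppr_le0 mulr_ge0.
      have e4 := expR_gt0 (- (lam * x)).
      have e5 : 0 <= lam * (s - x) by apply: mulr_ge0 => //; linarith.
      nra.
    have := ler_wpM2l E0 e1; have : 0 <= s - x by linarith.
    rewrite /k; have := mulr_ge0 (ltW e0) (ltac:(linarith) : 0 <= s - x); linarith.
  have h4 : k * (s - x) <= z / 2.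
    have -> : z / 2 = k * (z / (2 * k)) by field; rewrite gt_eqF.
    by rewrite ler_pM2l// /x; linarith.
  linarith.
have [<-//|nst] := eqVneq s t.
have {}st : s < t by rewrite lt_neqAle nst.
exfalso; have [d d0 H] := HR s (ltac:(linarith)) e e0.
(* Steps of length at most [k^-1] give [lam * h <= 1], so that [E s <= b s] may be multiplied by
   [1 - lam * h]. *)
pose k := lam + 1; have k0 : 0 < k by rewrite /k; linarith.
pose w := Num.min (Num.min d (t - s)) k^-1.
have w0 : 0 < w by rewrite !lt_min d0 invr_gt0 k0 subr_gt0 st.
have w1 : w <= d by rewrite !ge_min lexx.
have w2 : w <= t - s by rewrite !ge_min lexx orbT.
have w3 : w <= k^-1 by rewrite !ge_min lexx orbT.
have : A (s + w).
  split; first linarith.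
  move=> x /andP[x0 xw]; have [xs|sx] := ltP x s; first exact: below.
  have [->//|nxs] := eqVneq x s.
  have {}sx : s < x by rewrite lt_neqAle eq_sym nxs.
  pose h := x - s; have xE : x = s + h by rewrite /h; ring.
  have h0 : 0 < h by rewrite /h; linarith.
  have hw : h <= w by rewrite /h; linarith.
  have hk : lam * h <= 1.
    have : k * h <= 1 by rewrite mulrC -ler_pdivlMr// div1r; linarith.
    by rewrite /k; linarith.
  have := H h (ltac:(linarith)) (ltac:(linarith)); rewrite -xE => h1.
  have h2 : E x <= E s * (1 - lam * h) + e * h by linarith.
  have h3 : E s * (1 - lam * h) <= b s * (1 - lam * h) by apply: ler_wpM2r => //; linarith.
  have h4 : expR (- (lam * s)) * (1 - lam * h) <= expR (- (lam * x)).
    have -> : - (lam * x) = - (lam * s) + - (lam * h) by rewrite xE; ring.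
    by rewrite expRD ler_pM2l ?expR_gt0//; exact: expR_ge1Dx.
  have h5 := ler_wpM2l E0 h4.
  have h6 : 0 <= e * (1 + s) * (lam * h) by apply: mulr_ge0; apply: mulr_ge0 => //; linarith.
  rewrite /b xE; rewrite /b in h3; rewrite xE in h2 h5; linarith.
move=> /(sup_upper_bound hA); rewrite -/s; linarith.
Qed.

End Gronwall.

(** * Differentiation of the energy *)

Section StageTwo.
Context {R : realType}.
Notation mu := (@lebesgue_measure R).
Variables (T nu r : R) (p g : R -> R -> R) (pi_ gi : R -> R).
Hypotheses (nu0 : 0 < nu) (T0 : 0 < T) (r01 : 0 <= r < 1).
Hypotheses (Si : state pi_ gi) (gir : nm gi <= r).
Hypothesis S : forall t : R, 0 <= t <= T -> state (p t) (g t).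
Hypothesis gr : forall t : R, 0 <= t <= T -> nm (g t) <= r.
Let U t := vol (p t).
Let G t x := nu * (gi x - g t x).
Hypothesis C : curve T [set t | 0 <= t <= T] U G.
Hypothesis PC : forall e : R, 0 < e -> exists2 d : R, 0 < d & forall s t : R,
     0 <= s <= T -> 0 <= t <= T -> `|s - t| <= d ->
     forall x : R, 0 <= x <= 1 -> `|p t x - p s x| <= e.

Let N t := ip (G t) (G t).
(** Strong monotonicity constant of the flow, obtained from [monotone] with the lower bound
    [1 - 3/5 r] common to all states. *)
Let c := nu * ((1 - 3 / 5 * r) ^+ 2 * pi ^+ 2).
Let D h t x := U (t + h) x - U t x.

Let gi2 : L2 gi. Proof. by case: Si. Qed.

Let g2 (t : R) : 0 <= t <= T -> L2 (g t). Proof. by move=> /S[]. Qed.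

Let G2 (t : R) : 0 <= t <= T -> L2 (G t). Proof. by move=> /g2; move/(L2B gi2)/(L2Z nu). Qed.

Let D2 (h t : R) : 0 < h -> 0 <= t -> t + h <= T -> L2 (D h t).
Proof. by move=> h0 t0 tT; apply: L2B; apply: vol_L2 (S _); apply/andP; split; lra. Qed.

Let c0 : 0 <= c.
Proof. by rewrite /c; apply: mulr_ge0; [exact: ltW|rewrite mulr_ge0 ?sqr_ge0]. Qed.

Let m0 : 0 < 1 - 3 / 5 * r. Proof. by have [? ?] := andP r01; lra. Qed.

Let G_mono (s t : R) : 0 <= s <= T -> 0 <= t <= T ->
  ip (fun x => G t x - G s x) (fun x => U t x - U s x) <=
  - c * ip (fun x => U t x - U s x) (fun x => U t x - U s x).
Proof.
move=> sT tT; have lo t' : 0 <= t' <= T -> forall x, 0 <= x <= 1 -> 1 - 3 / 5 * r <= p t' x.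
  move=> t'T x x01; apply: le_trans (state_lower (S t'T) x01); have := gr t'T; lra.
have M := monotone (S tT) (S sT) m0 (lo t tT) (lo s sT).
have W2 := L2B (vol_L2 (S tT)) (vol_L2 (S sT)).
have -> : ip (fun x => G t x - G s x) (fun x => U t x - U s x) =
    - nu * ip (fun x => g t x - g s x) (fun x => U t x - U s x).
  rewrite -ipZl; [|by apply: L2B; exact: g2|exact: W2].
  by apply: ip_ext => // x _; rewrite /G; ring.
have := ler_wpM2l (ltW nu0) M; rewrite -/(U t) -/(U s) /c; lra.
Qed.

Lemma increment_lipschitz (h t : R) : 0 < h -> 0 <= t -> t + h <= T -> nm (D h t) <= h * nm (G t).
Proof.
move=> h0 t0 thT; have := @flow_lipschitz R T nu _ p g gi nu0 gi2 S C t (t + h).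
rewrite (_ : t + h - t = h); last by ring.
apply; [apply/andP; split; lra|apply/andP; split; lra|lra|lra|lra].
Qed.

(** Increments shrink along the flow, so between [s] and [t] the squared norm decreases at a rate of
    at least [2 c] times its final value. The resulting linear form already has the derivative at
    [s = t] that the energy estimate needs. *)
Lemma increment_decay (h s t : R) : 0 < h -> 0 <= s -> s <= t -> t + h <= T ->
  ip (D h t) (D h t) * (1 + 2 * c * (t - s)) <= ip (D h s) (D h s).
Proof.
move=> h0 s0 st thT; have Ch := curve_shift h0 C.
have inT t' : 0 <= t' -> t' + h <= T -> 0 <= t' <= T /\ 0 <= t' + h <= T.
  by move=> ? ?; split; apply/andP; split; lra.
have [t0 sh] : 0 <= t /\ s + h <= T by split; lra.
have tT : t <= T - h by lra.
have AE : {ae mu, forall tau, s < tau < t ->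
    ip (fun x => G (tau + h) x - G tau x) (fun x => U (tau + h) x - U tau x) <=
    - c * ip (D h t) (D h t)}.
  apply: aeW => tau /andP[h1 h2].
  have [t1 t2] := inT tau (ltac:(lra)) (ltac:(lra)).
  apply: (le_trans (G_mono t1 t2)); rewrite !mulNr lerN2; apply: (ler_wpM2l c0).
  have [t3 t4] := inT t t0 thT.
  have := @flow_contraction R T nu _ p g gi nu0 S C h tau t h0 t1 t3 t2 t4 (ltac:(lra)) (ltW h2) thT.
  rewrite -/(D h t) -/(D h tau) => F.
  by rewrite -[leLHS]nm_sq -[leRHS]nm_sq; apply: lerXn2r F; rewrite nnegrE nm_ge0.
have H := curve_energy Ch (inT s s0 sh) (inT t t0 thT) s0 st tT AE.
rewrite mulrDr mulr1 -lerBrDr -lerBlDl; apply: le_trans H _.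
by rewrite le_eqVlt; apply/orP; left; apply/eqP; ring.
Qed.

(** The primitive of [G t] at [x] is [nu] times [primitive gi x - (p t x - p t 0)], so it inherits
    the uniform continuity of [p] in time. *)
Lemma velocity_primitive (s e : R) : 0 < e -> 0 <= s < T -> exists2 d : R, 0 < d &
  forall t : R, s <= t <= T -> t - s <= d -> forall x : R, 0 <= x <= 1 ->
  `|primitive (G t) x - primitive (G s) x| <= e.
Proof.
move=> e0 /andP[s0 sT].
have [d d0 H] := PC (ltac:(rewrite divr_gt0// mulr_gt0//) : 0 < e / (2 * nu)).
exists d => // tau /andP[st tT] td x x01.
have sT' : 0 <= s <= T by apply/andP; split; lra.
have tauT : 0 <= tau <= T by apply/andP; split; lra.
rewrite !primitiveZ//; [|by apply: L2B => //; exact: g2..].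
rewrite !primitiveB//; [|exact: g2..].
have [A1 _ _ _] := S sT'; have [A2 _ _ _] := S tauT.
have E1 := AC_primE A1 x01; have E2 := AC_primE A2 x01.
have ttau : `|s - tau| <= d by rewrite ler_norml; apply/andP; split; lra.
have b1 := H s tau sT' tauT ttau x x01.
have b2 := H s tau sT' tauT ttau 0 (ltac:(by rewrite lexx ler01)).
have -> : nu * (primitive gi x - primitive (g tau) x) - nu * (primitive gi x - primitive (g s) x)
  = nu * ((p tau 0 - p s 0) - (p tau x - p s x)) by rewrite E1 E2; ring.
rewrite normrM gtr0_norm// (_ : e = nu * (e / (2 * nu) + e / (2 * nu))); last first.
  by field; rewrite gt_eqF.
by rewrite ler_pM2l//; apply: (le_trans (ler_normB _ _)); exact: lerD.
Qed.

(** Pairing with the indicator of [[0, x]] writes the primitive of the increment as the time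
    integral of [primitive (G tau) x], which is continuous in time. *)
Lemma increment_weak (t e : R) : 0 <= t < T -> 0 < e -> exists2 d : R, 0 < d &
  forall h : R, 0 < h <= d -> t + h <= T -> forall x : R, 0 <= x <= 1 ->
  `|primitive (D h t) x - h * primitive (G t) x| <= e * h.
Proof.
move=> /andP[t0 tT] e0; have tT1 : 0 <= t < T by rewrite t0.
have [d d0 H] := velocity_primitive e0 tT1.
exists d => // h /andP[h0 hd] thT x x01; have [x0 x1] := andP x01.
have X2 := L2_indic (lexx 0) x0 x1.
have [_ _ _ W] := C; have [gm [gi' ge E]] := W _ X2.
have tT' : 0 <= t <= T by apply/andP; split; lra.
have thT' : 0 <= t + h <= T by apply/andP; split; lra.
have := E t (t + h) tT' thT' t0 (ltac:(lra)) thT.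
rewrite ip_indic_prim; [|exact: D2|exact: x01].
rewrite -/(D h t) => ->.
have gi2' : itg mu `[t, t + h] gm by exact: itg_cc gi'.
have tth : t <= t + h by lra.
have -> : h * primitive (G t) x = \int[mu]_(tau in `[t, t + h]) primitive (G t) x.
  by rewrite Rint_cst_cc//; ring.
have -> : e * h = \int[mu]_(tau in `[t, t + h]) e by rewrite Rint_cst_cc//; ring.
rewrite -RintegralB//; last exact: itg_cst_cc.
apply: le_normr_Rint => //.
- by apply: itgB => //; exact: itg_cst_cc.
- exact: itg_cst_cc.
apply: ae_itv; apply: ae_imply ge _ => tau Hg /andP[h1 h2].
have tauT : 0 <= tau <= T by apply/andP; split; lra.
rewrite Hg; last by apply/andP; split; lra.
rewrite ip_indic_prim//; last exact: G2.
apply: H => //; [apply/andP; split; lra|lra].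
Qed.

(** This is [increment_decay] divided by [h^2]: [increment_lipschitz] bounds the right side by
    [N s], and [weak_lsc] recovers [N t] on the left as [h] tends to 0. It holds at every time, not
    just at almost every one. *)
Lemma velocity_decay (s t : R) : 0 <= s -> s <= t -> t < T ->
  N t * (1 + 2 * c * (t - s)) <= N s.
Proof.
move=> s0 st tT; have t0 : 0 <= t by lra.
have tT' : 0 <= t <= T by apply/andP; split; lra.
have k0 : 0 < 1 + 2 * c * (t - s).
  have ts : 0 <= t - s by lra.
  have := mulr_ge0 c0 ts; lra.
rewrite -ler_pdivlMr//.
have [e [e01 ed]] := @rat01_dense R.
pose h n : R := (T - t) / n.+1%:R.
have h0 n : 0 < h n by rewrite divr_gt0 ?ltr0n// subr_gt0.
have hT n : h n <= T - t.
  by rewrite ler_pdivrMr ?ltr0n// ler_peMr ?ler1n// subr_ge0 ltW.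
have thT n : t + h n <= T by have := hT n; lra.
pose k n x := (h n)^-1 * D (h n) t x.
have D2' n : L2 (D (h n) t) by exact: D2.
have k2 n : L2 (k n) by exact/L2Z.
have kK n : ip (k n) (k n) <= N s / (1 + 2 * c * (t - s)).
  rewrite ipZZ// exprVn ler_pdivrMl ?exprn_gt0// mulrA ler_pdivlMr//.
  apply: (le_trans (increment_decay (h0 n) s0 st (thT n))).
  have shT : s + h n <= T by have := thT n; lra.
  rewrite -nm_sq -[N s]nm_sq -exprMn; apply: lerXn2r; rewrite ?nnegrE ?nm_ge0//.
    by rewrite mulr_ge0 ?nm_ge0// ltW.
  exact: increment_lipschitz.
have kf i : primitive (k n) (e i) @[n --> \oo] --> primitive (G t) (e i).
  apply/cvgrPdist_le => z z0; have tT2 : 0 <= t < T by rewrite t0.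
  have [d d0 H] := increment_weak tT2 z0.
  near=> n; have hd : h n <= d.
    rewrite ler_pdivrMr ?ltr0n// mulrC -ler_pdivrMr//; apply: ltW.
    apply: (lt_le_trans (truncnS_gt _)); rewrite ler_nat ltnS.
    by near: n; exact: nbhs_infty_ge.
  rewrite [X in _ - X]primitiveZ//.
  have := H (h n) (ltac:(by rewrite h0)) (thT n) (e i) (e01 i) => HH.
  have -> : primitive (G t) (e i) - (h n)^-1 * primitive (D (h n) t) (e i) =
     - ((h n)^-1 * (primitive (D (h n) t) (e i) - h n * primitive (G t) (e i))).
    by field; rewrite gt_eqF.
  by rewrite normrN normrM gtr0_norm ?invr_gt0// ler_pdivrMl// (mulrC _ z).
have [l [l2 lK lE]] := weak_lsc e01 k2 kK kf.
have lG := ae_of_primitive l2 (G2 tT') (primitive_dense ed e01 l2 (G2 tT') lE).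
rewrite (_ : N t = ip l l)// -[N t]nm_sq -[RHS]nm_sq; congr (_ ^+ 2).
by apply/esym; apply: nm_ae => //; exact: G2.
Unshelve. all: by end_near. Qed.

(** Weak continuity and a nonincreasing norm give strong right continuity. If [G (t + h)] stayed
    away from [G t], the parallelogram identity would bound the square of [G (t + h) + G t] by
    [4 N t - e], whereas the weak limit [2 G t] of these sums has square [4 N t]. *)
Lemma velocity_rcont (t e : R) : 0 <= t < T -> 0 < e -> exists2 d : R, 0 < d &
  forall h : R, 0 < h <= d -> t + h < T ->
  ip (fun x => G (t + h) x - G t x) (fun x => G (t + h) x - G t x) <= e.
Proof.
move=> /[dup] t0T /andP[t0 tT] e0; apply: contrapT => no.
have tT' : 0 <= t <= T by apply/andP; split; lra.
have /choice[h Hh] (n : nat) : exists h : R, [/\ 0 < h, h <= n.+1%:R^-1, t + h < T &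
   e < ip (fun x => G (t + h) x - G t x) (fun x => G (t + h) x - G t x)].
  apply: contrapT => no'; apply: no; exists n.+1%:R^-1; first by rewrite invr_gt0 ltr0n.
  move=> h /andP[h0 hn] thT; rewrite leNgt; apply/negP => lt.
  by apply: no'; exists h.
have hT n : 0 <= t + h n <= T by have [a _ b _] := Hh n; apply/andP; split; lra.
have [e' [e01 ed]] := @rat01_dense R.
pose k n x := G (t + h n) x + G t x.
have k2 n : L2 (k n) by apply: L2D; exact: G2.
have kK n : ip (k n) (k n) <= 4 * N t - e.
  rewrite ipDD; [|exact: G2..].
  have [h0 _ hT' lt] := Hh n; rewrite ipBB in lt; [|exact: G2..].
  have th : t <= t + h n by lra.
  have := velocity_decay t0 th hT'; rewrite /N => ND.
  have X0 := ip_ge0 (G (t + h n)).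
  have hh : 0 <= t + h n - t by lra.
  have := mulr_ge0 X0 (mulr_ge0 c0 hh); lra.
have kf i : primitive (k n) (e' i) @[n --> \oo] --> primitive (fun x => G t x + G t x) (e' i).
  apply/cvgrPdist_le => z z0; have [d d0 H] := velocity_primitive z0 t0T.
  near=> n; have [h0 hn _ _] := Hh n.
  have hd : h n <= d.
    apply: (le_trans hn); rewrite -[leRHS]invrK lef_pV2 ?posrE ?invr_gt0//.
    apply: ltW; apply: (lt_le_trans (truncnS_gt _)); rewrite ler_nat ltnS.
    by near: n; exact: nbhs_infty_ge.
  rewrite !primitiveD//; [|exact: G2..].
  rewrite opprD addrACA subrr addr0 distrC; apply: H => //.
  - by have /andP[_ ?] := hT n; apply/andP; split; lra.
  - lra.
have [l [l2 lK lE]] := weak_lsc e01 k2 kK kf.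
have GG2 : L2 (fun x => G t x + G t x) by apply: L2D; exact: G2.
have lG := ae_of_primitive l2 GG2 (primitive_dense ed e01 l2 GG2 lE).
have E : ip l l = 4 * N t.
  rewrite -[LHS]nm_sq (nm_ae l2 GG2 lG) nm_sq ipDD /N; [|exact: G2..].
  by ring.
by rewrite E in lK; lra.
Unshelve. all: by end_near. Qed.

(** Tested against itself, the increment minus [h G t] is a time integral of pairings with
    [G tau - G t], small by right continuity. *)
Lemma increment_strong (t e : R) : 0 <= t < T -> 0 < e -> exists2 d : R, 0 < d &
  forall h : R, 0 < h <= d -> t + h < T -> nm (fun x => D h t x - h * G t x) <= e * h.
Proof.
move=> /[dup] t0T /andP[t0 tT] e0; have [d d0 H] := velocity_rcont t0T (exprn_gt0 2 e0).
exists d => // h /andP[h0 hd] thT; have tT' : 0 <= t <= T by apply/andP; split; lra.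
have thT' : 0 <= t + h <= T by apply/andP; split; lra.
have Dh2 : L2 (D h t) by apply: D2 => //; lra.
have hG2 := L2Z h (G2 tT').
set psi := fun x => _; have psi2 : L2 psi by apply: L2B.
have [_ _ _ W] := C; have [gm [gi' ge E]] := W _ psi2.
have tth : t <= t + h by lra.
have E1 := E t (t + h) tT' thT' t0 tth (ltW thT); rewrite -/(D h t) in E1.
have : ip psi psi <= (e * nm psi) * h.
  rewrite [leLHS]ipBl// E1 ipZl//; last exact: G2.
  have -> : h * ip (G t) psi = \int[mu]_(tau in `[t, t + h]) ip (G t) psi.
    by rewrite Rint_cst_cc//; ring.
  have -> : e * nm psi * h = \int[mu]_(tau in `[t, t + h]) (e * nm psi).
    by rewrite Rint_cst_cc//; ring.
  have gi2' : itg mu `[t, t + h] gm by apply: itg_cc gi' => //; exact: ltW.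
  rewrite -RintegralB//; last exact: itg_cst_cc.
  apply: Rint_ae_le => //.
  - by apply: itgB => //; exact: itg_cst_cc.
  - exact: itg_cst_cc.
  apply: ae_itv; apply: ae_imply ge _ => tau Hg /andP[h1 h2].
  have tauT : 0 <= tau <= T by apply/andP; split; lra.
  rewrite Hg; last by apply/andP; split; lra.
  rewrite -ipBl//; [|exact: G2..].
  have GG2 : L2 (fun x => G tau x - G t x) by apply: L2B; exact: G2.
  apply: (le_trans (ip_le_nm GG2 psi2)); apply: ler_wpM2r; first exact: nm_ge0.
  rewrite nm_le ?(ltW e0)//; have := H (tau - t).
  by rewrite (_ : t + (tau - t) = tau); [apply; [apply/andP; split; lra|lra]|ring].
rewrite -nm_sq expr2 => h'.
have [->|nz] := eqVneq (nm psi) 0; first by rewrite mulr_ge0 ?ltW.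
have np : 0 < nm psi by rewrite lt_neqAle eq_sym nz nm_ge0.
by rewrite -(@ler_pM2r _ (nm psi))//; lra.
Qed.


Let q t x := p t x - pi_ x.
Let B t x := q t x * (p t x * g t x + p t x * g t x) + p t x * p t x * (g t x - gi x).

Let gr1 (t : R) : 0 <= t <= T -> nm (g t) <= 1.
Proof. by move=> /gr; have [? ?] := andP r01; lra. Qed.

Let q_bd (t x : R) : 0 <= t <= T -> 0 <= x <= 1 -> `|q t x| <= 2.
Proof.
move=> tT x01; have := state_bound (S tT) x01; have := state_bound Si x01.
have := gr1 tT; have [? ?] := andP r01; have := gir.
rewrite !ler_norml /q => ? ? /andP[? ?] /andP[? ?]; apply/andP; split; lra.
Qed.

Let p_lb (t x : R) : 0 <= t <= T -> 0 <= x <= 1 -> 2 / 5 <= p t x.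
Proof. by move=> tT x01; have := state_lower (S tT) x01; have := gr1 tT; lra. Qed.

Let qA (t : R) : 0 <= t <= T -> AC 0 1 (q t) (fun x => g t x - gi x).
Proof. by move=> /S[pA _ _ _]; have [iA _ _ _] := Si; exact: AC_B. Qed.

Let q2 (t : R) : 0 <= t <= T -> L2 (q t). Proof. by move=> /qA/AC01_L2. Qed.

(** Pointwise expansion of [q^2] to second order in the change of [1/p], the linear term being
    paired with [B] after integration by parts. With [v] the old and [w] the new value of [p], the
    slack is [(w - v)^2 (10 - 2 q / w)], nonnegative as [q <= 2] and [w >= 2/5]. *)
Lemma position_increment (h t : R) : 0 < h -> 0 <= t -> t + h <= T ->
  ip (q (t + h)) (q (t + h)) <= ip (q t) (q t) + 2 * ip (B t) (D h t) +
    11 * ip (fun x => p (t + h) x - p t x) (fun x => p (t + h) x - p t x).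
Proof.
move=> h0 t0 thT.
have tT : 0 <= t <= T by apply/andP; split; lra.
have hT : 0 <= t + h <= T by apply/andP; split; lra.
have FA := qpp_AC (S tT) Si; have B2 := qpp_L2 (S tT) Si.
have DA := AC_B (vol_AC (S hT)) (vol_AC (S tT)).
have i2 := L2B (state_inv_L2 (S hT)) (state_inv_L2 (S tT)).
have [A1 _ _ _] := S tT; have [A2 _ _ _] := S hT.
have d2 := AC01_L2 (AC_B A2 A1); have F2 := AC01_L2 FA.
have P := ip_parts FA DA B2 i2.
rewrite /= (vol1 (S tT)) (vol1 (S hT)) !vol0 !subrr !mulr0 subrr in P.
rewrite -/(U t) -/(U (t + h)) -/(D h t) -/(B t) in P.
rewrite [ip (B t) _]ipC.
set F := (fun x => (p t x - pi_ x) * (p t x * p t x)) in P F2.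
set du := (fun x => (p (t + h) x)^-1 - (p t x)^-1) in P i2.
have -> : 2 * ip (D h t) (B t) = - 2 * ip F du by lra.
have m1 := L2_itgM (q2 tT) (q2 tT); have m2 := itgZ (- 2) mI01 (L2_itgM F2 i2).
have m3 := itgZ 11 mI01 (L2_itgM d2 d2).
rewrite /ip -[- 2 * _]RintegralZl//; last exact: L2_itgM.
rewrite -[11 * _]RintegralZl//; last exact: L2_itgM.
rewrite -RintegralD// -RintegralD//; last exact: itgD.
apply: le_Rintegral => //.
- exact: L2_itgM (q2 hT) (q2 hT).
- by apply: itgD => //; exact: itgD.
move=> x /I01P x01; rewrite /F /du.
have p1 := p_lb tT x01; have p2 := p_lb hT x01.
have qb := q_bd tT x01; rewrite -/(q t x).
have z1 : 0 < p t x by lra.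
have z2 : 0 < p (t + h) x by lra.
have -> : q (t + h) x = q t x + (p (t + h) x - p t x) by rewrite /q; ring.
set w := p (t + h) x in p2 z2 *; set v := p t x in p1 z1 *.
have -> : q t x * q t x + - 2 * (q t x * (v * v) * (w^-1 - v^-1)) + 11 * ((w - v) * (w - v)) =
  (q t x + (w - v)) * (q t x + (w - v)) + (w - v) ^+ 2 * (10 - 2 * (q t x / w)).
  by field; rewrite !gt_eqF.
rewrite lerDl; apply: mulr_ge0; first exact: sqr_ge0.
have : q t x / w <= 5.
  by rewrite ler_pdivrMr//; move: qb; rewrite ler_norml => /andP[_ qb]; lra.
lra.
Qed.

(** [D h t] is [h G t] up to [o(h)]. The quadratic remainder is [o(h)] as well: by [sq_diff_le] it
    is a multiple of [nm (D h t) <= h * nm (G t)] times the norm of [g (t + h) - g t], which tends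
    to 0 from the right. *)
Lemma position_dini (t e : R) : 0 <= t < T -> 0 < e -> exists2 d : R, 0 < d &
  forall h : R, 0 < h <= d -> t + h < T ->
  ip (q (t + h)) (q (t + h)) - ip (q t) (q t) <= h * (2 * ip (B t) (G t) + e).
Proof.
move=> /[dup] t0T /andP[t0 tT'] e0.
have tT : 0 <= t <= T by apply/andP; split; lra.
have B2 : L2 (B t) := qpp_L2 (S tT) Si.
have b0 := nm_ge0 (B t); have n0 := nm_ge0 (G t).
(* 88 is [2 * 11 * 4], where 11 comes from [position_increment] and 4 from [sq_diff_le]. *)
pose e1 := e / (4 * (nm (B t) + 1)); pose e2 := e * nu / (88 * (nm (G t) + 1)).
have e10 : 0 < e1 by rewrite divr_gt0// mulr_gt0//; lra.
have e20 : 0 < e2 by rewrite divr_gt0 ?mulr_gt0//; lra.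
have [d1 d10 H1] := increment_strong t0T e10.
have [d2 d20 H2] := velocity_rcont t0T (exprn_gt0 2 e20).
exists (Num.min d1 d2); first by rewrite lt_min d10.
move=> h; rewrite le_min => /andP[h0 /andP[hd1 hd2]] thT.
have hT : 0 <= t + h <= T by apply/andP; split; lra.
have {}H1 := H1 h (ltac:(by rewrite h0)) thT; have {}H2 := H2 h (ltac:(by rewrite h0)) thT.
have Dh2 := D2 h0 t0 (ltW thT); have hG2 := L2Z h (G2 tT).
have I := position_increment h0 t0 (ltW thT).
have gg := L2B (g2 hT) (g2 tT).
have b1 : ip (B t) (D h t) <= h * ip (B t) (G t) + h * (e / 4).
  have -> : ip (B t) (D h t) = h * ip (B t) (G t) + ip (B t) (fun x => D h t x - h * G t x).
    by rewrite ipBr// ipZr//; [ring|exact: G2].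
  rewrite lerD2l; apply: (le_trans (ip_le_nm B2 (L2B Dh2 hG2))).
  apply: (@le_trans _ _ (nm (B t) * (e1 * h))); first by rewrite ler_wpM2l.
  have -> : h * (e / 4) = (nm (B t) + 1) * (e1 * h) by rewrite /e1; field; lra.
  by apply: ler_wpM2r; [rewrite mulr_ge0 ?ltW|lra].
have c1 : nm (fun x => g (t + h) x - g t x) <= e2 / nu.
  have -> : nm (fun x => g (t + h) x - g t x) = nm (fun x => nu^-1 * (G (t + h) x - G t x)).
    have E : nm (fun x => g (t + h) x - g t x) = nm (fun x => - (g (t + h) x - g t x)).
      by rewrite nmN.
    by rewrite E; apply: nm_ext => x _; rewrite /G; field; rewrite gt_eqF.
  have GG2 := L2B (G2 hT) (G2 tT).
  rewrite nmZ// gtr0_norm ?invr_gt0// mulrC; apply: ler_wpM2r; first by rewrite invr_ge0 ltW.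
  by rewrite nm_le// ltW.
have c2 : 11 * ip (fun x => p (t + h) x - p t x) (fun x => p (t + h) x - p t x) <= h * (e / 2).
  have s1 := sq_diff_le (S hT) (S tT) (gr1 hT) (gr1 tT).
  have W2 : L2 (fun x => vol (p (t + h)) x - vol (p t) x) := Dh2.
  have s2 := ip_le_nm gg W2.
  have s3 : nm (fun x => vol (p (t + h)) x - vol (p t) x) <= h * nm (G t).
    exact: increment_lipschitz h0 t0 (ltW thT).
  have s4 : nm (fun x => g (t + h) x - g t x) * nm (fun x => vol (p (t + h)) x - vol (p t) x) <=
      e2 / nu * (h * nm (G t)) by apply: ler_pM => //; exact: nm_ge0.
  have s5 : e2 / nu * (h * nm (G t)) <= e2 / nu * (h * (nm (G t) + 1)).
    apply: ler_wpM2l; first by rewrite divr_ge0 ?ltW.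
    by apply: ler_wpM2l; [exact: ltW|rewrite lerDl].
  have s6 : e2 / nu * (h * (nm (G t) + 1)) = h * e / 88.
    by rewrite /e2; field; rewrite !gt_eqF//; lra.
  lra.
lra.
Qed.

Theorem energy_decay (t : R) : 0 <= t < T ->
  ip (fun x => g t x - gi x) (fun x => g t x - gi x) + ip (q t) (q t) <=
  (ip (fun x => g 0 x - gi x) (fun x => g 0 x - gi x) + ip (q 0) (q 0)) *
    expR (- (2 * (nu * pi ^+ 2 * (1 - r) ^+ 2) * t)).
Proof.
pose X t := ip (fun x => g t x - gi x) (fun x => g t x - gi x).
have X0 s : 0 <= X s by exact: ip_ge0.
have XN s : 0 <= s <= T -> N s = nu ^+ 2 * X s.
  move=> sT; rewrite /N /X -ipZZ; last by apply: L2B => //; exact: g2.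
  by apply: Rint_ext => x _; rewrite /G; ring.
have Xdec s t' : 0 <= s -> s <= t' -> t' < T -> X t' * (1 + 2 * c * (t' - s)) <= X s.
  move=> s0 st tT; have := velocity_decay s0 st tT.
  rewrite !XN; [|apply/andP; split; lra..].
  by rewrite -[X in X <= _ -> _]mulrA ler_pM2l// exprn_gt0.
apply: (@dini_gronwall R (fun t => X t + ip (q t) (q t)) T
  (2 * (nu * pi ^+ 2 * (1 - r) ^+ 2))).
- rewrite mulr_ge0// mulr_ge0 ?sqr_ge0// mulr_ge0 ?sqr_ge0// ltW//.
- by rewrite addr_ge0 ?ip_ge0.
- move=> t' /[dup] t0T /andP[t0 tT'] e e0.
  have tT : 0 <= t' <= T by apply/andP; split; lra.
  have SE := static_energy (S tT) Si r01 (gr tT) gir.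
  have e20 : 0 < e / 2 by lra.
  have [d d0 H] := position_dini t0T e20.
  have k0 : 0 <= 4 * c ^+ 2 * X t' by rewrite mulr_ge0// mulr_ge0// sqr_ge0.
  pose d' := e / 2 / (4 * c ^+ 2 * X t' + 1).
  have d'0 : 0 < d' by rewrite divr_gt0//; lra.
  exists (Num.min d d'); first by rewrite lt_min d0.
  move=> h; rewrite le_min => /andP[h0 /andP[hd hd']] thT.
  have {}H := H h (ltac:(by rewrite h0)) thT.
  have th : t' <= t' + h by lra.
  have XD := Xdec t' (t' + h) t0 th thT.
  rewrite (_ : t' + h - t' = h) in XD; last by ring.
  have y0 : 0 <= 2 * c * h by rewrite mulr_ge0 ?(ltW h0)// mulr_ge0.
  (* [1 / (1 + y) <= 1 - y + y^2] with [y = 2 c h]; the quadratic term is absorbed by the choice of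
     [d']. *)
  have X1 : X (t' + h) <= X t' * (1 - 2 * c * h + (2 * c * h) ^+ 2).
    have y1 : 0 < 1 + 2 * c * h by lra.
    rewrite -(@ler_pM2r _ (1 + 2 * c * h))//; apply: (le_trans XD).
    have -> : X t' * (1 - 2 * c * h + (2 * c * h) ^+ 2) * (1 + 2 * c * h) =
      X t' + X t' * (2 * c * h) ^+ 3 by ring.
    by rewrite lerDl mulr_ge0// exprn_ge0.
  have X2 : X t' * (2 * c * h) ^+ 2 <= h * (e / 2).
    have -> : X t' * (2 * c * h) ^+ 2 = h * (h * (4 * c ^+ 2 * X t')) by ring.
    rewrite ler_pM2l//; apply: (@le_trans _ _ (d' * (4 * c ^+ 2 * X t' + 1))).
      by apply: ler_pM => //; lra.
    by rewrite /d' divfK// gt_eqF//; lra.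
  have BG : ip (B t') (G t') = - nu * ip (B t') (fun x => g t' x - gi x).
    rewrite -ipZr; last by apply: L2B => //; exact: g2.
      by apply: ip_ext => // x _; rewrite /G; ring.
    exact: qpp_L2 (S tT) Si.
  have SE2 : nu * (pi ^+ 2 * (1 - r) ^+ 2 * (X t' + ip (q t') (q t'))) <=
      nu * ((1 - 3 / 5 * r) ^+ 2 * pi ^+ 2 * X t' + ip (B t') (fun x => g t' x - gi x)).
    by rewrite ler_pM2l.
  rewrite BG in H.
  have SE3 := ler_wpM2l (ltW h0) SE2.
  rewrite /c in X1 X2; lra.
(* No upward jump from the left: the slope part of the energy is nonincreasing and the position part
   is continuous. *)
- move=> t' /andP[t0 tT'] e e0.
  have tT : 0 <= t' <= T by apply/andP; split; lra.
  have e40 : 0 < e / 4 by lra.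
  have [d d0 H] := PC e40; exists d => // s /andP[s0 st] sd.
  have sT : 0 <= s <= T by apply/andP; split; lra.
  have XD := Xdec s t' s0 st tT'.
  have y0 : 0 <= X t' * (2 * c * (t' - s)).
    by rewrite mulr_ge0// mulr_ge0 ?subr_ge0// mulr_ge0.
  suff : ip (q t') (q t') <= ip (q s) (q s) + e by lra.
  have qe : itg mu I01 (fun=> e : R) by apply: itg_cst => //; exact: mu_I01_fin.
  rewrite -[X in _ <= _ + X]Rint_cst01 -RintegralD//; last exact: L2_itgM (q2 sT) (q2 sT).
  apply: le_Rintegral => //.
  + exact: L2_itgM (q2 tT) (q2 tT).
  + by apply: itgD => //; exact: L2_itgM (q2 sT) (q2 sT).
  move=> x /I01P x01; have b1 := q_bd sT x01; have b2 := q_bd tT x01.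
  have ts : `|s - t'| <= d by rewrite ler_norml; apply/andP; split; lra.
  have b3 := H s t' sT tT ts x x01.
  have b4 : (q t' x - q s x) * (q t' x + q s x) <= e / 4 * 4.
    apply: (le_trans (ler_norm _)); rewrite normrM; apply: ler_pM => //.
      by rewrite /q (_ : _ - _ = p t' x - p s x)//; ring.
    by apply: (le_trans (ler_normD _ _)); lra.
  lra.
Qed.

End StageTwo.

(** * Weak derivatives in one variable *)

Section Ramp.
Context {R : realType}.
Implicit Types (a e x y k : R).

Lemma is_derive_quadratic (F : R -> R) x (f K : R) :
  (forall h : R, `|F (x + h) - F x - h * f| <= K * h ^+ 2) -> is_derive x (1 : R) F f.
Proof.
move=> H; have K0 : 0 <= K.
  by have := H 1; rewrite expr1n mulr1; apply: le_trans.
have cv : h^-1 *: ((F \o shift x) (h *: (1 : R)) - F x) @[h --> 0^'] --> f.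
  apply/cvgrPdist_le => e e0; near=> h.
  have h0 : h != 0 by near: h; exact: nbhs_dnbhs_neq.
  have hn : 0 < `|h| by rewrite normr_gt0.
  have he : `|h| <= e / (K + 1).
    near: h; exists (e / (K + 1)); first by rewrite /= divr_gt0//; linarith.
    by move=> y /=; rewrite sub0r normrN => /ltW.
  rewrite /= /GRing.scale/= mulr1 (addrC h x).
  have -> : f - h^-1 * (F (x + h) - F x) = - (h^-1 * (F (x + h) - F x - h * f)) by field.
  rewrite normrN normrM normfV ler_pdivrMl//; apply: (le_trans (H h)).
  rewrite -[h ^+ 2]real_normK ?num_real// expr2 mulrCA ler_pM2l//.
  apply: (@le_trans _ _ ((K + 1) * (e / (K + 1)))); last by rewrite mulrC divfK// gt_eqF//; linarith.
  by apply: ler_pM => //; linarith.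
by split; [exact: cvgP cv|exact: cvg_lim cv].
Unshelve. all: by end_near. Qed.

(** Half the square of the positive part is C^1 with the positive part as derivative; combinations
    of translates yield test functions with piecewise linear derivative. *)
Definition pos2 x := Num.max 0 x ^+ 2 / 2.

Lemma is_derive_pos2 x : is_derive x (1 : R) pos2 (Num.max 0 x).
Proof.
apply: (@is_derive_quadratic _ _ _ (1 / 2)) => h; rewrite /pos2 ler_norml.
by case: (leP 0 x) => x0; case: (leP 0 (x + h)) => xh; apply/andP; split; nra.
Qed.

Lemma continuous_pos : continuous (fun x : R => Num.max 0 x).
Proof. by move=> x; apply: continuous_max; [exact: cvg_cst|exact: cvg_id]. Qed.

(** Continuous approximation of the indicator of [x > a], linear between [a] and [a + e];
    [ramp_prim] is its antiderivative vanishing before [a]. *)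
Definition ramp a e x := (Num.max 0 (x - a) - Num.max 0 (x - a - e)) / e.
Definition ramp_prim a e x := (pos2 (x - a) - pos2 (x - a - e)) / e.

Lemma is_derive_ramp_prim a e x : is_derive x (1 : R) (ramp_prim a e) (ramp a e x).
Proof.
have d1 : is_derive x (1 : R) (fun y => y - a) 1.
  by have := derive_add (derive_id1 x) (derive_cst1 x (- a)); rewrite addr0.
have d2 : is_derive x (1 : R) (fun y => y - a - e) 1.
  by have := derive_add d1 (derive_cst1 x (- e)); rewrite addr0.
have p1 := derive_comp (g := fun y => y - a) (is_derive_pos2 (x - a)) d1; have p2 := derive_comp (g := fun y => y - a - e) (is_derive_pos2 (x - a - e)) d2.
have := derive_scale e^-1 (derive_add p1 (derive_scale (-1) p2)); rewrite !mulr1.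
have -> : (fun y => e^-1 * (pos2 (y - a) + -1 * pos2 (y - a - e))) = ramp_prim a e.
  by apply/funext => y; rewrite /ramp_prim mulrC mulN1r.
by have -> : e^-1 * (Num.max 0 (x - a) + -1 * Num.max 0 (x - a - e)) = ramp a e x
  by rewrite /ramp mulrC mulN1r.
Qed.

Lemma continuous_ramp a e : continuous (ramp a e).
Proof.
have c b : continuous (fun x : R => Num.max 0 (x - b)).
  move=> x; apply: (@continuous_comp _ _ _ (fun y => y - b) (fun y : R => Num.max 0 y)).
    by apply: cvgB; [exact: cvg_id|exact: cvg_cst].
  exact: continuous_pos.
have -> : ramp a e = (fun x => (Num.max 0 (x - a) - Num.max 0 (x - (a + e))) / e).
  by apply/funext => y; rewrite /ramp opprD addrA.
move=> x; apply: cvgM; last exact: cvg_cst.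
by apply: cvgB; exact: c.
Qed.

Lemma ramp_itv a e x : 0 < e -> 0 <= ramp a e x <= 1.
Proof.
move=> e0; rewrite /ramp divr_ge0 ?ler_pdivrMr ?mul1r//= ?(ltW e0)//.
  by case: (leP 0 (x - a)) => ?; case: (leP 0 (x - a - e)) => ?; linarith.
by case: (leP 0 (x - a)) => ?; case: (leP 0 (x - a - e)) => ?; linarith.
Qed.

Lemma ramp0 a e x : 0 < e -> x <= a -> ramp a e x = 0 /\ ramp_prim a e x = 0.
Proof.
move=> e0 xa; rewrite /ramp /ramp_prim /pos2.
have -> : Num.max 0 (x - a) = 0 by apply: max_l; linarith.
have -> : Num.max 0 (x - a - e) = 0 by apply: max_l; linarith.
by rewrite subrr mul0r subrr mul0r.
Qed.

Lemma ramp1 a e x : 0 < e -> a + e <= x -> ramp a e x = 1 /\ ramp_prim a e x = x - a - e / 2.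
Proof.
move=> e0 xa; rewrite /ramp /ramp_prim /pos2.
have -> : Num.max 0 (x - a) = x - a by apply: max_r; linarith.
have -> : Num.max 0 (x - a - e) = x - a - e by apply: max_r; linarith.
by split; field; rewrite gt_eqF.
Qed.

Lemma ramp_cvg a x (e : nat -> R) : (forall n, 0 < e n) -> e n @[n --> \oo] --> 0 ->
  ramp a (e n) x @[n --> \oo] --> (if a < x then 1 else 0 : R).
Proof.
move=> e0 ecv; have [ax|xa] := ltP a x; apply/cvgrPdist_le => z z0.
  have xa0 : 0 < x - a by linarith.
  move/cvgrPdist_le : ecv => /(_ _ xa0) ecv; near=> n.
  have en : `|0 - e n| <= x - a by near: n.
  have aen : a + e n <= x by move: en; rewrite sub0r normrN gtr0_norm//; linarith.
  by rewrite (ramp1 (e0 n) aen).1 subrr normr0 ltW.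
by near=> n; rewrite (ramp0 (e0 n) xa).1 subrr normr0 ltW.
Unshelve. all: by end_near. Qed.

End Ramp.

(** * Functions with vanishing weak derivative *)

Section WeakDerivative.
Context {R : realType}.
Notation mu := (@lebesgue_measure R).
Implicit Types (f g h phi : R -> R).

Lemma itg_sub (D E : set R) f : (R.-ocitv.-measurable).-sigma.-measurable D ->
  (R.-ocitv.-measurable).-sigma.-measurable E -> E `<=` D ->
  (forall x, D x -> ~ E x -> f x = 0) -> itg mu E f ->
  itg mu D f /\ \int[mu]_(x in D) f x = \int[mu]_(x in E) f x.
Proof.
move=> mD mE ED f0 fi.
have Ef : f \_ D = f \_ E.
  apply/funext => x; rewrite !patchE; case: ifPn => xD; case: ifPn => xE //.
    by rewrite f0//; [exact: set_mem|move=> /mem_set; apply/negP].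
  by move: xD; rewrite mem_set//; apply: ED; exact: set_mem.
have EE (A : set R) : (EFin \o f) \_ A = EFin \o (f \_ A).
  by apply/funext => x; rewrite /= !patchE; case: ifP.
split; last by rewrite Rintegral_mkcond Ef -Rintegral_mkcond.
rewrite /itg; apply/(integrable_mkcond _ mD); rewrite EE Ef -EE.
exact/(integrable_mkcond _ mE).
Qed.

Lemma itg_compact f (a b : R) : locally_integrable I01 f -> 0 < a -> b < 1 -> itg mu `[a, b] f.
Proof.
move=> [mf _ fK] a0 b1; have sub : `[a, b] `<=` (I01 : set R).
  by move=> x; rewrite /I01/= !in_itv/= => /andP[ax xb]; apply/andP; split; linarith.
apply/integrableP; split; first by apply/measurable_EFinP; by apply: (measurable_funS _ sub mf); exact: mI01R.
have := fK _ sub (@segment_compact R a b); rewrite /=.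
by under eq_integral do rewrite -abse_EFin.
Qed.

Lemma C1c_outside phi : C1c phi -> exists a b : R, [/\ 0 < a, a <= b, b < 1 &
  forall x, ~ `[a, b]%classic x -> phi x = 0 /\ derive1 phi x = 0].
Proof.
move=> [dphi cphi [a [b [a0 b1 H]]]].
(* The support interval is enlarged to contain 1/2, so that it is nonempty. *)
pose a' := Num.min a (1 / 2); pose b' := Num.max b (1 / 2).
have [la lb] : a' <= a /\ b <= b' by rewrite /a' /b' ge_min le_max !lexx.
have a'h : a' <= 1 / 2 by rewrite /a' ge_min lexx orbT.
have b'h : 1 / 2 <= b' by rewrite /b' le_max lexx orbT.
exists a', b'; split=> //.
- by rewrite /a' lt_min a0/=; linarith.
- linarith.
- by rewrite /b' gt_max b1/=; linarith.
move=> x; rewrite /= in_itv/= => /negP nx.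
have nab (y : R) : ~~ (a' <= y <= b') -> phi y = 0.
  by move=> ny; apply: H; apply: contra ny => /andP[ay yb]; apply/andP; split; linarith.
split; first exact: nab.
rewrite derive1E.
rewrite (@near_eq_derive _ _ _ phi (cst 0) x 1) ?derive_cst//.
have oC : open (~` `[a', b']%classic) by apply: closed_openC; exact: interval_closed.
have : nbhs x (~` `[a', b']%classic).
  by apply: open_nbhs_nbhs; split=> //; rewrite /setC/= in_itv/=; exact/negP.
apply: filterS => y; rewrite /setC/= in_itv/= => /negP ny; exact: nab.
Qed.

Lemma C1c_AC phi : C1c phi -> [/\ AC 0 1 phi (derive1 phi), L2 (derive1 phi), phi 0 = 0,
   phi 1 = 0 & exists M : R, forall x, `|derive1 phi x| <= M].
Proof.
move=> C; have [a [b [a0 ab b1 H]]] := C1c_outside C; have [dphi cphi _] := C.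
have A : AC 0 1 phi (derive1 phi).
  apply: (AC_C1 ler01) => x _; last exact: cphi.
  by split; [exact: dphi|rewrite derive1E].
have [M HM] : exists M : R, forall x, `|derive1 phi x| <= M.
  have [] := @EVT_max R (fun x => `|derive1 phi x|) 0 1 ler01.
    apply: continuous_subspaceT => x; apply: cvg_norm; exact: cphi.
  move=> z _ Hz; exists `|derive1 phi z| => x.
  have [x01|nx] := boolP (x \in `[0, 1]); first exact: Hz.
  have nab : ~ `[a, b]%classic x.
    by move: nx; rewrite /= !in_itv/= => /negP nx /andP[? ?]; apply: nx; apply/andP; split; linarith.
  by have [_ ->] := H x nab; rewrite normr0.
split=> //; last by exists M.
- apply: (L2_bd _ (M := M)) => //; apply: measurable_funTS; exact: continuous_measurable_fun.
- by apply: (H _ _).1; rewrite /= in_itv/=; linarith.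
- by apply: (H _ _).1; rewrite /= in_itv/=; linarith.
Qed.

Lemma AC_weak_deriv F f : AC 0 1 F f -> L2 f -> weak_deriv F f.
Proof.
move=> FA f2; have F2 := AC01_L2 FA; split.
- by apply: open_integrable_locally; [exact: interval_open|exact: L2_itg].
- by apply: open_integrable_locally; [exact: interval_open|exact: L2_itg].
move=> phi /C1c_AC[A d2 p0 p1 _]; have := ip_parts FA A f2 d2.
rewrite p0 p1 !mulr0 subrr (ipC phi) /ip => h; linarith.
Qed.

(* [phi'] is the derivative of a C^1 function with compact support in (0,T). *)
Definition test_deriv (T : R) (phi phi' : R -> R) := [/\
  forall x : R, is_derive x (1 : R) phi (phi' x), continuous phi' &
  exists a b : R, [/\ 0 < a, b < T & forall x, ~~ (a <= x <= b) -> phi x = 0 /\ phi' x = 0]].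

(** The du Bois-Reymond argument. The derivative of a test function has integral 0, so an
    approximate indicator of [[x, y]] is corrected by [r] times one of [[A, B]], the middle third of
    the interval. In the limit of [e n] this compares the integrals of [h] over the two
    intervals. *)
Lemma weak_const (T : R) h : 0 < T -> measurable_fun `]0, T[ h ->
  (forall a b : R, 0 < a -> b < T -> itg mu `[a, b] h) ->
  (forall phi phi', test_deriv T phi phi' -> \int[mu]_(x in `]0, T[) (h x * phi' x) = 0) ->
  exists k : R, forall x y : R, 0 < x -> x <= y -> y < T ->
    \int[mu]_(s in `[x, y]) h s = k * (y - x).
Proof.
move=> T0 mh hi h0; pose A : R := T / 3; pose B : R := 2 * (T / 3).
have A0 : 0 < A by rewrite divr_gt0.
have AB : 3 / T * (B - A) = 1 by rewrite /A /B; field; rewrite gt_eqF.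
have AB0 : A < B by rewrite /B -/A; linarith.
exists (3 / T * \int[mu]_(s in `[A, B]) h s) => x y x0 xy y1.
(* [[a, b]] contains the supports of all the test functions: the widths [e n] are at most [delta],
   so every ramp is complete by [b]. *)
pose delta := (T - Num.max y B) / 2; pose b := Num.max y B + delta; pose a := Num.min x A / 2.
have yB : y <= Num.max y B by rewrite le_max lexx.
have BB : B <= Num.max y B by rewrite le_max lexx orbT.
have m1 : Num.max y B < T by rewrite gt_max y1 /B/=; linarith.
have d0 : 0 < delta by rewrite /delta; linarith.
have b1 : b < T by rewrite /b /delta; linarith.
have a0 : 0 < a by rewrite /a divr_gt0// lt_min x0.
have ax : a <= x by have : Num.min x A <= x by [rewrite ge_min lexx]; rewrite /a; linarith.
have aA : a <= A by have : Num.min x A <= A by [rewrite ge_min lexx orbT]; rewrite /a; linarith.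
pose e n := delta / n.+1%:R.
have e0 n : 0 < e n by rewrite divr_gt0 ?ltr0n.
have ed n : e n <= delta by rewrite ler_pdivrMr ?ltr0n// ler_peMr ?ler1n// ltW.
have ecv : e n @[n --> \oo] --> (0 : R).
  by rewrite -(mulr0 delta); apply: cvgM; [exact: cvg_cst|exact: cvg_harmonic].
pose r := 3 / T * (y - x).
pose psi n z := ramp x (e n) z - ramp y (e n) z - r * (ramp A (e n) z - ramp B (e n) z).
pose Psi n z := ramp_prim x (e n) z - ramp_prim y (e n) z -
  r * (ramp_prim A (e n) z - ramp_prim B (e n) z).
have dPsi n z : is_derive z (1 : R) (Psi n) (psi n z).
  have D c := is_derive_ramp_prim c (e n) z.
  have D1 := derive_add (D x) (derive_scale (-1) (D y)); have D2 := derive_add (D A) (derive_scale (-1) (D B)).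
  have := derive_add D1 (derive_scale (- r) D2).
  rewrite (_ : (fun _ => _) = Psi n); last by apply/funext => w; rewrite /Psi; ring.
  by rewrite (_ : _ + _ = psi n z)// /psi; ring.
have out n z : ~~ (a <= z <= b) -> Psi n z = 0 /\ psi n z = 0.
  rewrite negb_and -!ltNge => /orP[za|bz].
    rewrite /Psi /psi; have zx : z <= x by linarith.
    have zy : z <= y by linarith.
    have zA : z <= A by linarith.
    have zB : z <= B by linarith.
    have [-> ->] := ramp0 (e0 n) zx; have [-> ->] := ramp0 (e0 n) zy.
    have [-> ->] := ramp0 (e0 n) zA; have [-> ->] := ramp0 (e0 n) zB.
    by split; ring.
  have edn := ed n; rewrite /b in bz; rewrite /Psi /psi.
  have zx : x + e n <= z by linarith.
  have zy : y + e n <= z by linarith.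
  have zB : B + e n <= z by linarith.
  have zA : A + e n <= z by linarith.
  have [-> ->] := ramp1 (e0 n) zx; have [-> ->] := ramp1 (e0 n) zy.
  have [-> ->] := ramp1 (e0 n) zA; have [-> ->] := ramp1 (e0 n) zB.
  split; last by ring.
  rewrite (_ : _ - r * _ = (y - x) * (1 - 3 / T * (B - A))); last by rewrite /r; ring.
  by rewrite AB subrr mulr0.
have cpsi n : continuous (psi n).
  by move=> z; apply: cvgB; [apply: cvgB|apply: cvgM; [exact: cvg_cst|apply: cvgB]];
    exact: continuous_ramp.
have CP n : test_deriv T (Psi n) (psi n).
  by split; [exact: dPsi|exact: cpsi|exists a, b; split=> // z; exact: out].
have sub : `[a, b]%classic `<=` (`]0, T[%classic : set R).
  by move=> z; rewrite /= !in_itv/= => /andP[? ?]; apply/andP; split; linarith.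
have hab := hi a b a0 b1; have mab : (R.-ocitv.-measurable).-sigma.-measurable (`[a, b]%classic : set R) by exact: measurable_itv.
have I0 n : \int[mu]_(z in `[a, b]) (h z * psi n z) = 0.
  rewrite -(h0 _ _ (CP n)) [in RHS]Rintegral_mkcond [in LHS]Rintegral_mkcond.
  apply: Rint_ext => z _; rewrite !patchE; case: ifPn => [/set_mem zab|zab].
    by rewrite mem_set//; exact: sub.
  have zn : ~~ (a <= z <= b).
    by apply/negP => h'; move/negP : zab; apply; apply/mem_set; rewrite /= in_itv.
  by case: ifPn => // _; have [_ ->] := out n z zn; rewrite mulr0.
pose i (c z : R) : R := if c < z then 1 else 0.
pose l z : R := (i x z - i y z) - r * (i A z - i B z).
have lcv z : psi n z @[n --> \oo] --> l z.
  by apply: cvgB; [apply: cvgB|apply: cvgM; [exact: cvg_cst|apply: cvgB]]; exact: ramp_cvg.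
have r0 : 0 <= r by rewrite /r mulr_ge0 ?subr_ge0// divr_ge0// ltW.
have mi c : measurable_fun `[a, b] (i c).
  have -> : i c = \1_(`]c, +oo[%classic : set R).
    by apply/funext => z; rewrite indicE /i mem_setE in_itv/= andbT; case: ltP.
  exact: measurable_indic.
have ml : measurable_fun `[a, b] l.
  by apply: measurable_funB; [|apply: measurable_funM => //]; apply: measurable_funB.
have mpsi n : measurable_fun `[a, b] (psi n).
  by apply: measurable_funTS; exact: continuous_measurable_fun.
have [li Icv] : itg mu `[a, b] (fun z => h z * l z) /\
   \int[mu]_(z in `[a, b]) (h z * psi n z) @[n --> \oo] --> \int[mu]_(z in `[a, b]) (h z * l z).
  apply: (@Rint_dct _ _ R mu `[a, b]%classic (fun n z => h z * psi n z)
    (fun z => h z * l z) (fun z => (1 + r) * `|h z|)) => //.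
  - by move=> n; apply: measurable_funM; [exact: itg_meas hab|exact: mpsi].
  - by apply: measurable_funM; [exact: itg_meas hab|exact: ml].
  - by apply: itgZ => //; exact: itg_norm.
  - by apply: aeW => z _; apply: cvgM; [exact: cvg_cst|exact: lcv].
  move=> n; apply: aeW => z _; rewrite normrM mulrC ler_wpM2r//.
  have /andP[u1 v1] := ramp_itv x z (e0 n); have /andP[u2 v2] := ramp_itv y z (e0 n).
  have /andP[u3 v3] := ramp_itv A z (e0 n); have /andP[u4 v4] := ramp_itv B z (e0 n).
  rewrite /psi; apply: (le_trans (ler_normB _ _)); apply: lerD.
    by rewrite ler_norml; clear -u1 v1 u2 v2; apply/andP; split; lra.
  rewrite normrM (ger0_norm r0) -[leRHS]mulr1 ler_wpM2l//.
  by rewrite ler_norml; clear -u3 v3 u4 v4; apply/andP; split; lra.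
have L0 : \int[mu]_(z in `[a, b]) (h z * l z) = 0.
  apply: (cvg_unique _ Icv); first exact: Rhausdorff.
  by rewrite (_ : (fun n => _) = (fun=> 0)); [exact: cvg_cst|apply/funext => n; exact: I0].
have split_ c : a <= c -> c <= b ->
    itg mu `[a, b] (fun z => h z * i c z) /\
    \int[mu]_(z in `[a, b]) (h z * i c z) = \int[mu]_(z in `[a, b]) h z - \int[mu]_(z in `[a, c]) h z.
  move=> ac cb; rewrite (Rint_cc_sub ac cb hab).
  have hcb : itg mu `[c, b] h by exact: itg_cc hab.
  have hoc : itg mu `]c, b] h.
    by apply: itgS hcb => // z; rewrite /= !in_itv/= => /andP[cz ->]; rewrite ltW.
  have hi1 : itg mu `]c, b] (fun z => h z * i c z).
    apply: itg_ext hoc => // z; rewrite /= in_itv/= => /andP[cz _].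
    by rewrite /i cz mulr1.
  have socb : `]c, b]%classic `<=` `[a, b]%classic.
    by move=> z; rewrite /= !in_itv/= => /andP[cz ->]; rewrite (le_trans ac (ltW cz)).
  have out_ z : `[a, b]%classic z -> ~ `]c, b]%classic z -> h z * i c z = 0.
    rewrite /= !in_itv/= => /andP[_ zb] nz; rewrite /i; case: ltP => cz; last by rewrite mulr0.
    by exfalso; apply: nz; rewrite cz.
  have [u v] := itg_sub mab (measurable_itv _) socb out_ hi1; split=> //.
  rewrite v -Rintegral_itv_obnd_cbnd; last exact: hoc.
  by apply: Rint_ext => z; rewrite /= in_itv/= => /andP[cz _]; rewrite /i cz mulr1.
have [xb yb Bb] : [/\ x <= b, y <= b & B <= b] by rewrite /b; split; linarith.
have [ay aB] : a <= y /\ a <= B by split; linarith.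
have Ab : A <= b by linarith.
have [x1 x2] := split_ x ax xb; have [y1' y2] := split_ y ay yb.
have [A1 A2] := split_ A aA Ab; have [B1 B2] := split_ B aB Bb.
have LE : \int[mu]_(z in `[a, b]) (h z * l z) =
  \int[mu]_(z in `[a, b]) (h z * i x z) - \int[mu]_(z in `[a, b]) (h z * i y z) -
  r * (\int[mu]_(z in `[a, b]) (h z * i A z) - \int[mu]_(z in `[a, b]) (h z * i B z)).
  rewrite -!RintegralB// -RintegralZl//; last exact: itgB.
  rewrite -RintegralB//; [|exact: itgB|by apply: itgZ => //; exact: itgB].
  by apply: Rint_ext => z _; rewrite /l; ring.
have C1 := Rint_cc_sub ax xy (itg_cc (lexx a) yb hab).
have AB' := ltW AB0.
have C2 := Rint_cc_sub aA AB' (itg_cc (lexx a) Bb hab).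
rewrite LE x2 y2 A2 B2 in L0; rewrite -C1 -C2 /r in L0 *; clear -L0; lra.
Unshelve. all: by end_near. Qed.

(** Integrability holds on compact subintervals only, so Lebesgue points are taken on the intervals
    from [1/(n+1)] to [T - 1/(n+1)] for all [n] at once. *)
Lemma weak_const_ae (T : R) h : 0 < T -> measurable_fun `]0, T[ h ->
  (forall a b : R, 0 < a -> b < T -> itg mu `[a, b] h) ->
  (forall phi phi', test_deriv T phi phi' -> \int[mu]_(x in `]0, T[) (h x * phi' x) = 0) ->
  exists k : R, {ae mu, forall x, 0 < x < T -> h x = k}.
Proof.
move=> T0 mh hi h0; have [k Hk] := weak_const T0 mh hi h0; exists k.
pose a n : R := n.+1%:R^-1.
have a0 n : 0 < a n by rewrite invr_gt0 ltr0n.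
have D : {ae mu, forall t, forall n, a n < t < T - a n -> forall eps : R, 0 < eps ->
    exists2 d : R, 0 < d & forall r : R, 0 < r <= d ->
      `|\int[mu]_(s in `[t, t + r]) h s - r * h t| <= eps * r}.
  by apply: ae_all => n; apply: ae_rderiv; apply: hi => //; have := a0 n; linarith.
apply: ae_imply D _ => t H /andP[t0 t1].
have [n [tn1 tn2]] : exists n, a n < t /\ a n < T - t.
  have m0 : 0 < Num.min t (T - t) by rewrite lt_min t0 subr_gt0.
  exists (Num.truncn (Num.min t (T - t))^-1); apply/andP; rewrite -lt_min.
  rewrite -[ltRHS]invrK ltf_pV2 ?posrE ?invr_gt0//.
  exact: truncnS_gt.
apply/eqP; rewrite -subr_eq0 -normr_le0; apply/ler_addgt0Pr => e e0; rewrite add0r.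
have tn : a n < t < T - a n by apply/andP; split; linarith.
have [d d0 Hd] := H n tn e e0.
pose r := Num.min d ((T - t) / 2).
have r0 : 0 < r by rewrite lt_min d0 divr_gt0// subr_gt0.
have rd : r <= d by rewrite ge_min lexx.
have rt : r <= (T - t) / 2 by rewrite ge_min lexx orbT.
have := Hd r; rewrite r0 rd => /(_ isT); rewrite Hk//; [|linarith|linarith].
rewrite (_ : k * (t + r - t) - r * h t = - (r * (h t - k))); last by ring.
by rewrite normrN normrM gtr0_norm// mulrC ler_pM2r.
Qed.

(** [f] minus a primitive of [g] is orthogonal to the derivatives of all test functions. *)
Lemma weak_deriv_AC f g : weak_deriv f g -> L2 g ->
  exists c : R, {ae mu, forall x, I01 x -> f x = c + primitive g x}.
Proof.
move=> [fl gl W] g2; have gA := AC_prim0 (L2_itg g2); have P2 := AC01_L2 gA.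
have mf : measurable_fun I01 f by case: fl.
have mP : measurable_fun I01 (primitive g) by exact: P2.1.
have hi (a b : R) : 0 < a -> b < 1 -> itg mu `[a, b] f by exact: itg_compact.
have [||||k Hk] := @weak_const_ae 1 (fun x => f x - primitive g x); first exact: ltr01.
- exact: measurable_funB.
- move=> a b a0 b1; apply: itgB => //; first exact: hi.
  have [ab|ba] := leP a b; last first.
    rewrite (_ : `[a, b]%classic = set0); first exact: integrable_set0.
    by apply/seteqP; split=> x //=; rewrite in_itv/= => /andP[? ?]; linarith.
  by apply: itg_cc (itg_cc01 (L2_itg P2)); linarith.
- move=> phi phi' TD; have [dphi cphi' [a0' [b0' [pa pb out']]]] := TD.
  have E : derive1 phi = phi' by apply/funext => z; rewrite derive1E; case: (dphi z).
  have C : C1c phi.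
    split; [by move=> z; case: (dphi z)|by rewrite E|].
    by exists a0', b0'; split=> // z /out'[].
  have [A d2 p0 p1 [M HM]] := C1c_AC C; rewrite -E.
  have [a [b [a0 ab b1 out]]] := C1c_outside C.
  have sub : `[a, b] `<=` (I01 : set R).
    by move=> z; rewrite /I01/= !in_itv/= => /andP[? ?]; apply/andP; split; linarith.
  have mab : (R.-ocitv.-measurable).-sigma.-measurable (`[a, b]%classic : set R) by exact: measurable_itv.
  have fd : itg mu `[a, b] (fun x => f x * derive1 phi x).
    have md : measurable_fun `[a, b] (derive1 phi).
      by apply: (measurable_funS _ sub d2.1); exact: mI01R.
    have := itg_mulbd mab (hi a b a0 b1) md (fun x _ => HM x).
    by apply: itg_ext => // x _; rewrite mulrC.
  have [fI _] := itg_sub mI01 mab sub (fun x _ nx => (ltac:(rewrite (out x nx).2 mulr0//) : f x * derive1 phi x = 0)) fd.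
  under eq_Rintegral do rewrite mulrBl.
  rewrite RintegralB//; last exact: L2_itgM.
  rewrite W//; have := ip_parts gA A g2 d2; rewrite p0 p1 !mulr0 subrr (ipC phi) /ip.
  move=> E'; suff -> : \int[mu]_(x in `]0, 1[%classic) (primitive g x * derive1 phi x) =
      - \int[mu]_(x in I01) (g x * phi x) by rewrite subrr.
  by apply/eqP; rewrite -addr_eq0; apply/eqP; exact: E'.
exists k; apply: ae_imply Hk _ => x H; rewrite /I01/= in_itv/= => /H; linarith.
Qed.

End WeakDerivative.

(** * States from functions with weak derivatives *)

Section ReciprocalState.
Context {R : realType}.
Notation mu := (@lebesgue_measure R).
Implicit Types (f g h u p : R -> R).

(** Gronwall's uniqueness argument: on an interval that contains a zero and over which [m] has
    integral at most 1/2, the maximum of [|z|] is at most half of itself. Intervals of one fixed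
    length [del] propagate the zero over [0, 1]. *)
Lemma AC_linear_zero (z d m : R -> R) (x0 : R) : AC 0 1 z d -> itg mu `[0, 1] m ->
  (forall x, 0 <= m x) ->
  {ae mu, forall x, I01 x -> `|d x| <= m x * `|z x|} -> 0 <= x0 <= 1 -> z x0 = 0 ->
  forall x : R, 0 <= x <= 1 -> z x = 0.
Proof.
move=> zA mi m0 dm x001 z0.
have KA := AC_int 0 mi; set K := (fun x => 0 + _) in KA.
have [del del0 Hdel] := AC_uc KA (ltac:(linarith) : 0 < (1/2 : R)).
have dm' : {ae mu, forall x, `[0, 1]%classic x -> `|d x| <= m x * `|z x|}.
  apply: ae_itv; apply: ae_imply dm _ => x H x01; apply: H; by rewrite /I01/= in_itv.
have loc (x y : R) : 0 <= x <= 1 -> 0 <= y <= 1 -> `|y - x| <= del -> z x = 0 -> z y = 0.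
  move=> x01 y01 xy zx.
  pose a := Num.min x y; pose b := Num.max x y.
  have ab : a <= b by rewrite /a /b ge_min !le_max lexx.
  have abP : [/\ 0 <= a, b <= 1, b - a <= del, a <= x <= b & a <= y <= b].
    have /andP[x0' x1] := x01; have /andP[y0 y1] := y01; move: xy; rewrite /a /b.
    case: (leP x y) => xy'.
      by rewrite ger0_norm ?subr_ge0// => h; split=> //; rewrite ?lexx ?xy'.
    by rewrite distrC gtr0_norm ?subr_gt0// => h; split=> //; rewrite ?lexx ltW.
  have [a0 b1 bad xab yab] := abP.
  have cz : {within `[a, b], continuous (fun x => `|z x|)}.
    have := AC_cont ab (AC_restrict zA a0 ab b1) => c t.
    by apply: (continuous_comp (c t)); exact: norm_continuous.
  have [w] := EVT_max ab cz; rewrite in_itv/= => wab Hw.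
  have step (u v : R) : a <= u -> u <= v -> v <= b -> `|z v - z u| <= `|z w| / 2.
    move=> au uv vb; have u0 : 0 <= u by linarith.
    have v1 : v <= 1 by linarith.
    have uva : `[u, v]%classic `<=` `[0, 1]%classic by exact: subset_ccP.
    rewrite (AC_sub zA u0 uv v1).
    have miuv : itg mu `[u, v] m by exact: itg_cc mi.
    have wi : itg mu `[u, v] (fun x => `|z w| * m x) by apply: itgZ.
    have i1 : `|\int[mu]_(s in `[u, v]) d s| <= \int[mu]_(s in `[u, v]) (`|z w| * m s).
      apply: le_normr_Rint => //; first by apply: itg_cc zA.1.
      apply: ae_imply dm' _ => s H suv; apply: (le_trans (H (uva _ suv))).
      have sab : s \in `[a, b].
        by move: suv; rewrite /= !in_itv/= => /andP[? ?]; apply/andP; split; linarith.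
      have zs := Hw s sab; rewrite mulrC.
      exact: ler_wpM2r.
    apply: (le_trans i1); rewrite RintegralZl// ler_wpM2l//.
    rewrite -(AC_sub KA u0 uv v1); apply: (le_trans (ler_norm _)); rewrite -[leRHS]mul1r.
    apply: Hdel => //; linarith.
  have /andP[xa xb] := xab; have /andP[wa wb] := wab.
  have M0 : `|z w| <= `|z w| / 2.
    have [xw|wx] := leP x w; first by have := step x w xa xw wb; rewrite zx subr0.
    by have := step w x wa (ltW wx) xb; rewrite zx sub0r normrN.
  have zy := Hw y (ltac:(by rewrite in_itv)).
  have := normr_ge0 (z y) => zy0; apply/eqP; rewrite -normr_eq0; apply/eqP; linarith.
have glob n : forall x, 0 <= x <= 1 -> `|x - x0| <= n%:R * del -> z x = 0.
  elim: n => [|n IH] x x01.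
    by rewrite mul0r normr_le0 subr_eq0 => /eqP ->.
  (* The point at the fraction [n / (n + 1)] of the way from [x0] to [x] is within [n * del] of [x0]
     and within [del] of [x]. *)
  move=> xd; pose y := x0 + (x - x0) * (n%:R / n.+1%:R).
  have n1 : (0 : R) < n.+1%:R by rewrite ltr0n.
  have q01 : 0 <= (n%:R / n.+1%:R : R) <= 1.
    by rewrite divr_ge0//= ler_pdivrMr// mul1r ler_nat.
  have y01 : 0 <= y <= 1.
    rewrite /y; move: (n%:R / n.+1%:R) q01 => q /andP[q0 q1].
    have /andP[x0' x1] := x01; have /andP[y0 y1] := x001.
    have h1 : 0 <= x0 * (1 - q) by apply: mulr_ge0 => //; linarith.
    have h2 : 0 <= x * q by exact: mulr_ge0.
    have h3 : 0 <= (1 - x0) * (1 - q) by apply: mulr_ge0; linarith.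
    have h4 : 0 <= (1 - x) * q by apply: mulr_ge0 => //; linarith.
    by apply/andP; split; linarith.
  have yx0 : `|y - x0| <= n%:R * del.
    have -> : y - x0 = (x - x0) * (n%:R / n.+1%:R) by rewrite /y; ring.
    rewrite normrM [X in _ * X]ger0_norm; last by case/andP: q01.
    by rewrite mulrA ler_pdivrMr// mulrC -mulrA ler_wpM2l// (mulrC del).
  apply: (loc y x y01 x01); last exact: IH.
  have -> : x - y = (x - x0) / n.+1%:R by rewrite /y -natr1; field; rewrite natr1 gt_eqF.
  by rewrite normrM normfV (gtr0_norm n1) ler_pdivrMr// mulrC.
move=> x x01; apply: (glob (Num.truncn (`|x - x0| / del)).+1 x x01).
by rewrite -ler_pdivrMr// ltW// truncnS_gt.
Qed.

Lemma AC_ae_le (F G f g : R -> R) : AC 0 1 F f -> AC 0 1 G g ->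
  {ae mu, forall x, I01 x -> F x <= G x} -> forall x : R, 0 <= x <= 1 -> F x <= G x.
Proof.
move=> FA GA FG x x01; apply/ler_addgt0Pr => e e0; have e20 : 0 < e / 2 by linarith.
have [d1 d10 H1] := AC_uc_sym FA e20; have [d2 d20 H2] := AC_uc_sym GA e20.
pose d := Num.min (Num.min d1 d2) (1 / 2).
have d0 : 0 < d by rewrite !lt_min d10 d20/=; linarith.
have dd1 : d <= d1 by rewrite !ge_min lexx.
have dd2 : d <= d2 by rewrite !ge_min lexx orbT.
have dh : d <= 1 / 2 by rewrite !ge_min lexx !orbT.
have [a [b [ab a0 b1 xab]]] : exists a b : R, [/\ a < b, 0 <= a, b <= 1 &
    forall y, a < y < b -> `|y - x| <= d].
  have [xh|xh] := leP x (1 / 2).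
    exists x, (x + d); split; [linarith|linarith|linarith|].
    by move=> y /andP[? ?]; rewrite ler_norml; apply/andP; split; linarith.
  exists (x - d), x; split; [linarith|linarith|linarith|].
  by move=> y /andP[? ?]; rewrite ler_norml; apply/andP; split; linarith.
have [y FGy yab] := ae_exists ab FG; have yx := xab y yab.
have yI : I01 y by rewrite /I01/= in_itv/=; have /andP[? ?] := yab; apply/andP; split; linarith.
have b1' := H1 x y x01 (I01P yI) (le_trans yx dd1).
have b2' := H2 x y x01 (I01P yI) (le_trans yx dd2).
have := FGy yI; move: b1' b2'; rewrite !ler_norml => /andP[? ?] /andP[? ?] ?; linarith.
Qed.

Lemma AC_ae_eq (F G f g : R -> R) : AC 0 1 F f -> AC 0 1 G g ->
  {ae mu, forall x, I01 x -> F x = G x} -> forall x : R, 0 <= x <= 1 -> F x = G x.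
Proof.
move=> FA GA FG x x01; apply/eqP; rewrite eq_le; apply/andP; split.
  by apply: AC_ae_le FA GA _ _ x01; apply: ae_imply FG _ => y H /H->.
by apply: AC_ae_le GA FA _ _ x01; apply: ae_imply FG _ => y H /H->.
Qed.

Lemma weak_deriv_unique f g g' : weak_deriv f g -> weak_deriv f g' -> L2 g -> L2 g' ->
  {ae mu, forall x, I01 x -> g x = g' x}.
Proof.
move=> W W' g2 g'2; have [c Hc] := weak_deriv_AC W g2; have [c' Hc'] := weak_deriv_AC W' g'2.
have H : {ae mu, forall x, I01 x -> c + primitive g x = c' + primitive g' x}.
  by apply: ae_imply2 Hc Hc' _ => x h1 h2 Ix; rewrite -h1// -h2.
have E := AC_ae_eq (AC_prim c (L2_itg g2)) (AC_prim c' (L2_itg g'2)) H.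
have z01 : 0 <= (0 : R) <= 1 by rewrite lexx ler01.
have E0 := E 0 z01; rewrite !primitive0 !addr0 in E0.
apply: ae_of_primitive => // x x01; have := E x x01; rewrite E0; exact: addrI.
Qed.

(** The continuous version [U] of [u] might vanish somewhere, so the reciprocal is built first: [P]
    is the primitive of [k = - u^-2 u_x] that equals [1/U] at one point. Then [z = U P - 1]
    satisfies [z' = - u k z], hence vanishes identically, and [U] has no zero. *)
Lemma state_of_weak (u ux : R -> R) : weak_deriv u ux -> L2 ux ->
  {ae mu, forall x, I01 x -> 0 < u x} ->
  L2 (fun x => - ((u x) ^- 2 * ux x)) -> \int[mu]_(x in I01) u x = 1 ->
  exists2 p : R -> R, state p (fun x => - ((u x) ^- 2 * ux x)) &
    {ae mu, forall x, I01 x -> (p x)^-1 = u x}.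
Proof.
move=> W ux2 u0 k2 u1; set k := (fun x => _) in k2 *.
have [c Hc] := weak_deriv_AC W ux2.
have UA := AC_prim c (L2_itg ux2); set U := (fun x => c + _) in UA Hc.
have U0 x : 0 <= x <= 1 -> 0 <= U x.
  apply: (AC_ae_le (AC_cst 0 1 0) UA); apply: ae_imply2 Hc u0 _ => y h1 h2 Iy.
  by rewrite /U -h1// ltW// h2.
have [x0 [Ix0 Ux0]] : exists x, I01 x /\ 0 < U x.
  have [x H x01] := ae_exists ltr01 (ae_imply2 Hc u0 (fun x a b => conj a b)).
  have Ix : I01 x by rewrite /I01/= in_itv.
  by exists x; split=> //; case: H => h1 h2; rewrite /U -(h1 Ix); exact: h2.
pose P x := ((U x0)^-1 - primitive k x0) + primitive k x.
have PA : AC 0 1 P k := AC_prim _ (L2_itg k2).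
have UPA := AC_mul ler01 UA PA.
have ZA := AC_B UPA (AC_cst 0 1 1).
have U2 := AC01_L2 UA.
have mi : itg mu `[0, 1] (fun x => `|U x * k x|).
  by apply: itg_norm => //; apply: itg_cc01; exact: L2_itgM.
have z0 : U x0 * P x0 - 1 = 0 by rewrite /P subrK divff ?subrr// gt_eqF.
have := AC_linear_zero ZA mi (fun x => normr_ge0 _) _ (I01P Ix0) z0.
have dz : {ae mu, forall x, I01 x -> `|U x * k x + P x * ux x - 0| <=
    `|U x * k x| * `|U x * P x - 1|}.
  apply: ae_imply2 Hc u0 _ => x h1 h2 Ix; rewrite subr0.
  have ux' : U x = u x := esym (h1 Ix); have up := h2 Ix; rewrite ux'.
  have -> : u x * k x + P x * ux x = - (u x * k x * (u x * P x - 1)).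
    by rewrite /k; field; rewrite gt_eqF.
  by rewrite normrN normrM.
move=> /(_ dz) Z.
have UP x : 0 <= x <= 1 -> P x = (U x)^-1 /\ 0 < U x.
  move=> x01; have Zx := Z x x01; have UPx : U x * P x = 1 by linarith.
  have Un : U x != 0 by apply/eqP => h; move: UPx; rewrite h mul0r => /eqP; rewrite eq_sym oner_eq0.
  split; last by rewrite lt_neqAle eq_sym Un U0.
  by apply: (mulfI Un); rewrite UPx divff.
exists P; last first.
  by apply: ae_imply Hc _ => x h Ix; have [-> _] := UP x (I01P Ix); rewrite invrK h.
split=> //.
  by move=> x x01; have [-> h] := UP x x01; rewrite invr_gt0.
rewrite -u1; apply/esym; apply: Rint_ae_eq => //.
- by case: W => [[]].
- apply: (@measurable_ext _ _ _ _ U); last exact: AC01_meas UA.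
  by move=> x Ix; have [-> _] := UP x (I01P Ix); rewrite invrK.
- by apply: ae_imply Hc _ => x h Ix; have [-> _] := UP x (I01P Ix); rewrite invrK h.
Qed.

(* Both the function and its reciprocal have a weak derivative, so their
   continuous representatives multiply to 1 and neither vanishes. *)
Lemma state_of_reciprocal (u ux k : R -> R) : weak_deriv u ux -> L2 ux ->
  weak_deriv (fun x => (u x)^-1) k -> L2 k ->
  {ae mu, forall x, I01 x -> 0 < u x} -> \int[mu]_(x in I01) u x = 1 ->
  exists2 p : R -> R, state p k & {ae mu, forall x, I01 x -> (p x)^-1 = u x}.
Proof.
move=> W ux2 W' k2 u0 u1.
have [c Hc] := weak_deriv_AC W ux2; have [c' Hc'] := weak_deriv_AC W' k2.
have UA := AC_prim c (L2_itg ux2); set U := (fun x => c + _) in UA Hc.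
have PA := AC_prim c' (L2_itg k2); set P := (fun x => c' + _) in PA Hc'.
have H : {ae mu, forall x, I01 x -> [/\ u x = U x, (u x)^-1 = P x & 0 < u x]}.
  by apply: ae_imply2 (ae_imply2 Hc Hc' (fun _ a b => conj a b)) u0 _ => x [h1 h2] h3 Ix; split; auto.
have UP1 : forall x, 0 <= x <= 1 -> U x * P x = 1.
  apply: (AC_ae_eq (AC_mul ler01 UA PA) (AC_cst 0 1 1)).
  by apply: ae_imply H _ => x h /h[<- <- h0]; rewrite divff// gt_eqF.
have P0 : forall x, 0 <= x <= 1 -> 0 <= P x.
  apply: (AC_ae_le (AC_cst 0 1 0) PA).
  by apply: ae_imply H _ => x h /h[_ <- h0]; rewrite invr_ge0 ltW.
have UP x : 0 <= x <= 1 -> (P x)^-1 = U x /\ 0 < P x.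
  move=> x01; have UPx := UP1 x x01.
  have Pn : P x != 0 by apply/eqP => h; move: UPx; rewrite h mulr0 => /eqP; rewrite eq_sym oner_eq0.
  split; last by rewrite lt_neqAle eq_sym Pn P0.
  by apply: (mulIf Pn); rewrite UPx mulVf.
exists P; last by apply: ae_imply H _ => x h /[dup]/h[-> _ _] /I01P/UP[].
split=> //; first by move=> x /UP[].
rewrite -u1; apply/esym; apply: Rint_ae_eq => //.
- by case: W => [[]].
- apply: (@measurable_ext _ _ _ _ U); last exact: AC01_meas UA.
  by move=> x Ix; have [-> _] := UP x (I01P Ix).
- by apply: ae_imply H _ => x h /[dup]/h[-> _ _] /I01P/UP[].
Qed.

End ReciprocalState.

(** * From the weak formulation to the flow *)

Section Fubini.
Context {R : realType}.
Notation mu := (@lebesgue_measure R).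
Implicit Types (H : R * R -> R) (w : R -> R -> R).

(** The inner integrals in Fubini's theorem may be infinite on a null set; [fine] sends them to 0
    there without changing the outer integral. *)
Lemma fine_integrable (g : R -> \bar R) : mu.-integrable setT g ->
  itg mu setT (fine \o g) /\ \int[mu]_t (fine \o g) t = fine (\int[mu]_t g t)%E.
Proof.
move=> gi; have mg := measurable_int mu gi.
have mf : measurable_fun setT (fine \o g) by apply: measurableT_comp mg; exact: fine_measurable.
have fi : itg mu setT (fine \o g).
  apply: (le_integrable measurableT _ _ gi); first exact/measurable_EFinP.
  by move=> t _ /=; case: (g t) => [r| |] /=; rewrite ?normr0 ?leey.
split=> //; rewrite /Rintegral; congr fine; apply: ae_eq_integral => //.
  exact/measurable_EFinP.
by have := integrable_ae measurableT gi; apply: filterS => t H tT /=; rewrite fineK//; exact: H.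
Qed.

Let integrable_G (f : R * R -> \bar R) : (@leb2 R).-integrable setT f ->
  mu.-integrable setT (fubini_G mu f).
Proof.
move=> fi; have mf := measurable_int _ fi.
have maf : measurable_fun setT (abse \o f) by exact: measurableT_comp.
apply/integrableP; split; first exact: measurable_fubini_G fi.
apply: le_lt_trans ((integrable21ltyP _ _ mf).1 fi).
apply: ge0_le_integral => //.
- by apply: measurableT_comp => //; exact: measurable_fubini_G fi.
- exact: (@measurable_fun_fubini_tonelli_G _ _ _ _ R mu (abse \o f) maf (fun z => abse_ge0 _)).
- move=> t _; apply: le_abse_integral => //.
  exact: measurableT_comp.
Qed.

Lemma real_fubini H : (@leb2 R).-integrable setT (EFin \o H) ->
  [/\ {ae mu, forall t, itg mu setT (fun x => H (x, t))},
      itg mu setT (fun t => \int[mu]_x H (x, t)) &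
      \int[leb2]_z H z = \int[mu]_t (\int[mu]_x H (x, t))].
Proof.
move=> Hi; split; first exact: ae_integrable2 Hi.
  by have [h _] := fine_integrable (integrable_G Hi).
have [_ E] := fine_integrable (integrable_G Hi).
by rewrite [RHS]E /Rintegral -(integral21_prod_meas1 Hi).
Qed.

Lemma real_fubini' H : (@leb2 R).-integrable setT (EFin \o H) ->
  [/\ {ae mu, forall x, itg mu setT (fun t => H (x, t))},
      itg mu setT (fun x => \int[mu]_t H (x, t)) &
      \int[leb2]_z H z = \int[mu]_x (\int[mu]_t H (x, t))].
Proof.
move=> Hi; split; first exact: ae_integrable1 Hi.
  by have [h _] := fine_integrable (integrable_fubini_F Hi).
have [_ E] := fine_integrable (integrable_fubini_F Hi).
by rewrite [RHS]E /Rintegral -(integral12_prod_meas1 Hi).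
Qed.

Definition L1Q (T : R) w := (@leb2 R).-integrable (Q T%:E) (fun z => (w z.1 z.2)%:E).

Lemma QE (T : R) : Q T%:E = I01 `*` `]0, T[%classic.
Proof.
apply/seteqP; split=> -[x t]; rewrite /Q /I01/= !in_itv/= lte_fin.
  by move=> [-> -> ->].
by move=> [-> /andP[-> ->]].
Qed.

Lemma mQ (T : R) : measurable (Q T%:E : set (measurableTypeR R * measurableTypeR R)).
Proof. by rewrite QE; apply: measurableX => //; exact: mI01. Qed.

Lemma Q_mem (T x t : R) : ((x, t) \in Q T%:E) = (x \in I01) && (0 < t < T).
Proof.
rewrite QE; apply/idP/idP => [/set_mem[/= h1 h2]|/andP[h1 h2]].
  by rewrite mem_set//=; move: h2; rewrite /= in_itv.
by apply/mem_set; split=> /=; [exact: set_mem|rewrite in_itv].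
Qed.

Lemma L1Q_patch (T : R) w : L1Q T w ->
  (@leb2 R).-integrable setT (EFin \o ((fun z => w z.1 z.2) \_ (Q T%:E))).
Proof.
move=> wi; have := (integrable_mkcond _ (mQ T)).1 wi.
rewrite (_ : _ \_ _ = EFin \o ((fun z => w z.1 z.2) \_ (Q T%:E)))//.
by apply/funext => z; rewrite /= !patchE; case: ifP.
Qed.

Let secx (T t : R) w : (fun x => ((fun z => w z.1 z.2) \_ (Q T%:E)) (x, t)) =
  if 0 < t < T then (w ^~ t) \_ I01 else (fun=> 0).
Proof.
apply/funext => x; rewrite patchE Q_mem; case: (boolP (0 < t < T)) => t0T; last by rewrite andbF.
by rewrite andbT patchE.
Qed.

Let sect (T x : R) w : (fun t => ((fun z => w z.1 z.2) \_ (Q T%:E)) (x, t)) =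
  if x \in I01 then (w x) \_ `]0, T[ else (fun=> 0).
Proof.
apply/funext => t; rewrite patchE Q_mem; case: (x \in I01) => //=.
by rewrite patchE mem_setE in_itv.
Qed.

Let itg_patch (D : set R) (f : R -> R) : (R.-ocitv.-measurable).-sigma.-measurable D ->
  itg mu D f <-> itg mu setT (f \_ D).
Proof.
move=> mD; rewrite /itg; have -> : EFin \o (f \_ D) = (EFin \o f) \_ D.
  by apply/funext => x; rewrite /= !patchE; case: ifP.
exact: integrable_mkcond.
Qed.


Lemma L1Q_fubini (T : R) w : L1Q T w ->
  [/\ {ae mu, forall t, 0 < t < T -> itg mu I01 (w ^~ t)},
      itg mu `]0, T[ (fun t => \int[mu]_(x in I01) w x t) &
      \int[leb2]_(z in Q T%:E) w z.1 z.2 = \int[mu]_(t in `]0, T[) \int[mu]_(x in I01) w x t].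
Proof.
move=> /L1Q_patch/real_fubini[A B C].
have mT : (R.-ocitv.-measurable).-sigma.-measurable (`]0, T[%classic : set R) by exact: measurable_itv.
have E : (fun t => \int[mu]_x ((fun z => w z.1 z.2) \_ (Q T%:E)) (x, t)) =
    (fun t => \int[mu]_(x in I01) w x t) \_ `]0, T[.
  apply/funext => t; rewrite secx patchE mem_setE in_itv/=.
  by case: (boolP (0 < t < T)) => _; [rewrite -Rintegral_mkcond|rewrite Rint0].
split.
- apply: ae_imply A _ => t H t0T; move: H; rewrite secx t0T => H.
  by apply/(itg_patch _ mI01).
- by apply/(itg_patch _ mT); rewrite -E.
- by rewrite Rintegral_mkcond C E -Rintegral_mkcond.
Qed.

Lemma L1Q_fubini' (T : R) w : L1Q T w ->
  [/\ {ae mu, forall x, I01 x -> itg mu `]0, T[ (w x)},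
      itg mu I01 (fun x => \int[mu]_(t in `]0, T[) w x t) &
      \int[leb2]_(z in Q T%:E) w z.1 z.2 = \int[mu]_(x in I01) \int[mu]_(t in `]0, T[) w x t].
Proof.
move=> /L1Q_patch/real_fubini'[A B C].
have mT : (R.-ocitv.-measurable).-sigma.-measurable (`]0, T[%classic : set R) by exact: measurable_itv.
have E : (fun x => \int[mu]_t ((fun z => w z.1 z.2) \_ (Q T%:E)) (x, t)) =
    (fun x => \int[mu]_(t in `]0, T[) w x t) \_ I01.
  apply/funext => x; rewrite sect patchE.
  by case: (x \in I01); [rewrite -Rintegral_mkcond|rewrite Rint0].
split.
- apply: ae_imply A _ => x H Ix; move: H; rewrite sect mem_set// => H.
  by apply/(itg_patch _ mT).
- by apply/(itg_patch _ mI01); rewrite -E.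
- by rewrite Rintegral_mkcond C E -Rintegral_mkcond.
Qed.

Lemma L1Q_le (S T : R) w : S <= T -> L1Q T w -> L1Q S w.
Proof.
move=> ST; apply: integrableS => //; [exact: mQ|exact: mQ|].
rewrite !QE => -[x t] [/= Ix]; rewrite !in_itv/= => /andP[t0 tS]; split=> //.
by rewrite /= t0 (lt_le_trans tS).
Qed.

Definition mQfun (T : R) w := measurable_fun (Q T%:E) (fun z : R * R => w z.1 z.2).

Definition L2Q (T : R) w := mQfun T w /\ L1Q T (fun x t => w x t ^+ 2).

Lemma in_L2Q_L2Q (T : R) w : in_L2Q T w -> L2Q T w.
Proof.
move=> w2; have mw : measurable_fun setT ((fun z : R * R => w z.1 z.2) \_ (Q T%:E)).
  by move: w2; rewrite /in_L2Q inE => /andP[/set_mem].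
split.
  by apply/(measurable_restrictT _ _).2 => //; exact: mQ.
have := Lfun2_integrable_sqr w2 => h; apply/(integrable_mkcond _ (mQ T)).
move: h; rewrite (_ : EFin \o _ = (fun z => (w z.1 z.2 ^+ 2)%:E) \_ (Q T%:E))//.
by apply/funext => z; rewrite /= !patchE; case: ifP => // _; rewrite expr0n.
Qed.

Lemma L1Q_dom (T : R) w v : mQfun T w -> L1Q T v ->
  (forall x t, I01 x -> 0 < t < T -> `|w x t| <= v x t) -> L1Q T w.
Proof.
move=> mw vi wv; apply: (le_integrable (mQ T) _ _ vi); first exact/measurable_EFinP.
move=> [x t] /mem_set; rewrite Q_mem => /andP[/set_mem Ix t0T].
by rewrite /= lee_fin (le_trans (wv _ _ Ix t0T))// ler_norm.
Qed.

Lemma L1QD (T : R) w v : L1Q T w -> L1Q T v -> L1Q T (fun x t => w x t + v x t).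
Proof. by move=> wi vi; apply: (itgD (mQ T) wi vi). Qed.

Lemma L1QZ (T k : R) w : L1Q T w -> L1Q T (fun x t => k * w x t).
Proof. by move=> wi; apply: (itgZ k (mQ T) wi). Qed.

Lemma L2Q_mul (T : R) w v : L2Q T w -> L2Q T v -> L1Q T (fun x t => w x t * v x t).
Proof.
move=> [mw w2] [mv v2]; apply: L1Q_dom (L1QD w2 v2) _; first exact: measurable_funM.
by move=> x t _ _; rewrite ler_norml; apply/andP; split; nra.
Qed.

Lemma mQfun_x (T : R) (f : R -> R) : measurable_fun I01 f -> mQfun T (fun x _ => f x).
Proof.
move=> mf; have mp : measurable_fun setT (f \_ I01).
  by apply/(measurable_restrictT _ _).1 => //; exact: mI01R.
apply: (@measurable_ext _ _ _ _ (fun z => (f \_ I01) z.1)).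
  by move=> [x t] /mem_set; rewrite Q_mem => /andP[Ix _] /=; rewrite patchE Ix.
by apply: measurable_funTS; exact: measurableT_comp mp measurable_fst.
Qed.

Lemma mQfun_t (T : R) (f : R -> R) : measurable_fun setT f -> mQfun T (fun _ t => f t).
Proof.
by move=> mf; apply: measurable_funTS; exact: measurableT_comp mf measurable_snd.
Qed.

(** By Tonelli, the inner integral of [|f x|] in time being [T |f x|]. *)
Lemma L1Q_x (T : R) (f : R -> R) : 0 < T -> itg mu I01 f -> L1Q T (fun x _ => f x).
Proof.
move=> T0 fi; have mf := @mQfun_x T f (itg_meas fi).
apply/(integrable_mkcond _ (mQ T)).
rewrite (_ : _ \_ _ = EFin \o ((fun z => f z.1) \_ (Q T%:E))); last first.
  by apply/funext => z; rewrite /= !patchE; case: ifP.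
apply/integrable12ltyP.
  by apply/measurable_EFinP; apply/(measurable_restrictT _ _).1 => //; exact: mQ.
have inner x : (\int[mu]_t `|(EFin \o ((fun z : R * R => f z.1) \_ (Q T%:E))) (x, t)|)%E =
    (((fun x => `|T * `|f x| |) \_ I01) x)%:E.
  rewrite patchE; case: ifPn => Ix.
    pose I := (`]0, T[%classic : set R); transitivity (\int[mu]_(t in I) (`|f x|)%R%:E)%E.
      rewrite [RHS]integral_mkcond; apply: eq_integral => t _ /=.
      rewrite !patchE Q_mem Ix/= mem_setE in_itv/=.
      by case: ifP => // _; rewrite normr0.
    have mI : mu I = T%:E by rewrite [LHS]lebesgue_measure_itv/= lte_fin T0 -EFinD subr0.
    rewrite integral_cst; last exact: measurable_itv.
    rewrite [X in (_ * X)%E]mI -EFinM.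
    by rewrite normrM normr_id (gtr0_norm T0) mulrC.
  rewrite -[RHS](integral0 mu setT); apply: eq_integral => t _ /=.
  by rewrite patchE Q_mem (negbTE Ix) normr0.
under eq_integral do rewrite inner.
have fa : itg mu I01 (fun x => T * `|f x|).
  by apply: itgZ; [exact: mI01|apply: itg_norm => //; exact: mI01].
move: fa => /integrableP[_].
rewrite integral_mkcond; apply: le_lt_trans; rewrite le_eqVlt; apply/orP; left; apply/eqP.
by apply: eq_integral => x _; rewrite /= !patchE; case: ifP.
Qed.

Lemma L1Q_mulbd (T M : R) w b : L1Q T w -> mQfun T b ->
  (forall x t, I01 x -> 0 < t < T -> `|b x t| <= M) -> L1Q T (fun x t => b x t * w x t).
Proof.
move=> wi mb bM.
have aw : L1Q T (fun x t => M * `|w x t|).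
  by apply: L1QZ; have := itg_norm (mQ T) wi.
apply: L1Q_dom aw _.
  by apply: measurable_funM => //; apply/measurable_EFinP; exact: measurable_int wi.
by move=> x t Ix t0T; rewrite normrM ler_wpM2r// bM.
Qed.

Lemma L2Q_x (T : R) (f : R -> R) : 0 < T -> L2 f -> L2Q T (fun x _ => f x).
Proof. by move=> T0 [mf f2]; split; [exact: mQfun_x|exact: L1Q_x]. Qed.

Lemma L2Q_L1Q (T : R) w : 0 < T -> L2Q T w -> L1Q T w.
Proof.
move=> T0 w2; have := L2Q_mul w2 (L2Q_x T0 (L2_cst 1)).
by apply: eq_integrable; [exact: mQ|move=> z _ /=; rewrite mulr1].
Qed.

Lemma L2QD (T : R) w v : L2Q T w -> L2Q T v -> L2Q T (fun x t => w x t + v x t).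
Proof.
move=> [mw w2] [mv v2]; split; first exact: measurable_funD.
apply: L1Q_dom (L1QD (L1QZ 2 w2) (L1QZ 2 v2)) _; first exact/measurable_funX/measurable_funD.
move=> x t _ _; rewrite ger0_norm ?sqr_ge0//; have := sqr_ge0 (w x t - v x t); nra.
Qed.

Lemma L2QZ (T k : R) w : L2Q T w -> L2Q T (fun x t => k * w x t).
Proof.
move=> [mw w2]; split; first exact: measurable_funM.
have := L1QZ (k ^+ 2) w2.
by apply: eq_integrable; [exact: mQ|move=> z _ /=; rewrite exprMn].
Qed.

Lemma L2Q_section (T : R) w : L2Q T w -> {ae mu, forall t, 0 < t < T -> L2 (w ^~ t)}.
Proof.
move=> [mw w2]; have [A _ _] := L1Q_fubini w2.
have mp : measurable_fun setT ((fun z : R * R => w z.1 z.2) \_ (Q T%:E)).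
  by apply/(measurable_restrictT _ _).1 => //; exact: mQ.
apply: ae_imply A _ => t H t0T; split; last exact: H.
have := measurable_fun_pair1 t mp.
move=> /(@measurable_funTS _ _ _ _ I01); apply: measurable_ext => x Ix.
by rewrite /= patchE Q_mem mem_set//= t0T.
Qed.

(** Fubini for the indicator of a measurable null set that covers the exceptions. *)
Lemma ae_section (P : R * R -> Prop) : {ae (@leb2 R), forall z, P z} ->
  {ae mu, forall t, {ae mu, forall x, P (x, t)}}.
Proof.
move=> [N [mN N0 sub]].
have Ni : (@leb2 R).-integrable setT (EFin \o (\1_N : R * R -> R)).
  apply/integrableP; split; first by apply/measurable_EFinP; exact: measurable_indic.
  have -> : (\int[@leb2 R]_z `|(EFin \o (\1_N : R * R -> R)) z| =
      \int[@leb2 R]_z (\1_N z : R)%:E)%E.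
    by apply: eq_integral => z _; rewrite /= ger0_norm// indicE.
  by rewrite integral_indic// setIT [X in (X < _)%E]N0.
have [A B C] := real_fubini Ni.
have z0 : \int[mu]_t (\int[mu]_x \1_N (x, t)) <= 0.
  by rewrite -C /Rintegral integral_indic// setIT [X in fine X]N0.
have nn t : 0 <= \int[mu]_x (\1_N (x, t) : R) by apply: Rintegral_ge0 => x _; rewrite indicE.
have D := Rint_eq0_ae measurableT B (fun t _ => nn t) z0.
apply: ae_imply2 A D _ => t Ht Dt.
have E := Rint_eq0_ae measurableT Ht (fun x _ => (ltac:(by rewrite indicE) : 0 <= \1_N (x, t) :> R))
  (ltac:(by rewrite Dt)).
apply: ae_imply E _ => x /(_ I) h; apply: contrapT => nP; have Nx : N (x, t) by exact: sub.
by move: h; rewrite indicE mem_set// => /eqP; rewrite oner_eq0.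
Qed.

Lemma itg_oo_cc (a b : R) (f : R -> R) : itg mu `]a, b[ f ->
  itg mu `[a, b] f /\ \int[mu]_(t in `]a, b[) f t = \int[mu]_(t in `[a, b]) f t.
Proof.
move=> fi; have E : \int[mu]_(t in `]a, b[) f t = \int[mu]_(t in `[a, b]) f t.
  by rewrite /Rintegral [in RHS]integral_itv_bndoo//; case/integrableP : fi.
split=> //; move: fi => /integrableP[mf foo]; apply/integrableP; split.
  apply/measurable_EFinP.
  apply/measurable_fun_itv_obnd_cbndP.
  by apply/measurable_fun_itv_bndo_bndcP; exact/measurable_EFinP.
rewrite integral_itv_bndoo//; exact: measurableT_comp.
Qed.

End Fubini.

(** * Equations weak in time *)

Section TimeDerivative.
Context {R : realType}.
Notation mu := (@lebesgue_measure R).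
Implicit Types (theta : R -> R).

(** Vanishing is imposed at [T] only; the value at 0 stays free and carries the initial datum. *)
Definition time_test (T : R) (theta theta' : R -> R) := [/\
  forall x : R, is_derive x (1 : R) theta (theta' x), continuous theta' &
  forall t, T <= t -> theta t = 0].

Lemma C1_bounded (T : R) theta theta' : 0 < T ->
  (forall x : R, is_derive x (1 : R) theta (theta' x)) -> continuous theta' ->
  AC 0 T theta theta' /\
  exists M : R, forall x, 0 <= x <= T -> `|theta x| <= M /\ `|theta' x| <= M.
Proof.
move=> T0 dphi cphi.
have A := AC_C1 (ltW T0) (fun x _ => dphi x) (fun x _ => cphi x); split=> //.
have [M1 HM1] := AC_bd (ltW T0) A.
have [] := @EVT_max R (fun x => `|theta' x|) 0 T (ltW T0).
  by apply: continuous_subspaceT => x; apply: cvg_norm; exact: cphi.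
move=> z _ Hz; exists (Num.max M1 `|theta' z|) => x x0T.
by split; rewrite le_max; [rewrite HM1|rewrite Hz ?orbT// in_itv].
Qed.

(** With [W] the primitive of [w], integration by parts makes [m + W] orthogonal to the derivatives
    of all test functions supported inside (0, T), hence constant; one test function equal to 1 at
    time 0 identifies the constant as [c]. *)
Lemma weak_time_derivative (T c : R) (m w : R -> R) : 0 < T ->
  itg mu `]0, T[ m -> itg mu `]0, T[ w ->
  (forall theta theta', time_test T theta theta' ->
     \int[mu]_(t in `]0, T[) (- (m t * theta' t) + w t * theta t) = theta 0 * c) ->
  {ae mu, forall t, 0 < t < T -> m t = c - \int[mu]_(s in `]0, t[) w s}.
Proof.
move=> T0 mi wi0 H; have [wi _] := itg_oo_cc wi0.
have WA := AC_int 0 wi; set W := (fun x => 0 + _) in WA.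
have W0 : W 0 = 0 by rewrite /W set_itv1 Rintegral_set1 addr0.
have [Wi0 Wi] : itg mu `]0, T[ W /\ itg mu `[0, T] W.
  have Wi : itg mu `[0, T] W.
    have := itg_mulAC (ltW T0) WA (itg_cst_cc 1 (ltW T0)).
    by apply: itg_ext => // x _; rewrite mulr1.
  by split=> //; apply: itgS Wi => //; exact: subset_itv_oo_cc.
have key theta theta' : time_test T theta theta' ->
    [/\ itg mu `]0, T[ (fun t => (m t + W t) * theta' t), itg mu `]0, T[ theta' &
    \int[mu]_(t in `]0, T[) ((m t + W t) * theta' t) = - (theta 0 * c)].
  move=> TT; have [dth cth out] := TT.
  have [A [M HM']] := C1_bounded T0 dth cth.
  have HM x : 0 < x < T -> `|theta x| <= M /\ `|theta' x| <= M.
    by move=> /andP[x0 xT]; apply: HM'; rewrite !ltW.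
  have ti0 : itg mu `]0, T[ theta'.
    by apply: itgS A.1 => //; exact: subset_itv_oo_cc.
  have mth : measurable_fun `]0, T[ theta' by exact: itg_meas ti0.
  have mth0 : measurable_fun `]0, T[ theta.
    by apply: measurable_funS (AC_meas (ltW T0) A) => //; exact: subset_itv_oo_cc.
  have bd (v : R -> R) (h : R -> R) : itg mu `]0, T[ v -> measurable_fun `]0, T[ h ->
      (forall x, 0 < x < T -> `|h x| <= M) -> itg mu `]0, T[ (fun t => v t * h t).
    move=> vi mh hM; have := @itg_mulbd _ _ R mu `]0, T[%classic v h M _ vi mh.
    move=> /(_ (measurable_itv _)) => E.
    have := E (fun x xT => hM x (ltac:(by move: xT; rewrite /= in_itv))).
    by apply: itg_ext => // x _; rewrite mulrC.
  have i1 := bd _ _ mi mth (fun x xT => (HM x xT).2).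
  have i2 := bd _ _ Wi0 mth (fun x xT => (HM x xT).2).
  have i3 := bd _ _ wi0 mth0 (fun x xT => (HM x xT).1).
  have P : \int[mu]_(t in `]0, T[) (W t * theta' t + theta t * w t) = 0.
    have PA := AC_mul (ltW T0) WA A.
    have PAi : itg mu `]0, T[ (fun t => W t * theta' t + theta t * w t).
      by apply: itgS PA.1 => //; exact: subset_itv_oo_cc.
    have [_ ->] := itg_oo_cc PAi.
    by rewrite -(AC_sub PA (lexx 0) (ltW T0) (lexx T)) W0 mul0r subr0 out// mulr0.
  split=> //.
    have mT : (R.-ocitv.-measurable).-sigma.-measurable (`]0, T[%classic : set R).
      exact: measurable_itv.
    have i12 := itgD mT i1 i2.
    by apply: itg_ext i12 => // x _; rewrite [RHS]mulrDl.
  have := H _ _ TT.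
  rewrite RintegralD//; last exact: itgN.
  rewrite RintN// => E1; rewrite RintegralD// in P; last first.
    by apply: itg_ext i3 => // x _; rewrite mulrC.
  under eq_Rintegral do rewrite mulrDl.
  rewrite RintegralD//.
  have E2 : \int[mu]_(t in `]0, T[) (theta t * w t) = \int[mu]_(t in `]0, T[) (w t * theta t).
    by apply: Rint_ext => x _; rewrite mulrC.
  by rewrite E2 in P; linarith.
have mW : measurable_fun `]0, T[ (fun t => m t + W t).
  by apply: measurable_funD; [exact: itg_meas mi|exact: itg_meas Wi0].
have [|phi phi' TD|k Hk] := @weak_const_ae R T (fun t => m t + W t) T0 mW.
- move=> a b a0 bT; have sub : `[a, b]%classic `<=` (`]0, T[%classic : set R).
    by move=> z; rewrite /= !in_itv/= => /andP[? ?]; apply/andP; split; linarith.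
  have mT : (R.-ocitv.-measurable).-sigma.-measurable (`]0, T[%classic : set R).
    exact: measurable_itv.
  have mab : (R.-ocitv.-measurable).-sigma.-measurable (`[a, b]%classic : set R).
    exact: measurable_itv.
  exact: itgD mab (itgS mT mab sub mi) (itgS mT mab sub Wi0).
- have [dphi cphi [a [b [a0 bT out]]]] := TD.
  have TT : time_test T phi phi'.
    by split=> // t Tt; apply: (out t _).1; rewrite negb_and -!ltNge; apply/orP; right; linarith.
  have [_ _ ->] := key _ _ TT.
  by rewrite (out 0 _).1 ?mul0r ?oppr0// negb_and -!ltNge a0.
(* A C^1 cutoff, equal to 1 up to [T / 4] and to 0 from [3 T / 4] on. *)
pose th t : R := 1 - (T / 4)^-1 * (ramp_prim (T / 4) (T / 4) t - ramp_prim (T / 2) (T / 4) t).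
pose th' t : R := - (T / 4)^-1 * (ramp (T / 4) (T / 4) t - ramp (T / 2) (T / 4) t).
have T4 : 0 < T / 4 by linarith.
have TT : time_test T th th'.
  split.
  - move=> x; have D a := is_derive_ramp_prim a (T / 4) x.
    have := derive_add (derive_cst1 x 1) (derive_scale (- (T / 4)^-1) (derive_add (D (T / 4)) (derive_scale (-1) (D (T / 2))))).
    rewrite (_ : (fun _ => _) = th); last by apply/funext => y; rewrite /th; ring.
    by rewrite (_ : 0 + _ = th' x)// /th'; ring.
  - by move=> x; apply: cvgM; [exact: cvg_cst|apply: cvgB; exact: continuous_ramp].
  - move=> t Tt; rewrite /th; have h1 : T / 4 + T / 4 <= t by linarith.
    have h2 : T / 2 + T / 4 <= t by linarith.
    have [_ ->] := ramp1 T4 h1; have [_ ->] := ramp1 T4 h2.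
    by field; rewrite gt_eqF.
have [i1 i2 E] := key _ _ TT.
have th0 : th 0 = 1.
  rewrite /th; have h1 : 0 <= T / 4 by linarith.
  have h2 : 0 <= T / 2 by linarith.
  by have [_ ->] := ramp0 T4 h1; have [_ ->] := ramp0 T4 h2; rewrite subrr mulr0 subr0.
have [dth cth out] := TT; have [A _] := C1_bounded T0 dth cth.
have I : \int[mu]_(t in `]0, T[) th' t = -1.
  have [_ ->] := itg_oo_cc i2.
  by rewrite -(AC_sub A (lexx 0) (ltW T0) (lexx T)) th0 out// sub0r.
have E2 : \int[mu]_(t in `]0, T[) ((m t + W t) * th' t) = \int[mu]_(t in `]0, T[) (k * th' t).
  apply: Rint_ae_eq => //; [exact: itg_meas i1|exact: itg_meas (itgZ k _ i2)|].
  by apply: ae_imply Hk _ => t Ht; rewrite /= in_itv/= => /Ht ->.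
rewrite RintegralZl// I E th0 in E2.
apply: ae_imply Hk _ => t Ht /[dup] /Ht h /andP[t0 tT].
have [_ ->] : itg mu `[0, t] w /\ \int[mu]_(s in `]0, t[) w s = \int[mu]_(s in `[0, t]) w s.
  apply: itg_oo_cc; apply: itgS wi0 => // z; rewrite /= !in_itv/= => /andP[? ?].
  by apply/andP; split; linarith.
by move: h; rewrite /W; linarith.
Qed.



End TimeDerivative.

Section Tensor.
Context {R : realType}.
Notation mu := (@lebesgue_measure R).

Lemma test_fun_tensor (T : R) (phi phi' theta theta' : R -> R) :
  (forall x : R, is_derive x (1 : R) phi (phi' x)) -> continuous phi' ->
  time_test T theta theta' ->
  [/\ test_fun T (fun x t => phi x * theta t),
     forall x t, d_x (fun x t => phi x * theta t) x t = phi' x * theta t &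
     forall x t, d_t (fun x t => phi x * theta t) x t = phi x * theta' t].
Proof.
move=> dphi cphi' [dth cth' out].
have dx x t : is_derive x (1 : R) (fun y => phi y * theta t) (phi' x * theta t).
  have := derive_mul (dphi x) (derive_cst1 x (theta t)).
  by rewrite mulr0 add0r mulrC.
have dt x t : is_derive t (1 : R) (fun s => phi x * theta s) (phi x * theta' t).
  exact: derive_scale (dth t).
have Ex x t : d_x (fun x t => phi x * theta t) x t = phi' x * theta t.
  by rewrite /d_x derive1E; case: (dx x t).
have Et x t : d_t (fun x t => phi x * theta t) x t = phi x * theta' t.
  by rewrite /d_t derive1E; case: (dt x t).
have cphi : continuous phi by move=> x; exact: is_derive_continuous (dphi x).
have cth : continuous theta by move=> x; exact: is_derive_continuous (dth x).
have cc (f g : R -> R) : continuous f -> continuous g -> continuous (fun z : R * R => f z.1 * g z.2).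
  move=> cf cg z; apply: cvgM.
    by apply: continuous_comp; [exact: cvg_fst|exact: cf].
  by apply: continuous_comp; [exact: cvg_snd|exact: cg].
split=> //; split.
- by move=> x t; split; [case: (dx x t)|case: (dt x t)].
- exact: cc.
- rewrite (_ : (fun z => _) = (fun z : R * R => phi' z.1 * theta z.2)); first exact: cc.
  by apply/funext => z; exact: Ex.
- rewrite (_ : (fun z => _) = (fun z : R * R => phi z.1 * theta' z.2)); first exact: cc.
  by apply/funext => z; exact: Et.
- by move=> x t /out ->; rewrite mulr0.
Qed.

End Tensor.

(** * The equation integrated in space and time *)

Section FluxIdentity.
Context {R : realType}.
Notation mu := (@lebesgue_measure R).
Variables (nu T : R) (f0 u0 : R -> R) (u k : R -> R -> R).
Hypotheses (nu0 : 0 < nu) (T0 : 0 < T) (f02 : L2 f0) (u02 : L2 u0).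
Hypothesis f0_mean : \int[mu]_(x in I01) f0 x = 0.
Hypotheses (u2 : L2Q T u) (k2 : L2Q T k).
Hypothesis W : forall phi, test_fun T phi ->
  \int[leb2]_(z in Q T%:E) (- (u z.1 z.2 * d_t phi z.1 z.2)
            + nu * (k z.1 z.2) * d_x phi z.1 z.2)
        = \int[leb2]_(z in Q T%:E) (f0 z.1 * phi z.1 z.2)
          + \int[mu]_(x in I01) (u0 x * phi x 0).

(** Products [phi x * theta t] as test functions leave an equation in time alone for the moment of
    [u] against [phi]. *)
Lemma moment_equation (phi phi' : R -> R) :
  (forall x : R, is_derive x (1 : R) phi (phi' x)) -> continuous phi' ->
  L1Q T (fun x t => nu * k x t * phi' x - f0 x * phi x) /\
  {ae mu, forall t, 0 < t < T -> \int[mu]_(x in I01) (u x t * phi x) =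
    \int[mu]_(x in I01) (u0 x * phi x) -
    \int[mu]_(s in `]0, t[) \int[mu]_(x in I01) (nu * k x s * phi' x - f0 x * phi x)}.
Proof.
move=> dphi cphi'; have [A [M HM]] := C1_bounded ltr01 dphi cphi'.
have cphi : continuous phi by move=> x; exact: is_derive_continuous (dphi x).
have mc (h : R -> R) : continuous h -> measurable_fun setT h.
  by move=> ch; exact: continuous_measurable_fun.
have b2 : L2 phi by exact: AC01_L2 A.
have b2' : L2 phi'.
  apply: (L2_bd (M := M)); first by apply: measurable_funTS; exact: mc.
  by move=> x /I01P x01; case: (HM x x01).
have pQ := L2Q_x T0 b2; have pQ' := L2Q_x T0 b2'.
have uphi := L2Q_mul u2 pQ; have kphi := L2Q_mul (L2QZ nu k2) pQ'.
have fphi := L2Q_mul (L2Q_x T0 f02) pQ.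
have wi : L1Q T (fun x t => nu * k x t * phi' x - f0 x * phi x).
  have := L1QD kphi (L1QZ (-1) fphi).
  by apply: eq_integrable; [exact: mQ|move=> z _ /=; rewrite mulN1r].
split=> //.
have [_ mi _] := L1Q_fubini uphi; have [_ wi' _] := L1Q_fubini wi.
apply: weak_time_derivative => // theta theta' TT.
have [dth cth' out] := TT; have [A' [M' HM']] := C1_bounded T0 dth cth'.
have cth : continuous theta by move=> x; exact: is_derive_continuous (dth x).
have [tf Ex Et] := test_fun_tensor dphi cphi' TT.
have bt (h : R -> R) (M1 : R) w : continuous h -> (forall t, 0 <= t <= T -> `|h t| <= M1) ->
    L1Q T w -> L1Q T (fun x t => h t * w x t).
  move=> ch hM wi1; apply: (L1Q_mulbd (M := M1) wi1 (mQfun_t (mc _ ch))).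
  by move=> x t _ /andP[t1 t2]; apply: hM; rewrite !ltW.
have u1 := bt _ _ _ cth' (fun t tT => (HM' t tT).2) uphi.
have w1 := bt _ _ _ cth (fun t tT => (HM' t tT).1) wi.
have k1 := bt _ _ _ cth (fun t tT => (HM' t tT).1) kphi.
have f1 := bt _ _ _ cth (fun t tT => (HM' t tT).1) fphi.
have WF := W tf.
have E1 : \int[leb2]_(z in Q T%:E) (- (u z.1 z.2 * d_t (fun x t => phi x * theta t) z.1 z.2)
            + nu * (k z.1 z.2) * d_x (fun x t => phi x * theta t) z.1 z.2) =
   - (\int[leb2]_(z in Q T%:E) (theta' z.2 * (u z.1 z.2 * phi z.1))) +
   (\int[leb2]_(z in Q T%:E) (theta z.2 * (nu * k z.1 z.2 * phi' z.1))).
  rewrite -RintN//; last exact: mQ.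
  rewrite -RintegralD//; [|exact: mQ|exact: (itgN (mQ T) u1)].
  by apply: Rint_ext => z _; rewrite Ex Et; ring.
have E2 : \int[leb2]_(z in Q T%:E) (f0 z.1 * (phi z.1 * theta z.2)) =
   \int[leb2]_(z in Q T%:E) (theta z.2 * (f0 z.1 * phi z.1)).
  by apply: Rint_ext => z _; ring.
have E3 : \int[mu]_(x in I01) (u0 x * (phi x * theta 0)) =
    theta 0 * \int[mu]_(x in I01) (u0 x * phi x).
  rewrite -RintegralZl//; last exact: L2_itgM.
  by apply: Rint_ext => x _; ring.
rewrite E1 E2 E3 in WF.
have E4 : (\int[leb2]_(z in Q T%:E) (theta z.2 * (nu * k z.1 z.2 * phi' z.1))) -
    \int[leb2]_(z in Q T%:E) (theta z.2 * (f0 z.1 * phi z.1)) =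
    \int[leb2]_(z in Q T%:E) (theta z.2 * (nu * k z.1 z.2 * phi' z.1 - f0 z.1 * phi z.1)).
  rewrite -RintegralB//; last exact: mQ.
  by apply: Rint_ext => z _; ring.
have mT : (R.-ocitv.-measurable).-sigma.-measurable (`]0, T[%classic : set R).
  exact: measurable_itv.
have time_factor (h : R -> R) (M1 : R) w : continuous h -> (forall t, 0 <= t <= T -> `|h t| <= M1) ->
    L1Q T w -> itg mu `]0, T[ (fun t => (\int[mu]_(x in I01) w x t) * h t) /\
    \int[leb2]_(z in Q T%:E) (h z.2 * w z.1 z.2) =
    \int[mu]_(t in `]0, T[) ((\int[mu]_(x in I01) w x t) * h t).
  move=> ch hM wi1; have hw := bt _ _ _ ch hM wi1.
  have [s1 s2 s3] := L1Q_fubini wi1; have [r1 r2 r3] := L1Q_fubini hw.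
  have mh : measurable_fun `]0, T[ h by apply: measurable_funTS; exact: mc.
  have i1 : itg mu `]0, T[ (fun t => (\int[mu]_(x in I01) w x t) * h t).
    have := itg_mulbd mT s2 mh (M := M1) => i.
    have {}i := i (fun t tT => hM t (ltac:(by move: tT; rewrite /= in_itv/= => /andP[? ?]; rewrite !ltW))).
    by apply: itg_ext i => // t _; rewrite mulrC.
  split=> //; rewrite r3; apply: Rint_ae_eq => //; [exact: itg_meas r2|exact: itg_meas i1|].
  apply: ae_imply s1 _ => t H; rewrite /= in_itv/= => /H wt.
  by rewrite RintegralZl//; [rewrite mulrC|exact: mI01].
have [ui uE] := time_factor _ _ _ cth' (fun t tT => (HM' t tT).2) uphi.
have [wwi wE] := time_factor _ _ _ cth (fun t tT => (HM' t tT).1) wi.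
rewrite RintegralD//; last exact: (itgN mT ui).
rewrite (RintN mT ui).
rewrite -uE -wE -E4; lra.
Qed.


Let F := primitive f0.
(** In the application [k] is [u^-2 u_x], that is [- p_x], so this is the velocity of the primitive
    of [u]. *)
Let G x t := nu * k x t + F x.

Let FA : AC 0 1 F f0. Proof. exact/AC_prim0/L2_itg. Qed.

Lemma flux_L2Q : L2Q T G.
Proof. by apply: L2QD; [exact: L2QZ|apply: L2Q_x => //; exact: AC01_L2 FA]. Qed.

(** The source has mean 0, so its primitive [F] vanishes at both ends and [f0] moves into the flux
    by parts; Fubini then exchanges the two integrals. *)
Lemma moment_flux (phi phi' : R -> R) :
  (forall x : R, is_derive x (1 : R) phi (phi' x)) -> continuous phi' ->
  {ae mu, forall t, 0 < t < T -> \int[mu]_(x in I01) (u x t * phi x) =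
    \int[mu]_(x in I01) (u0 x * phi x) -
    \int[mu]_(x in I01) ((\int[mu]_(s in `]0, t[) G x s) * phi' x)}.
Proof.
move=> dphi cphi'; have [wi H] := moment_equation dphi cphi'.
have [A [M HM]] := C1_bounded ltr01 dphi cphi'.
have phi2 : L2 phi := AC01_L2 A.
have phi2' : L2 phi'.
  apply: (L2_bd (M := M)); first by apply: measurable_funTS; exact: continuous_measurable_fun.
  by move=> x /I01P x01; case: (HM x x01).
have F1 : F 1 = 0 by rewrite /F primitive1//; exact: L2_itg.
have P := ip_parts FA A f02 phi2'; rewrite F1 /F primitive0 !mul0r subrr in P.
have F2 : L2 F := AC01_L2 FA.
have Gphi := L2Q_mul flux_L2Q (L2Q_x T0 phi2').
have ks := L2Q_section k2.
apply: ae_imply H _ => t E /[dup] t0T /E ->; have /andP[t0 tT] := t0T.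
congr (_ - _).
have wt := L1Q_le (ltW tT) wi; have Gt := L1Q_le (ltW tT) Gphi.
have [w1 w2 w3] := L1Q_fubini wt; have [g1 g2 g3] := L1Q_fubini Gt.
have [h1 h2 h3] := L1Q_fubini' Gt.
have GiT := L1Q_le (ltW tT) (L2Q_L1Q T0 flux_L2Q).
have [G1 Gm _] := L1Q_fubini' GiT.
transitivity (\int[mu]_(s in `]0, t[) \int[mu]_(x in I01) (G x s * phi' x)).
  apply: Rint_ae_eq => //; [exact: itg_meas w2|exact: itg_meas g2|].
  apply: ae_imply ks _ => s Hs; rewrite /= in_itv/= => /andP[s0 st].
  have ks2 : L2 (k ^~ s) by apply: Hs; rewrite s0 (lt_trans st).
  rewrite RintegralB//; [|exact: mI01|exact: (L2_itgM (L2Z nu ks2) phi2')|exact: L2_itgM].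
  transitivity ((\int[mu]_(x in I01) (nu * k x s * phi' x)) + \int[mu]_(x in I01) (F x * phi' x)).
    congr (_ + _); apply/eqP; rewrite eq_sym -addr_eq0; apply/eqP.
    by move: P; rewrite (ipC phi) /ip.
  have ki := L2_itgM (L2Z nu ks2) phi2'; have Fi := L2_itgM F2 phi2'.
  rewrite -RintegralD//.
  by apply: Rint_ext => x _; rewrite /G mulrDl.
rewrite -g3 h3; apply: Rint_ae_eq => //; first exact: itg_meas h2.
  apply: measurable_funM; last exact: phi2'.1.
  exact: itg_meas Gm.
apply: ae_imply G1 _ => x Hx Ix; rewrite [RHS]mulrC -RintegralZl//; last exact: Hx.
by apply: Rint_ext => s _; rewrite mulrC.
Qed.

(** As [j] grows, the derivatives of the test functions [phi i j] tend to minus the indicator of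
    [[0, e i]], and the boundary terms cancel because both masses are 1. Hence the difference of the
    two sides has a primitive that vanishes at every [e i]. Countably many test functions leave a
    single null set of times. *)
Lemma flow_identity : \int[mu]_(x in I01) u0 x = 1 ->
  {ae mu, forall t, 0 < t < T -> \int[mu]_(x in I01) u x t = 1} ->
  {ae mu, forall t, 0 < t < T -> [/\ L2 (u ^~ t), \int[mu]_(x in I01) u x t = 1 &
    {ae mu, forall x, I01 x ->
      primitive (u ^~ t) x - primitive u0 x = \int[mu]_(s in `]0, t[) G x s}]}.
Proof.
move=> mass0 mass; have [e [e01 ed]] := @rat01_dense R.
pose eps j : R := j.+1%:R^-1.
have eps0 j : 0 < eps j by rewrite invr_gt0 ltr0n.
pose phi i j x : R := ramp_prim (e i) (eps j) x - x.
pose phi' i j x : R := ramp (e i) (eps j) x - 1.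
have dphi i j x : is_derive x (1 : R) (phi i j) (phi' i j x).
  have := derive_add (is_derive_ramp_prim (e i) (eps j) x) (derive_scale (-1) (derive_id1 x)).
  rewrite (_ : (fun _ => _) = phi i j); last by apply/funext => y; rewrite /phi mulN1r.
  by rewrite mulr1.
have cphi i j : continuous (phi' i j).
  by move=> x; apply: cvgB; [exact: continuous_ramp|exact: cvg_cst].
have M : {ae mu, forall t, forall i j, 0 < t < T -> \int[mu]_(x in I01) (u x t * phi i j x) =
    \int[mu]_(x in I01) (u0 x * phi i j x) -
    \int[mu]_(x in I01) ((\int[mu]_(s in `]0, t[) G x s) * phi' i j x)}.
  by apply: ae_all => i; apply: ae_all => j; exact: moment_flux (dphi i j) (cphi i j).
have us := L2Q_section u2.
apply: ae_imply2 (ae_imply2 us mass (fun _ a b => conj a b)) M _ => t [Ht mt] Mt t0T.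
have {}Ht := Ht t0T; have {}mt := mt t0T; have {}Mt := fun i j => Mt i j t0T.
split=> //; have /andP[t0 tT] := t0T.
pose Gh x := \int[mu]_(s in `]0, t[) G x s.
have Ghi : itg mu I01 Gh.
  have Gi := L1Q_le (ltW tT) (L2Q_L1Q T0 flux_L2Q).
  by have [_ h _] := L1Q_fubini' Gi.
have UA := AC_prim0 (L2_itg Ht); have U0A := AC_prim0 (L2_itg u02).
have U2 := AC01_L2 UA; have U02 := AC01_L2 U0A.
pose h x := primitive (u ^~ t) x - primitive u0 x - Gh x.
have hi : itg mu I01 h by apply: itgB => //; apply: itgB => //; exact: L2_itg.
have h0 i j : \int[mu]_(x in I01) (h x * phi' i j x) = 0.
  have [A [M' HM]] := C1_bounded ltr01 (dphi i j) (cphi i j).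
  have mphi' : measurable_fun I01 (phi' i j).
    by apply: measurable_funTS; exact: continuous_measurable_fun.
  have b' x : I01 x -> `|phi' i j x| <= M' by move=> /I01P x01; case: (HM x x01).
  have phi2' : L2 (phi' i j) by exact: L2_bd b'.
  have P := ip_parts UA A Ht phi2'; have P0 := ip_parts U0A A u02 phi2'.
  rewrite !primitive1 ?mt ?mass0 ?primitive0 in P P0; [|exact: L2_itg..].
  have := Mt i j; have Gp : itg mu I01 (fun x => Gh x * phi' i j x).
    have := itg_mulbd mI01 Ghi mphi' b'.
    by apply: itg_ext => // x _; rewrite mulrC.
  have -> : \int[mu]_(x in I01) (h x * phi' i j x) =
     ip (primitive (u ^~ t)) (phi' i j) - ip (primitive u0) (phi' i j) -
     \int[mu]_(x in I01) (Gh x * phi' i j x).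
    rewrite -ipBl// -RintegralB//; last by apply: L2_itgM => //; exact: L2B.
    by apply: Rint_ext => x _; rewrite /h mulrBl.
  rewrite (ipC (phi i j)) in P; rewrite (ipC (phi i j)) in P0.
  rewrite -/(ip (u ^~ t) (phi i j)) -/(ip u0 (phi i j)) -/(Gh _); lra.
have hA := AC_prim0 hi.
have he i : primitive h (e i) = 0.
  pose l x : R := (if e i < x then 1 else 0) - 1.
  have ml : measurable_fun I01 l.
    apply: measurable_funB => //.
    rewrite (_ : (fun x => _) = \1_(`]e i, +oo[%classic : set R)); first exact: measurable_indic.
    by apply/funext => z; rewrite indicE mem_setE in_itv/= andbT; case: ltP.
  have epscv : eps j @[j --> \oo] --> (0 : R) by exact: cvg_harmonic.
  have [li Icv] : itg mu I01 (fun z => h z * l z) /\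
     \int[mu]_(z in I01) (h z * phi' i j z) @[j --> \oo] --> \int[mu]_(z in I01) (h z * l z).
    apply: (@Rint_dct _ _ R mu I01 (fun j z => h z * phi' i j z)
      (fun z => h z * l z) (fun z => `|h z|)) => //.
    - move=> j; apply: measurable_funM; first exact: itg_meas hi.
      by apply: measurable_funTS; exact: continuous_measurable_fun.
    - by apply: measurable_funM; [exact: itg_meas hi|exact: ml].
    - by apply: itg_norm => //.
    - apply: aeW => z _; apply: cvgM; first exact: cvg_cst.
      by apply: cvgB; [exact: ramp_cvg|exact: cvg_cst].
    move=> j; apply: aeW => z _; rewrite normrM -[leRHS]mulr1 ler_wpM2l//.
    have := ramp_itv (e i) z (eps0 j); rewrite /phi' ler_norml => /andP[? ?].
    by apply/andP; split; lra.
  have L0 : \int[mu]_(z in I01) (h z * l z) = 0.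
    apply: (cvg_unique _ Icv); first exact: Rhausdorff.
    by rewrite (_ : (fun n => _) = (fun=> 0)); [exact: cvg_cst|apply/funext => n; exact: h0].
  have m01 : (R.-ocitv.-measurable).-sigma.-measurable (`[0, 1]%classic : set R).
    exact: measurable_itv.
  have m0e : (R.-ocitv.-measurable).-sigma.-measurable (`[0, e i]%classic : set R).
    exact: measurable_itv.
  have /andP[ei0 ei1] := e01 i.
  have sub : `[0, e i]%classic `<=` `[0, 1]%classic by apply: subset_ccP.
  have hie : itg mu `[0, e i] (fun x => h x * l x).
    have := itgN m0e (itg_cc (lexx 0) ei1 (itg_cc01 hi)).
    apply: itg_ext => // x; rewrite /= in_itv/= => /andP[_ xe].
    by rewrite /l ltNge xe /= sub0r mulrN1.
  have out x : `[0, 1]%classic x -> ~ `[0, e i]%classic x -> h x * l x = 0.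
    rewrite /= !in_itv/= => /andP[x0 _]; rewrite x0/= => /negP; rewrite -ltNge => ex.
    by rewrite /l ex subrr mulr0.
  have [_ E] := itg_sub m01 m0e sub out hie.
  rewrite (Rint01 li) E in L0; rewrite /primitive -[LHS]opprK -RintN//; last first.
    exact: itg_cc (lexx 0) ei1 (itg_cc01 hi).
  rewrite (_ : Rintegral _ _ _ = 0) ?oppr0// -[RHS]L0; apply: Rint_ext => x.
  by rewrite /= in_itv/= => /andP[_ xe]; rewrite /l ltNge xe /= sub0r mulrN1.
have hx x : 0 <= x <= 1 -> primitive h x = 0.
  move=> x01; apply/eqP; rewrite -normr_le0; apply/ler_addgt0Pr => d d0; rewrite add0r.
  have [d1 d10 H1] := AC_uc_sym hA d0; have [i xi] := ed x x01 d1 d10.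
  have := H1 (e i) x (e01 i) x01 (ltac:(by rewrite distrC ltW)).
  by rewrite he subr0.
have h_ae := ae0_of_primitive hi hx; apply: ae_imply h_ae _ => x Hx /Hx; rewrite /h /Gh => E.
by apply/eqP; rewrite -subr_eq0; apply/eqP.
Qed.

End FluxIdentity.

(** * From weak solutions to curves of states *)

Section WeakCurve.
Context {R : realType}.
Notation mu := (@lebesgue_measure R).

Lemma primitive_ae (f g : R -> R) : L2 f -> L2 g ->
  {ae mu, forall x, I01 x -> f x = g x} ->
  forall x : R, 0 <= x <= 1 -> primitive f x = primitive g x.
Proof.
move=> f2 g2 fg x x01; apply/eqP; rewrite -subr_eq0 -normr_le0.
apply: (le_trans (prim_nm f2 g2 x01)).
rewrite (@nm_ae _ _ (fun=> 0) (L2B f2 g2) (L2_cst 0)).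
  rewrite nm_le// expr0n/= -[leRHS]Rint_cst01 /ip le_eqVlt; apply/orP; left; apply/eqP.
  by apply: Rint_ext => y _; rewrite mulr0.
by apply: ae_imply fg _ => y H /H ->; rewrite subrr.
Qed.

Lemma weak_solution_curve (nu T : R) (f0 u0 p0 k0 : R -> R) (u : R -> R -> R) :
  0 < nu -> 0 < T -> L2 f0 -> \int[mu]_(x in I01) f0 x = 0 -> L2 u0 ->
  state p0 k0 -> {ae mu, forall x, I01 x -> (p0 x)^-1 = u0 x} ->
  weak_solution nu f0 u0 T u ->
  exists A : set R, exists p g : R -> R -> R,
   [/\ A 0, p 0 = p0 /\ g 0 = k0, forall t, A t -> state (p t) (g t),
     curve T A (fun t => vol (p t)) (fun t x => nu * (nu^-1 * primitive f0 x - g t x)) &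
     forall t, A t -> 0 < t -> {ae mu, forall x, I01 x -> (p t x)^-1 = u x t}].
Proof.
move=> nu0 T0 f02 f0m u02 S0 pu0 [ux [[u2 ux2 W] upos k2 WI mass]].
pose k x t := (u x t) ^- 2 * ux x t; pose F := primitive f0.
pose G x t := nu * k x t + F x.
have {}u2 := in_L2Q_L2Q u2; have {}ux2 := in_L2Q_L2Q ux2.
have {}k2 : L2Q T k := in_L2Q_L2Q k2.
have i02 := state_inv_L2 S0.
have mass0 : \int[mu]_(x in I01) u0 x = 1.
  have [_ _ _ <-] := S0; apply/esym; apply: Rint_ae_eq => //; [exact: i02.1|exact: u02.1].
have flow := flow_identity T0 f02 u02 f0m u2 k2 WI mass0 mass.
have G2 : L2Q T G by exact: flux_L2Q.
have Gi := L2Q_L1Q T0 G2.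
pose good t q := state q (fun x => - k x t) /\ {ae mu, forall x, I01 x -> (q x)^-1 = u x t}.
(* The good times. Time 0 is added by hand, with the initial state and its slope, since the section
   of [u] at 0 carries no information. *)
pose A := [set t : R | t = 0 \/ [/\ 0 < t < T, exists q, good t q, L2 (u ^~ t) &
  {ae mu, forall x, I01 x ->
      primitive (u ^~ t) x - primitive u0 x = \int[mu]_(s in `]0, t[) G x s}]].
pose p t := if t == 0 then p0 else xget p0 [set q | good t q].
pose g t : R -> R := if t == 0 then k0 else fun x => - k x t.
have A0 : A 0 by left.
have pA t : A t -> 0 < t -> good t (p t).
  move=> [->|[_ [q qt] _ _] t0]; first by rewrite ltxx.
  rewrite /p gt_eqF//.
  by have := xgetI p0 (qt : [set q | good t q] q).
have Sp t : A t -> state (p t) (g t).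
  move=> At; have [t0|] := ltP 0 t.
    by have [] := pA t At t0; rewrite /g gt_eqF.
  by case: At => [->|[/andP[t0 _] _ _ _]]; [rewrite /p /g eqxx|rewrite leNgt t0].
have pu t : A t -> 0 < t -> {ae mu, forall x, I01 x -> (p t x)^-1 = u x t}.
  by move=> At t0; have [] := pA t At t0.
have Aae : {ae mu, forall t, 0 < t < T -> A t}.
  have P := ae_section upos.
  have H := ae_imply2 W P (fun _ a b => conj a b).
  have H' := ae_imply2 (L2Q_section ux2) (L2Q_section k2) (fun _ a b => conj a b).
  apply: ae_imply2 (ae_imply2 H H' (fun _ a b => conj a b)) flow _ => t [[W1 P1] [X1 K1]] Fl t0T.
  have [ut2 ut1 E] := Fl t0T; right; split=> //.
  have k2' : L2 (fun x => - (u x t ^- 2 * ux x t)) by exact: L2N (K1 t0T).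
  have P2 : {ae mu, forall x, I01 x -> 0 < u x t}.
    apply: ae_imply P1 _ => x H1 Ix; apply: (H1 _); move: Ix; rewrite /I01/= in_itv/= /Q/= lte_fin.
    by have /andP[? ?] := t0T.
  by have [q q1 q2] := state_of_weak (W1 t0T) (X1 t0T) P2 k2' ut1; exists q.
have GE t x : t != 0 -> nu * (nu^-1 * primitive f0 x - g t x) = G x t.
  by move=> t0; rewrite /g (negbTE t0) /G -/F; field; rewrite gt_eqF.
exists A, p, g; split=> //; first by rewrite /p /g eqxx.
split.
- by move=> t At; exact: vol_L2 (Sp t At).
- apply: ae_imply Aae _ => t H t0T; have At := H t0T; split=> //.
  have [_ g2 _ _] := Sp t At; apply/L2Z/L2B => //; apply: L2Z.
  exact/AC01_L2/AC_prim0/L2_itg.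
- have [_ n1 _] := L1Q_fubini G2.2.
  have [n2 _] := itg_oo_cc n1.
  (* A norm is at most 1 plus its square, and the square is integrable in time because [G] is square
     integrable on [Q]. *)
  exists (fun t => 1 + \int[mu]_(x in I01) (G x t ^+ 2)); split.
    by apply: itgD => //; exact: itg_cst_cc (ltW T0).
  apply: aeW => t /andP[t0 _].
  have -> : \int[mu]_(x in I01) (G x t ^+ 2) = nm (fun x => nu * (nu^-1 * primitive f0 x - g t x)) ^+ 2.
    by rewrite nm_sq; apply: Rint_ext => x _; rewrite GE ?gt_eqF.
  have := nm_ge0 (fun x => nu * (nu^-1 * primitive f0 x - g t x)); nra.
move=> psi psi2; pose ga t := \int[mu]_(x in I01) (G x t * psi x).
have Gpsi := L2Q_mul G2 (L2Q_x T0 psi2).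
have [_ ga1 _] := L1Q_fubini Gpsi; have [ga2 _] := itg_oo_cc ga1.
exists ga; split=> //.
  apply: aeW => t /andP[t0 _]; apply: Rint_ext => x _; by rewrite GE ?gt_eqF.
have KA := AC_int 0 ga2.
(* Increments from time 0 are given by [flow_identity]; all others are differences of two of
   these. *)
have V t : A t -> ip (fun x => vol (p t) x - vol p0 x) psi = \int[mu]_(tau in `[0, t]) ga tau.
  move=> At; have V2 := L2B (vol_L2 (Sp t At)) (vol_L2 S0).
  have [t0|] := ltP 0 t; last first.
    case: (At) => [-> _|[/andP[t0 _] _ _ _]]; last by rewrite leNgt t0.
    have -> : p 0 = p0 by rewrite /p eqxx.
    rewrite set_itv1 Rintegral_set1 /ip -[RHS]Rint_cst01.
    by apply: Rint_ext => x _; rewrite subrr mul0r.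
  have [|[/andP[_ tT] _ ut2 E]] := At; first by move=> h; rewrite h ltxx in t0.
  have [h1 h2 h3] := L1Q_fubini (L1Q_le (ltW tT) Gpsi).
  have [h1' h2' h3'] := L1Q_fubini' (L1Q_le (ltW tT) Gpsi).
  have [G1 Gm _] := L1Q_fubini' (L1Q_le (ltW tT) Gi).
  have [_ <-] := itg_oo_cc h2; rewrite -h3 h3'.
  apply: Rint_ae_eq => //; [exact: itg_meas (L2_itgM V2 psi2)|exact: itg_meas h2'|].
  apply: ae_imply2 E G1 _ => x Hx Gx Ix; rewrite /vol.
  rewrite (primitive_ae (state_inv_L2 (Sp t At)) ut2 (pu t At t0) (I01P Ix)).
  rewrite (primitive_ae i02 u02 pu0 (I01P Ix)) Hx// mulrC -RintegralZl//; last exact: Gx.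
  by apply: Rint_ext => s _; rewrite mulrC.
move=> s t As At s0 st tT.
have Kt : 0 <= t by exact: le_trans st.
have e1 : ip (fun x => vol (p t) x - vol (p s) x) psi =
   ip (fun x => vol (p t) x - vol p0 x) psi - ip (fun x => vol (p s) x - vol p0 x) psi.
  rewrite -ipBl//; [|exact: L2B (vol_L2 (Sp t At)) (vol_L2 S0)|exact: L2B (vol_L2 (Sp s As)) (vol_L2 S0)].
  by apply: ip_ext => // x _; ring.
rewrite e1 !V//.
by rewrite -(AC_sub KA s0 st tT); ring.
Qed.

End WeakCurve.

(** * Norms, gluing in time, and the theorem *)

Section Norms.
Context {R : realType}.
Notation mu := (@lebesgue_measure R).
Implicit Types (f g F : R -> R).

Lemma Lnorm2E f : ('N[mu]_2%:E [EFin \o (f \_ I01)] =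
  (\int[mu]_(x in I01) (f x ^+ 2)%:E) `^ 2^-1)%E.
Proof.
rewrite unlock /= [in RHS]integral_mkcond; congr (_ `^ _)%E.
apply: eq_integral => x _; rewrite /= !patchE; case: ifPn => _.
  by rewrite /= powR_mulrn// -normrX ger0_norm ?sqr_ge0.
by rewrite normr0 powR0.
Qed.

Lemma in_L2P f : in_L2 f <-> L2 f.
Proof.
have mR : measurable_fun setT (f \_ I01) <-> measurable_fun I01 f.
  by apply: iff_sym; exact: (measurable_restrictT f mI01R).
split.
  move=> f2; have mf : measurable_fun setT (f \_ I01).
    by move: f2; rewrite /in_L2 inE => /andP[/set_mem].
  split; first exact/mR.
  have := Lfun2_integrable_sqr f2 => h; apply/(integrable_mkcond _ mI01).
  move: h; rewrite (_ : EFin \o _ = (fun x => (f x ^+ 2)%:E) \_ I01)//.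
  by apply/funext => z; rewrite /= !patchE; case: ifP => // _; rewrite expr0n.
move=> [mf f2]; rewrite /in_L2 inE; apply/andP; split; rewrite inE/=; first exact/mR.
rewrite /finite_norm Lnorm2E poweR_lty//.
move: f2 => /integrableP[_]; apply: le_lt_trans.
rewrite le_eqVlt; apply/orP; left; apply/eqP; apply: eq_integral => x _ /=.
by rewrite ger0_norm ?sqr_ge0.
Qed.

Lemma L2normE f : L2 f -> L2norm f = nm f.
Proof.
move=> f2; rewrite /L2norm Lnorm2E.
have -> : (\int[mu]_(x in I01) (f x ^+ 2)%:E = (ip f f)%:E)%E.
  rewrite /ip /Rintegral fineK.
    by apply: eq_integral => x _; rewrite expr2.
  by apply: integrable_fin_num; [exact: mI01R|exact: L2_itgM].
by rewrite /= powR12_sqrt// ip_ge0.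
Qed.

Lemma wderivP f : has_L2_deriv f -> L2 (wderiv f) /\ weak_deriv f (wderiv f).
Proof.
move=> [g Hg]; have := @xgetPex _ (fun=> 0) [set g | in_L2 g /\ weak_deriv f g] (ex_intro _ g Hg).
by rewrite -/(wderiv f) => -[/in_L2P h ?].
Qed.

Lemma weak_deriv_ae f F g : AC 0 1 F g -> L2 g -> L2 f ->
  {ae mu, forall x, I01 x -> f x = F x} -> weak_deriv f g.
Proof.
move=> FA g2 f2 fF; have [L1 L2g W] := AC_weak_deriv FA g2; split=> //.
  by apply: open_integrable_locally; [exact: interval_open|exact: L2_itg].
move=> phi Cphi; rewrite -W//; have [A B _] := Cphi.
have mB : measurable_fun I01 (derive1 phi).
  by apply: measurable_funTS; exact: continuous_measurable_fun.
apply: Rint_ae_eq => //.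
- by apply: measurable_funM => //; case: f2.
- by apply: measurable_funM => //; exact: AC01_meas FA.
by apply: ae_imply fF _ => x H /H ->.
Qed.

(** [wderiv] picks an unknown representative, but weak derivatives agree almost everywhere, so the
    norm can be computed with the density [g]. *)
Lemma H1norm_AC f F g : AC 0 1 F g -> L2 g -> measurable_fun I01 f ->
  {ae mu, forall x, I01 x -> f x = F x} ->
  in_H1 f /\ H1norm f = Num.sqrt (ip F F + ip g g).
Proof.
move=> FA g2 mf fF; have F2 := AC01_L2 FA.
have f2 : L2 f.
  by apply: (L2_ae F2 mf); apply: ae_imply fF _ => x H /H ->.
have W := weak_deriv_ae FA g2 f2 fF.
have D : has_L2_deriv f by exists g; split=> //; exact/in_L2P.
have [w2 w] := wderivP D.
split; first by split=> //; exact/in_L2P.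
rewrite /H1norm !L2normE// (nm_ae f2 F2 fF).
by rewrite (nm_ae w2 g2 (weak_deriv_unique w W w2 g2)) !nm_sq.
Qed.

End Norms.

(** * Joint measurability and null sets of sections *)

Section Joint.
Context {R : realType}.
Notation mu := (@lebesgue_measure R).

(** Freezing time at the left ends of [n + 1] equal subintervals gives finite sums of products of a
    function of [x] and a function of [t], which are jointly measurable; uniform continuity in time
    makes them converge. *)
Lemma mQfun_equicontinuous (S : R) (w : R -> R -> R) : 0 < S ->
  (forall t : R, 0 <= t <= S -> measurable_fun I01 (w ^~ t)) ->
  (forall e : R, 0 < e -> exists2 d : R, 0 < d & forall s t : R,
     0 <= s <= S -> 0 <= t <= S -> `|s - t| <= d ->
     forall x : R, 0 <= x <= 1 -> `|w x t - w x s| <= e) ->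
  mQfun S w.
Proof.
move=> S0 mw H.
pose de n : R := S / n.+1%:R; pose I n (j : nat) := (`[j%:R * de n, j.+1%:R * de n[%classic : set R).
pose f n (z : R * R) := \sum_(j < n.+1) (\1_(I n j) z.2 : R) * w z.1 (j%:R * de n).
have de0 n : 0 < de n by rewrite divr_gt0.
have mem_I n j t : (t \in I n j) = (Num.truncn (t / de n) == j) && (0 <= t).
  rewrite /I mem_setE in_itv/= -ler_pdivlMr// -ltr_pdivrMr//.
  have [t0|t0] := leP 0 t; last first.
    rewrite andbF; apply/negP => /andP[h _]; have : t / de n < 0 by rewrite pmulr_llt0 ?invr_gt0.
    by have := ler0n R j; linarith.
  have td0 : 0 <= t / de n by rewrite divr_ge0// ltW.
  by rewrite andbT; apply/idP/idP => [|/eqP <-]; [rewrite truncn_eq|rewrite truncn_itv].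
have fE n x t : 0 < t < S -> exists s : R, [/\ 0 <= s <= S, `|s - t| <= de n & f n (x, t) = w x s].
  move=> /andP[t0 tS]; pose j := Num.truncn (t / de n).
  have td0 : 0 <= t / de n by rewrite divr_ge0// ltW.
  have /andP[h1 h2] := truncn_itv td0; rewrite -/j in h1 h2.
  rewrite ler_pdivlMr// in h1; rewrite ltr_pdivrMr// in h2.
  have jn : (j < n.+1)%N.
    have : (j%:R : R) < n.+1%:R.
      rewrite -(ltr_pM2r (de0 n)); apply: (le_lt_trans h1); apply: (lt_le_trans tS).
      by rewrite /de mulrC divfK.
    by rewrite ltr_nat.
  exists (j%:R * de n); split.
  - by rewrite mulr_ge0 ?(ltW (de0 n))//= (le_trans h1)// ltW.
  - rewrite distrC ger0_norm ?subr_ge0//; move: h2; rewrite -natr1 mulrDl mul1r; linarith.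
  - rewrite /f (bigD1 (Ordinal jn))//= big1 ?addr0.
      by rewrite indicE mem_I eqxx ltW// mul1r.
    move=> i ij; rewrite indicE mem_I (_ : (_ == _) = false) ?mul0r//.
    by apply/negbTE; apply: contra ij => /eqP h; apply/eqP/val_inj; rewrite /= -h.
have mf n : measurable_fun (Q S%:E) (f n).
  apply: measurable_sum => j; apply: measurable_funM.
    apply: (@mQfun_t _ S (\1_(I n j))); apply: measurable_indic; exact: measurable_itv.
  have [jS|jS] := boolP (0 <= j%:R * de n <= S).
    exact: (@mQfun_x _ S (w ^~ (j%:R * de n)) (mw _ jS)).
  exfalso; move/negP: jS; apply; rewrite mulr_ge0 ?(ltW (de0 n))//=.
  by rewrite /de mulrCA ler_piMr ?(ltW S0)// ler_pdivrMr// mul1r ler_nat ltnW.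
apply: (measurable_fun_cvg mf) => -[x t] /mem_set; rewrite Q_mem => /andP[/set_mem Ix t0S].
apply/cvgrPdist_le => e e0; have [d d0 Hd] := H e e0.
near=> n; have [s [sS st ->]] := fE n x t t0S.
apply: Hd => //; [by have /andP[? ?] := t0S; rewrite !ltW| |exact: I01P].
apply: (le_trans st); rewrite /de ler_pdivrMr// mulrC -ler_pdivrMr//.
apply: (@le_trans _ _ n%:R); last by rewrite ler_nat.
near: n; exact: nbhs_infty_ger.
Unshelve. all: by end_near.
Qed.

(** Fubini for [|v - u|], almost all of whose sections have integral 0. *)
Lemma ae_of_sections (S : R) (v u : R -> R -> R) : 0 < S -> L2Q S v -> L2Q S u ->
  {ae mu, forall t, 0 < t < S -> {ae mu, forall x, I01 x -> v x t = u x t}} ->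
  {ae (@leb2 R), forall z, Q S%:E z -> v z.1 z.2 = u z.1 z.2}.
Proof.
move=> S0 v2 u2 H; pose w x t := `|v x t + (-1) * u x t|.
have di := L2Q_L1Q S0 (L2QD v2 (L2QZ (-1) u2)).
have wi : L1Q S w := itg_norm (mQ S) di.
have [w1 w2 w3] := L1Q_fubini wi.
have mS : (R.-ocitv.-measurable).-sigma.-measurable (`]0, S[%classic : set R) by exact: measurable_itv.
have I0 : \int[leb2]_(z in Q S%:E) w z.1 z.2 <= 0.
  rewrite w3 -[leRHS](Rint0 mu `]0, S[%classic) le_eqVlt; apply/orP; left; apply/eqP.
  apply: Rint_ae_eq => //; first exact: itg_meas w2.
  apply: ae_imply2 w1 H _ => t Ht1 Ht; rewrite /= in_itv/= => t0S.
  rewrite -[RHS](Rint0 mu I01); apply: (Rint_ae_eq mI01 (itg_meas (Ht1 t0S))) => //.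
  by apply: ae_imply (Ht t0S) _ => x Hx Ix; rewrite /w Hx// mulN1r subrr normr0.
have Z := Rint_eq0_ae (mQ S) wi (fun z _ => normr_ge0 _) I0.
apply: filterS Z => z Hz /Hz /normr0_eq0; rewrite mulN1r => /eqP.
by rewrite subr_eq0 => /eqP.
Qed.

End Joint.

(** * Gluing in time and the conclusion *)

Section Trajectories.
Context {R : realType}.
Notation mu := (@lebesgue_measure R).
Implicit Types (u P Gam : R -> R -> R).

Definition trajectory (S : R) u P Gam := [/\
  forall t : R, 0 <= t <= S -> state (P t) (Gam t),
  (forall e : R, 0 < e -> exists2 d : R, 0 < d & forall s t : R,
     0 <= s <= S -> 0 <= t <= S -> `|s - t| <= d ->
     forall x : R, 0 <= x <= 1 -> `|P t x - P s x| <= e) &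
  {ae (@leb2 R), forall z, Q S%:E z -> (P z.2 z.1)^-1 = u z.1 z.2}].

(** The initial velocity has norm at most [nu (nm gi + nm k0)], a bound that the flow preserves;
    returning from the velocity to the slope costs [nm gi] once more. This is the origin of [r]. *)
Lemma finite_trajectory (nu S r : R) (f0 u0 p0 k0 pinf : R -> R) u :
  let gi := fun x => nu^-1 * primitive f0 x in
  0 < nu -> 0 < S -> L2 f0 -> \int[mu]_(x in I01) f0 x = 0 -> L2 u0 ->
  state p0 k0 -> {ae mu, forall x, I01 x -> (p0 x)^-1 = u0 x} ->
  state pinf gi -> nm k0 + 2 * nm gi <= r -> r < 1 ->
  weak_solution nu f0 u0 S u ->
  exists P Gam, [/\ trajectory S u P Gam,
    forall t : R, 0 <= t <= S -> nm (Gam t) <= r &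
    forall t : R, 0 <= t < S ->
      ip (fun x => Gam t x - gi x) (fun x => Gam t x - gi x) +
      ip (fun x => P t x - pinf x) (fun x => P t x - pinf x) <=
      (ip (fun x => k0 x - gi x) (fun x => k0 x - gi x) +
       ip (fun x => p0 x - pinf x) (fun x => p0 x - pinf x)) *
      expR (- (2 * (nu * pi ^+ 2 * (1 - r) ^+ 2) * t))].
Proof.
move=> gi nu0 S0 f02 f0m u02 S0' pu0 Si kr r1 W.
have [A [p [g [A0 [p0E g0E] Sp C pu]]]] := weak_solution_curve nu0 S0 f02 f0m u02 S0' pu0 W.
have [_ gi2 _ _] := Si; have [p0A k02 _ _] := S0'; have [piA _ _ _] := Si.
have Gn : nm (fun x => nu * (gi x - g 0 x)) <= nu * (nm gi + nm k0).
  rewrite g0E nmZ; last exact: L2B.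
  by rewrite gtr0_norm// ler_wpM2l ?(ltW nu0)// nmB.
have Gr : nm (fun x => nu * (gi x - g 0 x)) / nu + nm gi <= r.
  apply: le_trans kr; have : nm (fun x => nu * (gi x - g 0 x)) / nu <= nm gi + nm k0.
    by rewrite ler_pdivrMr// mulrC.
  linarith.
have [P [Gam [SP CP mod P0 Pae]]] := flow_extension nu0 S0 gi2 A0 Sp C Gr (ltW r1).
have St t : 0 <= t <= S -> state (P t) (Gam t) by move=> /SP[].
have Gamr t : 0 <= t <= S -> nm (Gam t) <= r.
  move=> tS; have [[_ G2 _ _] Gn'] := SP t tS.
  by apply: le_trans Gr; exact: (slope_bound nu0 gi2 G2 Gn').
have r0 : 0 <= r by apply: le_trans kr; have := nm_ge0 k0; have := nm_ge0 gi; linarith.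
have gir : nm gi <= r by have := nm_ge0 k0; have := nm_ge0 gi; linarith.
exists P, Gam; split=> //.
  split=> //.
  have [ux [[/in_L2Q_L2Q u2 _ _] _ _ _ _]] := W.
  apply: (@ae_of_sections _ S (fun x t => (P t x)^-1) u S0) => //.
    have mP : mQfun S (fun x t => P t x).
      apply: mQfun_equicontinuous => //.
      by move=> t /St[PA _ _ _]; exact: AC01_meas PA.
    have pos z : Q S%:E z -> 0 < P z.2 z.1.
      case: z => x t /mem_set; rewrite Q_mem => /andP[/set_mem/I01P x01 /andP[t0 tS]].
      have tS' : 0 <= t <= S by rewrite !ltW.
      by have [_ _ h _] := St t tS'; exact: h.
    have mv : mQfun S (fun x t => (P t x)^-1) by exact: inv_meas mP pos.
    have one := L2Q_L1Q S0 (L2Q_x S0 (L2_cst 1)).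
    split=> //; apply: (L1Q_dom _ (L1QZ ((1 - r)^-1 ^+ 2) one)); first exact: measurable_funX.
    move=> x t /I01P x01 /andP[t0 tS]; have tS' : 0 <= t <= S by rewrite !ltW.
    have := state_bound (St t tS') x01; rewrite ler_norml => /andP[lb _].
    have := Gamr t tS' => gr; have Pr : 1 - r <= P t x by linarith.
    have r1' : 0 < 1 - r by linarith.
    have Pp := lt_le_trans r1' Pr.
    rewrite mulr1 ger0_norm ?sqr_ge0// ler_pXn2r ?nnegrE ?invr_ge0 ?(ltW Pp) ?(ltW r1')//.
    by rewrite lef_pV2.
  apply: ae_imply Pae _ => t Ht t0S; have [At E] := Ht t0S; have /andP[t0 _] := t0S.
  by apply: ae_imply (pu t At t0) _ => x Hx Ix; rewrite (E x (I01P Ix)) Hx.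
move=> t t0S.
have r01 : 0 <= r < 1 by rewrite r0.
apply: le_trans (energy_decay nu0 r01 Si gir St Gamr CP mod t0S) _.
have z0S : 0 <= (0 : R) <= S by rewrite lexx ltW.
have [P0A G02 _ _] := St 0 z0S.
(* The slope at time 0 was chosen by the extension; it agrees with [k0] almost everywhere, both
   being densities of [p0]. *)
have Gk : {ae mu, forall x, I01 x -> Gam 0 x = k0 x}.
  apply: ae_of_primitive => // x x01.
  have := AC_primE P0A x01; have := AC_primE p0A x01.
  have h0 : 0 <= (0 : R) <= 1 by rewrite lexx ler01.
  rewrite !P0// p0E => -> h; linarith.
rewrite le_eqVlt; apply/orP; left; apply/eqP; congr ((_ + _) * _).
  rewrite -!nm_sq; congr (_ ^+ 2); apply: nm_ae; [exact: L2B|exact: L2B|].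
  by apply: ae_imply Gk _ => x H /H ->.
by apply: ip_ext => x /I01P x01; rewrite P0// p0E.
Qed.

(** Just after [t] there are times at which both states equal [1/u] almost everywhere, hence
    everywhere by continuity in space; continuity in time leads back to [t]. Solutions for different
    horizons can therefore be glued. *)
Lemma trajectory_unique S S' u P Gam P' Gam' : trajectory S u P Gam ->
  trajectory S' u P' Gam' -> forall t x : R, 0 < t -> t < S -> t < S' -> 0 <= x <= 1 ->
  P t x = P' t x.
Proof.
move=> [St mod uP] [St' mod' uP'] t x t0 tS tS' x01.
apply/eqP; rewrite -subr_eq0 -normr_le0; apply/ler_addgt0Pr => e e0; rewrite add0r.
have e20 : 0 < e / 2 by linarith.
have [d d0 Hd] := mod _ e20; have [d' d'0 Hd'] := mod' _ e20.
pose b := Num.min (Num.min S S') (Num.min (t + d) (t + d')).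
have tb : t < b by rewrite /b !lt_min tS tS' !ltrDl d0 d'0.
have H := ae_imply2 (ae_section uP) (ae_section uP') (fun _ a b => conj a b).
have [s [E E'] /andP[ts]] := ae_exists tb H.
rewrite /b !lt_min => /andP[/andP[sS sS'] /andP[sd sd']].
have s0 : 0 < s by exact: lt_trans ts.
have i1 : 0 <= s <= S by rewrite !ltW.
have i2 : 0 <= s <= S' by rewrite !ltW.
have j1 : 0 <= t <= S by rewrite !ltW.
have j2 : 0 <= t <= S' by rewrite !ltW.
have [PA _ _ _] := St s i1; have [PA' _ _ _] := St' s i2.
have Es : P s x = P' s x.
  apply: (AC_ae_eq PA PA') x01; apply: ae_imply2 E E' _ => y Hy Hy' Iy.
  have yQ : Q S%:E (y, s) by apply/set_mem; rewrite Q_mem mem_set//= s0.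
  have yQ' : Q S'%:E (y, s) by apply/set_mem; rewrite Q_mem mem_set//= s0.
  by apply: invr_inj; rewrite (Hy yQ) (Hy' yQ').
have h : `|s - t| <= d by rewrite ger0_norm; linarith.
have h' : `|s - t| <= d' by rewrite ger0_norm; linarith.
have := Hd s t i1 j1 h x x01; have := Hd' s t i2 j2 h' x x01; rewrite Es.
rewrite !ler_norml => /andP[? ?] /andP[? ?]; apply/andP; split; linarith.
Qed.

Lemma trajectory_continuous S u P Gam (x t : R) : trajectory S u P Gam ->
  0 < x < 1 -> 0 < t < S -> {for (x, t), continuous (fun z : R * R => P z.2 z.1)}.
Proof.
move=> [St mod _] x01 t0S; have [x0 x1] := andP x01; have [t0 tS] := andP t0S.
have t0S' : 0 <= t <= S by rewrite !ltW.
have x01' : 0 <= x <= 1 by rewrite !ltW.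
have [PA _ _ _] := St t t0S'.
apply/cvgrPdist_le => e e0; have e20 : 0 < e / 2 by linarith.
have [d d0 Hd] := mod _ e20; have [d' d'0 Hd'] := AC_uc_sym PA e20.
pose a := Num.min d' (Num.min (x / 2) ((1 - x) / 2)).
pose b := Num.min d (Num.min (t / 2) ((S - t) / 2)).
have a0 : 0 < a by rewrite !lt_min d'0 !divr_gt0//= subr_gt0.
have b0 : 0 < b by rewrite !lt_min d0 !divr_gt0//= subr_gt0.
have N1 : \forall z \near (x, t), `|x - z.1| <= a.
  exact: (@cvgr_dist_le _ _ _ _ _ (fun z : R * R => z.1) x cvg_fst).
have N2 : \forall z \near (x, t), `|t - z.2| <= b.
  exact: (@cvgr_dist_le _ _ _ _ _ (fun z : R * R => z.2) t cvg_snd).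
near=> z.
have xz : `|x - z.1| <= a by near: z.
have tz : `|t - z.2| <= b by near: z.
move: xz tz; rewrite !le_min => /and3P[xd xz1 xz2] /and3P[td tz1 tz2].
move: xz1 xz2 tz1 tz2; rewrite !ler_norml => /andP[_ xz1] /andP[xz2 _] /andP[_ tz1] /andP[tz2 _].
have z01 : 0 <= z.1 <= 1 by clear -x0 x1 xz1 xz2; apply/andP; split; lra.
have s0S : 0 <= z.2 <= S by clear -t0 tS tz1 tz2; apply/andP; split; lra.
have zx : `|z.1 - x| <= d' by rewrite distrC.
have := Hd' x z.1 x01' z01 zx; have := Hd t z.2 t0S' s0S td z.1 z01.
rewrite /= !ler_norml => /andP[i1 i2] /andP[i3 i4].
by clear -i1 i2 i3 i4; apply/andP; split; lra.
Unshelve. all: by end_near.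
Qed.

End Trajectories.

(** [1/u_inf] is [nu^-1] times the sum of [C] and the double primitive of [f0]; the normalization of
    [C] is exactly the unit mass. *)
Lemma steady_state (R : realType) (nu C : R) (f0 : R -> R) : 0 < nu -> L2 f0 ->
  is_C_nu nu f0 C ->
  state (fun x => (u_inf nu f0 C x)^-1) (fun x => nu^-1 * primitive f0 x).
Proof.
move=> nu0 f02 [C0 C1].
have F2 : L2 (primitive f0) by exact/AC01_L2/AC_prim0/L2_itg.
have PA := AC_prim C (L2_itg F2).
have E x : (u_inf nu f0 C x)^-1 = nu^-1 * (C + primitive (primitive f0) x).
  by rewrite /u_inf invf_div mulrC (addrC C).
have CA : AC 0 1 (fun x => (u_inf nu f0 C x)^-1) (fun x => nu^-1 * primitive f0 x).
  by apply: AC_ext (AC_Z nu^-1 PA) => // x _; rewrite E.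
have pos x : 0 <= x <= 1 -> 0 < C + primitive (primitive f0) x.
  by move=> x01; rewrite addrC; exact: C0.
split=> //.
- exact: L2Z.
- by move=> x x01; rewrite E mulr_gt0 ?invr_gt0// pos.
- transitivity (\int[lebesgue_measure]_(x in I01) (nu * (C + primitive (primitive f0) x)^-1)).
    by apply: Rint_ext => x _; rewrite invrK /u_inf (addrC C).
  rewrite RintegralZl//; last exact: L2_itg (AC_inv_L2 PA pos).
  rewrite (_ : Rintegral _ _ _ = nu^-1) ?mulfV ?gt_eqF// -C1.
  by apply: Rint_ext => x _; rewrite (addrC C).
Qed.

(** A constant sequence when [T] is finite, the positive integers when it is infinite. *)
Lemma exhaustion (R : realType) (T : \bar R) : (0 < T)%E ->
  exists S : nat -> R, (forall n, 0 < S n /\ ((S n)%:E <= T)%E) /\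
    forall t : R, 0 < t -> (t%:E < T)%E -> exists n, t < S n.
Proof.
case: T => [T| |//] T0.
  by exists (fun=> T); split=> [n|t t0 tT]; [split|exists 0%N].
exists (fun n => n.+1%:R); split=> [n|t t0 _]; first by split; rewrite ?leey ?ltr0n.
exists (Num.truncn t); exact: truncnS_gt.
Qed.

Lemma glued_solution (R : realType) (nu r : R) (f0 u0 p0 k0 pinf : R -> R) (T : \bar R)
    (u : R -> R -> R) :
  let gi := fun x => nu^-1 * primitive f0 x in
  0 < nu -> L2 f0 -> \int[lebesgue_measure]_(x in I01) f0 x = 0 -> L2 u0 ->
  state p0 k0 -> {ae (@lebesgue_measure R), forall x, I01 x -> (p0 x)^-1 = u0 x} ->
  state pinf gi -> nm k0 + 2 * nm gi <= r -> r < 1 -> (0 < T)%E ->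
  weak_solution_upto nu f0 u0 T u ->
  exists P Gam : R -> R -> R,
  [/\ continuous_representative T u (fun x t => (P t x)^-1),
    (forall t : R, 0 < t -> (t%:E < T)%E -> state (P t) (Gam t) /\ nm (Gam t) <= r) &
    forall t : R, 0 < t -> (t%:E < T)%E ->
      ip (fun x => Gam t x - gi x) (fun x => Gam t x - gi x) +
      ip (fun x => P t x - pinf x) (fun x => P t x - pinf x) <=
      (ip (fun x => k0 x - gi x) (fun x => k0 x - gi x) +
       ip (fun x => p0 x - pinf x) (fun x => p0 x - pinf x)) *
      expR (- (2 * (nu * pi ^+ 2 * (1 - r) ^+ 2) * t))].
Proof.
move=> gi nu0 f02 f0m u02 S0 pu0 Si kr r1 T0 W.
have [S [ST Scov]] := exhaustion T0.
have sol n := finite_trajectory nu0 (ST n).1 f02 f0m u02 S0 pu0 Si kr r1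
  (W (S n) (ST n).1 (ST n).2).
have [P_ sol'] := choice sol; have [G_ {}sol] := choice sol'.
(* The index of some horizon beyond [t]; the default 0 is reached only if there is none. *)
pose N t := xget 0%N [set n | t < S n].
have NP t : 0 < t -> (t%:E < T)%E -> t < S (N t).
  by move=> t0 tT; have [n tn] := Scov t t0 tT; have := xgetI 0%N (tn : [set n | t < S n] n).
pose P t := P_ (N t) t; pose Gam t := G_ (N t) t.
have QT n z : Q (S n)%:E z -> Q T z.
  by move=> [z1 z2 z3]; split=> //; apply: (lt_le_trans z3); exact: (ST n).2.
have PE n x t : Q (S n)%:E (x, t) -> P t x = P_ n t x.
  move=> /[dup]/QT[/= /andP[x0 x1] t0 tT] [_ _ /=]; rewrite lte_fin => tn.
  have [h1 _ _] := sol (N t); have [h2 _ _] := sol n.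
  by apply: (trajectory_unique h1 h2 t0 (NP t t0 tT) tn); rewrite !ltW.
have itv t : 0 < t -> (t%:E < T)%E -> 0 <= t <= S (N t).
  by move=> t0 tT; rewrite !ltW// NP.
exists P, Gam; split.
- split.
    move=> [x t] /set_mem Qxt; have [/= x01 t0 tT] := Qxt.
    have tN := NP t t0 tT; pose n := N t; have [h _ _] := sol n.
    have t0n : 0 < t < S n by rewrite t0.
    have [St _ _] := h; have t0n' := itv t t0 tT.
    have [_ _ pos _] := St t t0n'.
    have x01' : 0 <= x <= 1 by have /andP[? ?] := x01; rewrite !ltW.
    have c := trajectory_continuous h x01 t0n.
    have cV : {for (x, t), continuous (fun z : R * R => (P_ n z.2 z.1)^-1)}.
      by apply: cvgV => //=; rewrite gt_eqF// pos.
    have Qxt' : Q (S n)%:E (x, t) by split=> //=; rewrite lte_fin.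
    (* Near [(x, t)] the glued function coincides with that of the single horizon [S (N t)], whose
       continuity is inherited. *)
    have near_eq : \forall z \near (x, t), (P_ n z.2 z.1)^-1 = (P z.2 z.1)^-1.
      have oQ : \forall z \near (x, t), (0 < z.1 < 1) && (0 < z.2 < S n).
        have /andP[x0 x1] := x01.
        have c1 : z.1 @[z --> (x, t)] --> x by exact: cvg_fst.
        have c2 : z.2 @[z --> (x, t)] --> t by exact: cvg_snd.
        near=> z; apply/andP; split; apply/andP; split; near: z.
        - exact: (cvgr_gt x c1).
        - exact: (cvgr_lt x c1).
        - exact: (cvgr_gt t c2).
        - exact: (cvgr_lt t c2).
      near=> z; have /andP[z1 /andP[z2 z3]] : (0 < z.1 < 1) && (0 < z.2 < S n) by near: z.
      by rewrite (PE n z.1 z.2)//; split=> //=; rewrite lte_fin.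
    rewrite /continuous_at /= (PE n x t Qxt').
    apply: cvg_trans cV; exact: near_eq_cvg.
  have H : {ae (@leb2 R), forall z, forall n, Q (S n)%:E z -> (P_ n z.2 z.1)^-1 = u z.1 z.2}.
    by apply/ae_foralln => n; have [[_ _ h] _ _] := sol n.
  apply: (@filterS _ _ (ae_filter_ringOfSetsType (@leb2 R))) H => -[x t] Hz Qz; have [/= x01 t0 tT] := Qz.
  have Qn : Q (S (N t))%:E (x, t) by split=> //=; rewrite lte_fin NP.
  by rewrite (PE _ _ _ Qn) (Hz _ Qn).
- move=> t t0 tT; have [[St _ _] gr _] := sol (N t).
  by split; [apply: St|apply: gr]; exact: itv.
move=> t t0 tT; have [_ _ D] := sol (N t); apply: D.
by rewrite ltW//= NP.
Unshelve. all: by end_near.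
Qed.

Theorem theorem2p1 (R : realType) (nu : R) (u0 f0 : R -> R)
  (hnu : 0 < nu)
  (hu0 : in_H1 u0)
  (hu0_pos : {ae @lebesgue_measure R, forall x, I01 x -> 0 < u0 x})
  (hu0_mass : \int[lebesgue_measure]_(x in I01) u0 x = 1)
  (hR0_fin : has_L2_deriv (fun x => (u0 x)^-1))
  (hf0 : in_L2 f0)
  (hf0_mean : \int[lebesgue_measure]_(x in I01) f0 x = 0)
  (hR0 : 0 <= R_0 u0 < 1)
  (hnu_large : 2 * P_0 f0 / (1 - R_0 u0) < nu)
  (C : R) (hC : is_C_nu nu f0 C)
  (T : \bar R) (hT : (0 < T)%E)
  (u : R -> R -> R) (hu : weak_solution_upto nu f0 u0 T u) :
  exists v : R -> R -> R,
  [/\ continuous_representative T u v,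
      0 < nu * (1 - R_0 u0) - 2 * P_0 f0,
      0 < nu / (nu * (1 + R_0 u0) + 2 * P_0 f0),
      (forall x t, Q T (x, t) ->
        nu / (nu * (1 + R_0 u0) + 2 * P_0 f0) <= v x t
          <= nu / (nu * (1 - R_0 u0) - 2 * P_0 f0)) &
      (forall t, 0 < t -> (t%:E < T)%E ->
        in_H1 (fun x => (v x t)^-1 - (u_inf nu f0 C x)^-1) /\
        H1norm (fun x => (v x t)^-1 - (u_inf nu f0 C x)^-1)
          <= H1norm (fun x => (u0 x)^-1 - (u_inf nu f0 C x)^-1)
             * expR (- (pi ^+ 2 * t / nu)
                     * (nu * (1 - R_0 u0) - 2 * P_0 f0) ^+ 2))].
Proof.
have f02 : L2 f0 by exact/in_L2P.
have u02 : L2 u0 by case: hu0 => /in_L2P.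
have [k02 k0W] := wderivP hR0_fin; set k0 := wderiv _ in k02 k0W.
have [_ [ux [/in_L2P ux2 uxW]]] := hu0.
(* [u0] and its reciprocal both have a square-integrable weak derivative, which provides a
   continuous initial state with slope [k0]. *)
have [p0 S0 pu0] := state_of_reciprocal uxW ux2 k0W k02 hu0_pos hu0_mass.
have F2 : L2 (primitive f0) by exact/AC01_L2/AC_prim0/L2_itg.
have R0E : R_0 u0 = nm k0 by rewrite /R_0 L2normE.
have P0E : P_0 f0 = nm (primitive f0) by rewrite /P_0 L2normE.
have P0ge : 0 <= P_0 f0 by rewrite P0E nm_ge0.
have Si := steady_state hnu f02 hC.
(* With this [r], [nu * (1 - r)] is [nu * (1 - R_0 u0) - 2 * P_0 f0], so the condition on [nu] says
   that [r < 1]. *)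
pose r := R_0 u0 + 2 * P_0 f0 / nu.
have {}hnu_large : 2 * P_0 f0 < nu * (1 - R_0 u0).
  by move: hnu_large; rewrite ltr_pdivrMr; linarith.
have pn : 2 * P_0 f0 / nu * nu = 2 * P_0 f0 by rewrite divfK ?gt_eqF.
have pn0 : 0 <= 2 * P_0 f0 / nu by rewrite divr_ge0 ?(ltW hnu)// mulr_ge0.
have r1 : r < 1.
  have : 2 * P_0 f0 / nu < 1 - R_0 u0 by rewrite ltr_pdivrMr// [ltRHS]mulrC.
  by rewrite /r; linarith.
have kr : nm k0 + 2 * nm (fun x => nu^-1 * primitive f0 x) <= r.
  rewrite /r R0E P0E nmZ// ger0_norm ?invr_ge0 ?(ltW hnu)// lerD2l.
  by rewrite mulrCA mulrC.
have [P [Gam [Prep Sr D]]] := glued_solution hnu f02 hf0_mean u02 S0 pu0 Si kr r1 hT hu.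
have r1' : 0 < 1 - r by linarith.
have r0 : 0 < 1 + r by rewrite /r; linarith.
have lowE : nu / (nu * (1 + R_0 u0) + 2 * P_0 f0) = (1 + r)^-1.
  rewrite (_ : _ + _ = nu * (1 + r)); last by rewrite /r; field; rewrite gt_eqF.
  by rewrite invfM mulrA divff ?gt_eqF// mul1r.
have upE' : nu * (1 - R_0 u0) - 2 * P_0 f0 = nu * (1 - r) by rewrite /r; field; rewrite gt_eqF.
exists (fun x t => (P t x)^-1); split=> //.
- linarith.
- by rewrite lowE invr_gt0.
- move=> x t [/= /andP[x0 x1] t0 tT]; have [St Gr] := Sr t t0 tT.
  have x01 : 0 <= x <= 1 by rewrite !ltW.
  have := state_bound St x01; rewrite ler_norml => /andP[h1 h2].
  have Pl : 1 - r <= P t x by linarith.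
  have Pu : P t x <= 1 + r by linarith.
  have Pp := lt_le_trans r1' Pl.
  rewrite lowE upE' invfM mulrA divff ?gt_eqF// mul1r.
  by rewrite !lef_pV2// Pl Pu.
move=> t t0 tT; have [[PA G2 _ _] _] := Sr t t0 tT.
have [p0A _ _ _] := S0; have [iA i2 _ _] := Si.
have dA := AC_B PA iA; have d0A := AC_B p0A iA.
have m0 : measurable_fun I01 (fun x => (u0 x)^-1 - (u_inf nu f0 C x)^-1).
  apply: measurable_funB; last exact: AC01_meas iA.
  by have [[]] := k0W.
rewrite (_ : (fun x => (P t x)^-1^-1 - _) = fun x => P t x - (u_inf nu f0 C x)^-1); last first.
  by apply/funext => x; rewrite invrK.
have [H1 ->] := H1norm_AC dA (L2B G2 i2) (AC01_meas dA) (aeW _ (fun x _ => erefl)).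
have q0 : {ae (@lebesgue_measure R), forall x, I01 x ->
    (u0 x)^-1 - (u_inf nu f0 C x)^-1 = p0 x - (u_inf nu f0 C x)^-1}.
  by apply: ae_imply pu0 _ => x h Ix; rewrite -h// invrK.
have [_ ->] := H1norm_AC d0A (L2B k02 i2) m0 q0.
split=> //.
set a := ip _ _ + _; set b := ip _ _ + _; set X := expR _.
have b0 : 0 <= b by rewrite addr_ge0 ?ip_ge0.
(* The decay estimate concerns squared norms; squaring [X] doubles its exponent, which gives the
   rate [2 nu pi^2 (1 - r)^2]. *)
have -> : X = Num.sqrt (X ^+ 2) by rewrite sqrtr_sqr ger0_norm// expR_ge0.
rewrite -sqrtrM// ler_wsqrtr//.
have := D t t0 tT; rewrite addrC -/a (addrC (ip _ _)) -/b => /le_trans; apply.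
rewrite le_eqVlt; apply/orP; left; apply/eqP; congr (_ * _).
rewrite /X -expRM_natl; congr expR; rewrite upE'; field.
by rewrite gt_eqF.
Qed.
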